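(* Let $c\in(1,8/7)$, $\rho\in(0,\infty)$ and $\theta\in(0,c-1)$, and let $h(x)=\exp((\log x)^c)$. Then there exist $\chi=\chi(c)\in(0,\infty)$, depending only on $c$, and $C=C(c,\rho,\theta)\in(0,\infty)$, depending only on $c,\rho,\theta$, such that for every $N\in\mathbb{Z}_+$ and every $\xi\in\mathbb{R}$ with $h(N)^{-1}N^{\rho}\le|\xi|\le h(N)^{\theta}$ we have $$\Big|\sum_{N<n\le 2N}e\big(h(n)\xi\big)\Big|\le C N e^{-(\log N)^{\chi}}.$$
   Context: $\mathbb{Z}_+=\{1,2,3,\dots\}$, $e(x)=e^{2\pi i x}$, $\log$ is the natural logarithm, and the sum runs over integers $n$ with $N<n\le2N$. *)

(* Defs.v *)
From Stdlib Require Import Reals.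
From Coquelicot Require Import Coquelicot.

Open Scope R_scope.

(* [Rpower 0 a] is 1, because [ln 0] is 0 in Stdlib.  Here log 1 = 0 occurs as
   a base, with a positive exponent, so 0 ^ a has to be 0.  Only bases x >= 0
   are meaningful. *)
Definition rpow (x a : R) : R :=
  if Req_EM_T x 0 then 0 else Rpower x a.

Definition h (c x : R) : R := exp (rpow (ln x) c).

Definition e (x : R) : C := (cos (2 * PI * x), sin (2 * PI * x)).

(* Main.v *)
(* Write L = log N, g = L^(c-1), so that h(n) = exp (L_n^c) with L_n = log n, and
   h varies near n like a power with exponent lam = c L_n^(c-1), of size g.  Expanding
   h(n + z) in t = z/n gives, up to a negligible error, a polynomial in z of degree
   k ~ g whose coefficients are essentially the binomials of lam, and these do not
   vanish below lam.  Summing over the shifts z = x y with x, y <= M, where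
   M^2 ~ N^(1 - delta), reduces the sum to bilinear Weyl sums with polynomial phases.
   Hoelder's inequality in both variables and the double large sieve bound these by
   Vinogradov's mean value with s ~ k^3 variables and by one saving: if
   |xi| = N^(kappa - g), the coefficient of degree j0 with kappa + 1 <= j0 <= kappa + 2
   has size N^(kappa - j0), hence is less than N^(-1/2) and greater than a power of N
   times M^(-2 j0).  The relevant j0 is below lam because kappa <= (1 + theta) g and
   1 + theta < c.  The saving is N^(- delta / O(k^6)), that is,
   exp (- L^(1 - 6 (c-1)) / O(1)), and one further factor g = L^(c-1) absorbs the
   constant; so chi = 1 - 7 (c-1) = 8 - 7 c, positive for c < 8/7.  All losses in the
   mean value theorem are exp (O(k^7)), which is why k^7 must be small against L.  The
   mean value theorem itself is only needed with O(k^3) variables, and follows from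
   the classical p-adic recursion. *)

Require Import Defs.
From Stdlib Require Import Reals Lra.
From Coquelicot Require Import Coquelicot.
From mathcomp Require all_boot all_order all_fingroup all_algebra all_field.
From mathcomp Require all_classical all_reals Rstruct complex.
From mathcomp Require zify ring lra.

(** * Systems of power sums *)
Module PowerSums.
Import all_boot all_order all_fingroup all_algebra all_field.
Import zify ring.
Set Implicit Arguments. Unset Strict Implicit. Unset Printing Implicit Defensive.
Import Order.TTheory GRing.Theory Num.Theory.

Local Open Scope nat_scope.

(** The degree [k] grows with [N], so every constant that depends on [k] must be explicit; this is
    why the estimates carry their losses inside [exp]. Moments are counted as coincidences in finite
    types, and Hoelder's inequality for them comes from characters of [(Z/Q)^n] instead of
    integrals. [M] is a power of a prime [P], so that the recursion rescales exactly; a prime with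
    [ln P = O(k^3)] is small enough, since rounding [M] costs only a factor [P]. The delicate point
    is the lower bound for the coefficient of degree [j0], which may be a fixed proportion of [lam].
    With [l = ln (1 + t)], [h(n + z) / h(n)] is [(1 + t)^lam] times [exp y], where [y] collects the
    powers [l^2, l^3, ...]. Expanding [exp y] in [u = t / (1 + t)], the [i]-th correction
    contributes the binomial of [lam - i] over [j0 - i], at most [r^i] times the main one once
    [j0 <= r lam]. Hence only the series at one radius [r < 1] matters, chosen between
    [(1 + theta) / c] and [1]; its nonconstant part there is [O(L^(c - 2))]. *)

Definition coinc (T T' : finType) (V : eqType) (A : pred T) (B : pred T')
  (f : T -> V) (g : T' -> V) : nat :=
  \sum_(x | A x) \sum_(y | B y) (f x == g y).

Definition energy (T : finType) (V : eqType) (A : pred T) (f : T -> V) : nat :=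
  coinc A A f f.

Lemma coinc_fibers (T T' : finType) (V : eqType) (A : pred T) (B : pred T')
    (f : T -> V) (g : T' -> V) (vals : seq V) :
    uniq vals -> (forall x, f x \in vals) ->
  coinc A B f g = \sum_(v <- vals)
    (\sum_(x | A x) (f x == v)) * (\sum_(y | B y) (g y == v)).
Proof.
move=> Uv Hv; under [RHS]eq_bigr do rewrite big_distrlr.
rewrite exchange_big; apply: eq_bigr => x _; rewrite exchange_big.
apply: eq_bigr => y _; rewrite (bigD1_seq (f x)) //= eqxx mul1n [g y == _]eq_sym.
by rewrite big1 ?addn0 // => v; rewrite eq_sym => /negPf->.
Qed.

(** Fibrewise [2 m n <= m^2 + n^2]; this removes every mixed count below. *)
Lemma coinc_energy (T T' : finType) (V : eqType) (A : pred T) (B : pred T')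
    (f : T -> V) (g : T' -> V) :
  2 * coinc A B f g <= energy A f + energy B g.
Proof.
pose vals := undup (map f (enum T) ++ map g (enum T')).
have Uv : uniq vals by apply: undup_uniq.
have Hf x : f x \in vals by rewrite mem_undup mem_cat map_f ?mem_enum.
have Hg y : g y \in vals by rewrite mem_undup mem_cat orbC map_f ?mem_enum.
rewrite /energy !(coinc_fibers _ _ _ Uv) // big_distrr -big_split /=.
by apply: leq_sum => v _; rewrite !mulnn nat_Cauchy.
Qed.

(** Cauchy-Schwarz in disguise: the counted pairs are distributed over pairs of covering sets, and
    each mixed count is averaged by [coinc_energy]. The sets may overlap. *)
Lemma energy_cover (T I : finType) (V : eqType) (A : pred T) (Ai : I -> pred T)
    (f : T -> V) :
    (forall x, A x -> exists i, Ai i x) ->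
  energy A f <= #|I| * \sum_i energy (Ai i) f.
Proof.
move=> HA; rewrite -(leq_pmul2l (isT : 0 < 2)).
have cov (F : T -> nat) : \sum_(x | A x) F x <= \sum_i \sum_(x | Ai i x) F x.
  under [X in _ <= X]eq_bigr do rewrite big_mkcond.
  rewrite exchange_big big_mkcond /=; apply: leq_sum => x _.
  case: ifP => // /HA[i Hi]; rewrite (bigD1 i) //= Hi; exact: leq_addr.
apply: (@leq_trans (2 * \sum_i \sum_j coinc (Ai i) (Ai j) f f)).
  rewrite leq_mul2l /=; apply: leq_trans (cov _) _; apply: leq_sum => i _.
  rewrite [X in _ <= X]exchange_big; apply: leq_sum => x _; exact: cov.
rewrite big_distrr /=.
apply: (@leq_trans (\sum_i \sum_j (energy (Ai i) f + energy (Ai j) f))).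
  apply: leq_sum => i _; rewrite big_distrr; apply: leq_sum => j _.
  exact: coinc_energy.
under eq_bigr do rewrite big_split sum_nat_const /=.
rewrite big_split /= -big_distrr sum_nat_const /= addnn -muln2 mulnC mulnA.
by rewrite (mulnC 2).
Qed.

Lemma leq_sum_inj (T T' : finType) (A : pred T) (A' : pred T') (h : T -> T')
    (F : T -> nat) (G : T' -> nat) :
    {in A &, injective h} -> (forall x, A x -> A' (h x)) ->
    (forall x, A x -> F x <= G (h x)) ->
  \sum_(x | A x) F x <= \sum_(y | A' y) G y.
Proof.
move=> hI hA hF; apply: leq_trans (_ : \sum_(x in A) G (h x) <= _).
  exact: leq_sum.
rewrite -(big_imset G hI) /=; rewrite [X in _ <= X](bigID (mem (h @: A))) /=.
apply: leq_trans (leq_addr _ _); rewrite (eq_bigl (fun y => A' y && (y \in h @: A))) //.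
move=> y; rewrite andbC; case: (boolP (y \in _)) => //= /imsetP[x Ax ->].
by rewrite hA.
Qed.

Lemma energy_inj (T T' : finType) (V V' : eqType) (A : pred T) (A' : pred T')
    (h : T -> T') (f : T -> V) (f' : T' -> V') :
    {in A &, injective h} -> (forall x, A x -> A' (h x)) ->
    (forall x y, A x -> A y -> f x = f y -> f' (h x) = f' (h y)) ->
  energy A f <= energy A' f'.
Proof.
move=> hI hA hf; apply: (leq_sum_inj (h := h)) => // x Ax.
apply: (leq_sum_inj (h := h)) => // y Ay.
by case: eqP => // /hf -> //; rewrite eqxx.
Qed.

(** * Finite Fourier analysis and Hoelder's inequality for energies *)

Local Open Scope ring_scope.

Lemma prim_root_orth (Q u v : nat) (z : algC) :
    Q.-primitive_root z -> (u < Q)%N -> (v < Q)%N ->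
  \sum_(a < Q) z ^+ (a * u) * (z ^+ (a * v))^* = (Q%:R *+ (u == v) : algC).
Proof.
move=> pz uQ vQ; have Q0 := prim_order_gt0 pz.
have z1 : `|z| = 1.
  apply/eqP; rewrite -(@pexpr_eq1 _ _ Q) ?normr_ge0 // -normrX.
  by rewrite prim_expr_order ?normr1.
have zzc n : z ^+ n * (z ^+ n)^* = 1.
  by rewrite -normCK normrX z1 !expr1n.
pose w := z ^+ u * (z ^+ v)^*.
have -> : \sum_(a < Q) z ^+ (a * u) * (z ^+ (a * v))^* = \sum_(a < Q) w ^+ a.
  apply: eq_bigr => a _; rewrite /w exprMn -!exprM -rmorphXn -exprM.
  by rewrite [(u * a)%N]mulnC [(v * a)%N]mulnC.
have wQ : w ^+ Q = 1.
  rewrite /w exprMn -rmorphXn -!exprM mulnC [(v * Q)%N]mulnC !exprM.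
  by rewrite (prim_expr_order pz) !expr1n rmorph1 mulr1.
case: (eqVneq u v) => [uv|uv].
  rewrite /w uv zzc; under eq_bigr do rewrite expr1n.
  by rewrite sumr_const card_ord.
have w1 : w != 1.
  apply/eqP => w1; case/negP: uv; move: (eq_prim_root_expr pz u v).
  rewrite !modn_small // => <-.
  apply/eqP; rewrite -[LHS]mulr1 -(zzc v) [z ^+ v * _]mulrC mulrA.
  by rewrite -/w w1 mul1r.
apply/eqP; rewrite mulr0n -(mulrI_eq0 _ (mulfI (_ : w - 1 != 0))) ?subr_eq0 //.
by rewrite -subrX1 wQ subrr.
Qed.

Section Fourier.
Variables (n Q : nat) (z : algC).
Hypothesis pz : Q.-primitive_root z.

(** The additive character of [(Z/Q)^n] with frequency [a]. *)
Definition chr (a : {ffun 'I_n -> 'I_Q}) (v : 'I_n -> nat) : algC :=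
  \prod_j z ^+ (a j * v j).

Lemma chrD a u v : chr a (fun j => u j + v j)%N = chr a u * chr a v.
Proof.
by rewrite /chr -big_split; apply: eq_bigr => j _; rewrite mulnDr exprD.
Qed.

Lemma chr_sum (I : finType) a (v : I -> 'I_n -> nat) :
  chr a (fun j => \sum_i v i j)%N = \prod_i chr a (v i).
Proof.
rewrite /chr exchange_big; apply: eq_bigr => j _.
by rewrite big_distrr /= expr_sum.
Qed.

Lemma chr_orth (u v : {ffun 'I_n -> nat}) :
    (forall j, u j < Q)%N -> (forall j, v j < Q)%N ->
  \sum_a chr a u * (chr a v)^* = (Q ^ n)%:R *+ (u == v).
Proof.
move=> uQ vQ; rewrite /chr.
under eq_bigr do rewrite rmorph_prod -big_split /=.
rewrite -(bigA_distr_bigA (fun (j : 'I_n) (b : 'I_Q) => z ^+ (b * u j) * (z ^+ (b * v j))^*)) /=.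
rewrite (eq_bigr (fun j => Q%:R *+ (u j == v j))); last first.
  by move=> j _; rewrite prim_root_orth.
case: eqP => [->|uv].
  by under eq_bigr do rewrite eqxx; rewrite prodr_const card_ord natrX.
have [j /negPf uvj] : exists j, u j != v j.
  apply/existsP; rewrite -negb_forall; apply/negP => /forallP uv'.
  by apply: uv; apply/ffunP => j; apply/eqP.
by rewrite (bigD1 j) //= uvj mul0r.
Qed.

(** Parseval: all values lie below [Q], so congruence modulo [Q] is equality and orthogonality
    isolates the coincidences. *)
Lemma energy_fourier (T : finType) (A : pred T) (f : T -> {ffun 'I_n -> nat}) :
    (forall x, A x -> forall j, f x j < Q)%N ->
  (Q ^ n * energy A f)%:R = \sum_a `|\sum_(x | A x) chr a (f x)| ^+ 2 :> algC.
Proof.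
move=> fQ; rewrite /energy /coinc natrM natr_sum big_distrr /=.
rewrite [RHS](eq_bigr (fun a => \sum_(x | A x) \sum_(y | A y)
  chr a (f x) * (chr a (f y))^*)); last first.
  by move=> a _; rewrite normCK rmorph_sum big_distrlr.
rewrite exchange_big; apply: eq_bigr => x Ax.
rewrite natr_sum big_distrr exchange_big; apply: eq_bigr => y Ay.
rewrite chr_orth; [|exact: fQ|exact: fQ].
by rewrite /= mulr_natr.
Qed.

End Fourier.

(** Arithmetic-geometric mean for the numbers [a i ^+ t]; the gain [1 / t] of the mean is given
    away. *)
Lemma prod_le_sum_pow (t : nat) (a : 'I_t -> algC) :
  (0 < t)%N -> (forall i, 0 <= a i) -> \prod_i a i <= \sum_i a i ^+ t.
Proof.
move=> t0 a0; have S0 : 0 <= \sum_i a i ^+ t.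
  by apply: sumr_ge0 => i _; apply: exprn_ge0.
rewrite -(@ler_pXn2r _ t) ?nnegrE ?prodr_ge0 // -prodrXl.
have := @leif_AGM algC _ 'I_t (fun i => a i ^+ t) (fun i _ => exprn_ge0 t (a0 i)).
case=> H _; apply: le_trans H _; rewrite card_ord.
apply: lerXn2r; rewrite ?nnegrE //.
  by rewrite divr_ge0 // ler0n.
by rewrite ler_pdivrMr ?ltr0n // ler_peMr // ler1n.
Qed.

(* Hoelder's inequality for the moments of exponential sums. *)
Lemma energy_holder (n t : nat) (D X : finType) (A : pred D) (B : 'I_t -> pred X)
    (f : D -> {ffun 'I_n -> nat}) (g : X -> {ffun 'I_n -> nat})
    (F := fun z : D * {ffun 'I_t -> X} =>
            [ffun j => f z.1 j + \sum_i g (z.2 i) j]%N) :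
    (0 < t)%N ->
  (energy (fun z : D * {ffun 'I_t -> X} => A z.1 && [forall i, B i (z.2 i)]) F <=
    \sum_i0 energy (fun z : D * {ffun 'I_t -> X} => A z.1 && [forall i, B i0 (z.2 i)]) F)%N.
Proof.
move=> t0.
(* A modulus above all values of [F], so that nothing wraps around. *)
pose Q := (\sum_z \sum_j F z j).+1.
have FQ x j : (F x j < Q)%N.
  rewrite ltnS (bigD1 x) //= (bigD1 j) //=.
  by rewrite -addnA; apply: leq_addr.
have Q0 : (0 < Q)%N by [].
move: {+}Q Q0 FQ => {}Q Q0 FQ.
have [z pz] := C_prim_root_exists Q0.
have Fsum (C : 'I_t -> pred X) a :
   \sum_(x : D * {ffun 'I_t -> X} | A x.1 && [forall i, C i (x.2 i)]) chr z (a : {ffun 'I_n -> 'I_Q}) (F x) =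
   (\sum_(d | A d) chr z a (f d)) * \prod_i \sum_(x | C i x) chr z a (g x).
  have -> : \prod_i \sum_(x | C i x) chr z a (g x) =
      \sum_(x : {ffun 'I_t -> X} | [forall i, C i (x i)]) \prod_i chr z a (g (x i)).
    under eq_bigr do rewrite big_mkcond.
    rewrite bigA_distr_bigA [RHS]big_mkcond; apply: eq_bigr => x _.
    case: forallP => Cx; first by apply: eq_bigr => i _; rewrite Cx.
    have [i /negPf Ci] : exists i, ~~ C i (x i).
      by apply/existsP; rewrite -negb_forall; apply/forallP.
    by rewrite (bigD1 i) //= Ci mul0r.
  rewrite big_distrlr pair_big /=; apply: eq_bigr => x _.
  rewrite -chr_sum -chrD /chr; apply: eq_bigr => j _; by rewrite ffunE.
rewrite -(ler_nat algC) -(ler_pM2l (_ : 0 < (Q ^ n)%:R)) ?ltr0n ?expn_gt0 ?Q0 //.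
rewrite -!natrM [X in (_ <= X%:R)]big_distrr [X in _ <= X]natr_sum (energy_fourier pz); last by move=> *; apply: FQ.
rewrite (eq_bigr (fun i0 => \sum_a `|\sum_(x : D * {ffun 'I_t -> X} | A x.1 && [forall i, B i0 (x.2 i)])
  chr z (a : {ffun 'I_n -> 'I_Q}) (F x)| ^+ 2)); last first.
  by move=> i _; rewrite (energy_fourier pz) // => *; apply: FQ.
rewrite exchange_big; apply: ler_sum => a _.
rewrite Fsum.
under [X in _ <= X]eq_bigr => i0 _.
  rewrite (Fsum (fun=> B i0)) prodr_const card_ord normrM normrX exprMn.
  rewrite -exprM mulnC exprM.
  over.
rewrite -big_distrr /= normrM exprMn ler_wpM2l ?exprn_ge0 //.
(* The inequality holds pointwise in the frequency [a]: a product over classes is at most the sum of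
   the pure powers. *)
rewrite normr_prod -prodrXl; apply: prod_le_sum_pow => // i.
by rewrite exprn_ge0.
Qed.

(** * Lifting power sums modulo prime powers *)

Lemma vandermonde_ker (F : fieldType) (k : nat) (b d : 'I_k -> F) :
    injective b -> (forall l : 'I_k, \sum_i b i ^+ l * d i = 0) ->
  forall i, d i = 0.
Proof.
move=> bI Hd i.
(* A test polynomial of degree below [k] that vanishes at every node except [b i]; the hypothesis
   pairs it with [d] to zero. *)
pose H := \prod_(j in predC1 i) ('X - (b j)%:P).
have sH : (size H <= k)%N.
  by rewrite /H -big_enum size_prod_XsubC -cardE cardC1 card_ord prednK // (leq_ltn_trans _ (ltn_ord i)).
have : \sum_j H.[b j] * d j = 0.
  under eq_bigr => j _ do rewrite (horner_coef_wide _ sH) mulr_suml.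
  rewrite exchange_big big1 // => l _.
  by under eq_bigr do rewrite -mulrA; rewrite -mulr_sumr Hd mulr0.
rewrite (bigD1 i) //= big1 => [|j ji]; last first.
  by rewrite /H horner_prod (bigD1 j) //= hornerXsubC subrr !mul0r.
move/eqP; rewrite addr0 mulf_eq0 => /orP[|/eqP//].
rewrite /H horner_prod => /prodf_eq0[j ji].
by rewrite hornerXsubC subr_eq0 => /eqP/bI/eqP; rewrite eq_sym (negPf ji).
Qed.

Lemma exprD_trunc2 (b h : int) (j : nat) :
  exists r, (b + h) ^+ j = b ^+ j + b ^+ j.-1 * h *+ j + r * h ^+ 2.
Proof.
elim: j => [|j [r IH]]; first by exists 0; rewrite mulr0n; ring.
case: j IH => [|j] IH.
  by exists 0; rewrite mulr1n; ring.
exists (b ^+ j *+ j.+1 + r * (b + h)).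
rewrite exprS IH /= [b ^+ j.+2]exprS [_ *+ j.+2]mulrSr [b ^+ j.+1]exprS.
rewrite -[b ^+ j *+ _]mulr_natr -[b ^+ j * h *+ _]mulr_natr -[b * b ^+ j * h *+ _]mulr_natr.
move: (b ^+ j) (j.+1%:R : int) => B n; ring.
Qed.

(** Hensel's lemma for the power-sum map: its Jacobian is [k!] times a Vandermonde determinant, a
    unit modulo [P] because the [b i] are distinct modulo [P] and [k < P]. Write [b' = b + d h] with
    [h = P^(e - 1)]; modulo [P h] only the terms linear in [d] survive, and they form a Vandermonde
    system for [d] modulo [P]. *)
Lemma powersum_lift (P k e : nat) (b b' : 'I_k -> int) :
    prime P -> (k < P)%N ->
    (forall i j, i != j -> ~~ (P%:Z %| b i - b j)%Z) ->
    (forall i, (P%:Z %| b' i - b i)%Z) ->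
    (forall j : 'I_k, ((P ^ e)%:Z %| \sum_i b' i ^+ j.+1 - \sum_i b i ^+ j.+1)%Z) ->
  forall i, ((P ^ e)%:Z %| b' i - b i)%Z.
Proof.
move=> pP kP bI b'b.
have P0 : P%:Z != 0 by rewrite -lt0n prime_gt0.
elim: e => [|[|e] IH] Hs i; rewrite ?dvd1z ?expn1 //.
have {}IH : forall i, ((P ^ e.+1)%:Z %| b' i - b i)%Z.
  apply: IH => j; apply: dvdz_trans (Hs j).
  by rewrite [in X in (_ %| X)%Z]expnS PoszM dvdz_mull.
pose h := (P ^ e.+1)%:Z; have h0 : h != 0 by rewrite -lt0n expn_gt0 prime_gt0.
pose d i := ((b' i - b i) %/ h)%Z.
have b'E j : b' j = b j + d j * h.
  by rewrite /d divzK ?IH // addrC subrK.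
have ph : (P%:Z %| h)%Z by rewrite /h expnS PoszM dvdz_mulr.
suff Hd : forall j, (P%:Z %| d j)%Z.
  by rewrite b'E addrC addKr expnS PoszM dvdz_mul.
have chP : P \in [pchar 'F_P] by apply: pchar_Fp.
move=> j0; rewrite (dvdz_pcharf chP); apply/eqP.
move: j0; apply: (@vandermonde_ker _ _ (fun i => (b i)%:~R)).
  move=> j1 j2 /eqP; apply: contraTeq => /bI.
  by rewrite (dvdz_pcharf chP) rmorphB subr_eq0.
move=> l.
have : (P%:Z * h %| (\sum_i b i ^+ l * d i) * l.+1%:Z * h)%Z.
  have : (P%:Z * h %| \sum_i (b i ^+ l * d i * l.+1%:Z * h))%Z.
    have := Hs l; rewrite [in X in (X %| _)%Z]expnS PoszM -/h -sumrB.
    move=> Hl; pose w j := b' j ^+ l.+1 - b j ^+ l.+1 - b j ^+ l * d j * l.+1%:Z * h.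
    rewrite (eq_bigr (fun j => (b' j ^+ l.+1 - b j ^+ l.+1) - w j)); last first.
      by move=> j _; rewrite /w opprB addrC subrK.
    rewrite sumrB; apply: rpredB => //; apply: rpred_sum => j _; rewrite /w.
    have [r /= Er] := exprD_trunc2 (b j) (d j * h) l.+1.
    rewrite b'E Er.
    have -> : b j ^+ l.+1 + b j ^+ l * (d j * h) *+ l.+1 + r * (d j * h) ^+ 2 -
      b j ^+ l.+1 - b j ^+ l * d j * l.+1%:Z * h = r * d j ^+ 2 * h * h.
      by rewrite -[_ *+ l.+1]mulr_natr natz; move: (b j ^+ l) (l.+1%:Z) => *; ring.
    by rewrite dvdz_mul // dvdz_mull.
  by rewrite -!mulr_suml.
rewrite [(P%:Z * h)%R]mulrC [X in (_ %| X)%Z]mulrC dvdz_mul2l // => H.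
have := H; rewrite Gauss_dvdzl; last first.
  rewrite coprimezE !absz_nat prime_coprime // gtnNdvd //.
  exact: leq_ltn_trans (ltn_ord l) kP.
rewrite (dvdz_pcharf chP) rmorph_sum => /eqP H0.
  rewrite -[RHS]H0.
by apply: eq_bigr => j _; rewrite rmorphM rmorphXn.
Qed.

Local Open Scope nat_scope.

Definition distinct_mod (P k X : nat) (d : 'I_k -> 'I_X) : bool :=
  [forall i, forall j, (i != j) ==> (d i != d j %[mod P])].

Definition shifted_psum (k X c : nat) (d : 'I_k -> 'I_X) (j : nat) : int :=
  (\sum_i ((d i)%:Z - c%:Z) ^+ j)%R.

Lemma eqz_mod_nat (P m n : nat) : (P%:Z %| (m%:Z - n%:Z)%R)%Z = (m == n %[mod P]).
Proof. by rewrite -eqz_mod_dvd !modz_nat eqz_nat. Qed.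

(** Linnik's lemma. Record [d] by its residues modulo [P] and its power sums modulo [q ^ k]. The
    congruence of degree [j + 1] leaves [q ^ (k - j - 1)] values for the latter, [q ^ 'C(k, 2)] over
    all degrees. By [powersum_lift] the record determines [d] modulo [q ^ k], hence [d] itself since
    [X <= q ^ k]. *)
Lemma card_distinct_mod (P a k X c : nat) (q := P ^ a) (d0 : 'I_k -> 'I_X) :
    prime P -> k < P -> 0 < a -> X <= q ^ k ->
  \sum_(d : {ffun 'I_k -> 'I_X} | distinct_mod P d &&
      [forall j : 'I_k, ((q ^ j.+1)%:Z %|
         (shifted_psum c d j.+1 - shifted_psum c d0 j.+1)%R)%Z]) 1
    <= P ^ k * q ^ 'C(k, 2).
Proof.
move=> pP kP a0 Xq.
have P0 := prime_gt0 pP.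
have q0 : 0 < q by rewrite expn_gt0 P0.
have qn0 n : 0 < q ^ n by rewrite expn_gt0 q0.
have qk0 := qn0 k.
pose D (d : {ffun 'I_k -> 'I_X}) j : int := (shifted_psum c d j - shifted_psum c d0 j)%R.
(* The residue of the difference from [d0]. It is divisible by [q ^ j], so the map [h] stores only
   its quotient. *)
pose u d j := `|(D d j %% (q ^ k)%:Z)%Z|%N.
have uE d j : Posz (u d j) = (D d j %% (q ^ k)%:Z)%Z.
  by rewrite /u gez0_abs // modz_ge0 // eqz_nat -lt0n.
have u_lt d j : u d j < q ^ k.
  by rewrite -ltz_nat uE ltz_pmod // ltz_nat.
have v_lt d j : u d j %/ q ^ j < q ^ k.
  by apply: leq_ltn_trans (leq_div _ _) (u_lt d j).
pose h (d : {ffun 'I_k -> 'I_X}) :=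
  ([ffun i => Ordinal (ltn_pmod (d i) P0)] : {ffun 'I_k -> 'I_P},
   [ffun j : 'I_k => Ordinal (v_lt d j.+1)] : {ffun 'I_k -> 'I_(q ^ k)}).
pose Fm (j : 'I_k) : pred 'I_(q ^ k) := fun v => v < q ^ (k - j.+1).
apply: (@leq_trans (\sum_(z : {ffun 'I_k -> 'I_P} * {ffun 'I_k -> 'I_(q ^ k)} |
    z.2 \in family Fm) 1)); last first.
  rewrite sum1_card; apply: (@leq_trans #|setX [set: {ffun 'I_k -> 'I_P}]
     [set v : {ffun 'I_k -> 'I_(q ^ k)} | v \in family Fm]|).
    by apply/subset_leq_card/subsetP => z; rewrite !inE.
  rewrite cardsX cardsT card_ffun !card_ord cardsE leq_mul2l; apply/orP; right.
  rewrite (card_family Fm) foldrE big_image /=.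
  rewrite (eq_bigr (fun j : 'I_k => q ^ rev_ord j)) => [|j _]; last first.
    rewrite -sum1_card /Fm -(big_ord_widen _ (fun=> 1)); last first.
      by rewrite leq_pexp2l // leq_subr.
    by rewrite sum1_card card_ord.
  rewrite [X in X <= _](_ : _ = \prod_(j < k) q ^ j).
    by rewrite -expn_sum -bin2_sum big_mkord.
  by rewrite [RHS](reindex_inj rev_ord_inj).
have qj j : j < k -> ((q ^ j.+1)%:Z %| (q ^ k)%:Z)%Z.
  by move=> jk; rewrite dvdzE /= dvdn_exp2l.
apply: (leq_sum_inj (h := h)) => //; last first.
  move=> d /andP[_ /forallP Hd]; apply/familyP => j.
  rewrite unfold_in /= ffunE /= ltn_divLR //.
  by rewrite -expnD subnK ?u_lt.
move=> d d'; rewrite !unfold_in => /andP[/forallP dd /forallP Dd].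
move=> /andP[_ /forallP Dd'] [/ffunP hP /ffunP hv].
have qu (e : {ffun 'I_k -> 'I_X}) (j : 'I_k) :
   ((q ^ j.+1)%:Z %| D e j.+1)%Z -> q ^ j.+1 %| u e j.+1.
  move=> He; have : ((q ^ j.+1)%:Z %| (u e j.+1)%:Z)%Z; last by rewrite dvdzE.
  rewrite uE; have := divz_eq (D e j.+1) (q ^ k)%:Z => /(canLR (addKr _)) <-.
  by rewrite addrC rpredB // dvdz_mull // qj.
have uu (j : 'I_k) : u d j.+1 = u d' j.+1.
  have := congr1 val (hv j); rewrite !ffunE /= => E.
  by rewrite -(divnK (qu _ _ (Dd j))) -(divnK (qu _ _ (Dd' j))) E.
have bI (i j : 'I_k) : i != j -> ~~ (P%:Z %| (((d i)%:Z - c%:Z) - ((d j)%:Z - c%:Z))%R)%Z.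
  move=> ij; rewrite opprB addrA subrK eqz_mod_nat.
  by have /forallP/(_ j)/implyP/(_ ij) := dd i.
have bb (i : 'I_k) : (P%:Z %| (((d' i)%:Z - c%:Z) - ((d i)%:Z - c%:Z))%R)%Z.
  rewrite opprB addrA subrK eqz_mod_nat; apply/eqP.
  by have := congr1 val (hP i); rewrite !ffunE /=.
have Hs (j : 'I_k) : ((P ^ (a * k))%:Z %|
    (\sum_i ((d' i)%:Z - c%:Z) ^+ j.+1 - \sum_i ((d i)%:Z - c%:Z) ^+ j.+1)%R)%Z.
  rewrite expnM -/q.
  have -> : (\sum_i ((d' i)%:Z - c%:Z) ^+ j.+1 - \sum_i ((d i)%:Z - c%:Z) ^+ j.+1 =
     D d' j.+1 - D d j.+1)%R by rewrite /D /shifted_psum; ring.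
  by rewrite -eqz_mod_dvd -!uE uu.
apply/ffunP => i; apply/val_inj.
have := powersum_lift pP kP bI bb Hs i.
rewrite opprB addrA subrK eqz_mod_nat expnM -/q.
rewrite !modn_small ?(leq_trans (ltn_ord _)) //.
by move/eqP.
Qed.

(** * Mean values split by residue classes *)

Definition psums (k s X : nat) (x : {ffun 'I_s -> 'I_X}) : {ffun 'I_k.+1 -> nat} :=
  [ffun j : 'I_k.+1 => \sum_i x i ^ j].

(* Vinogradov's J_{s,k}(X); the equation of degree 0 is vacuous. *)
Definition vino (k s X : nat) : nat := energy predT (@psums k s X).

(** The nested finite functions make this convertible to the [F] of [energy_holder]. *)
Definition pair_psums (k s t X : nat)
    (z : {ffun 'I_s -> 'I_X} * {ffun 'I_t -> 'I_X}) : {ffun 'I_k.+1 -> nat} :=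
  [ffun j : 'I_k.+1 => psums k z.1 j + \sum_i [ffun l : 'I_k.+1 => z.2 i ^ l] j].

Lemma pair_psumsE (k s t X : nat) (z : {ffun 'I_s -> 'I_X} * {ffun 'I_t -> 'I_X})
    (j : 'I_k.+1) :
  pair_psums k z j = \sum_i z.1 i ^ j + \sum_i z.2 i ^ j.
Proof.
by rewrite !ffunE; congr addn; apply: eq_bigr => i _; rewrite ffunE.
Qed.

Lemma sum_pair_split (D X : finType) (A : pred D) (B : pred X) (G : D * X -> nat) :
  \sum_(z | A z.1 && B z.2) G z = \sum_(d | A d) \sum_(x | B x) G (d, x).
Proof. by rewrite pair_big; apply: eq_bigr => -[]. Qed.

Lemma PoszD_sum (I : finType) (f : I -> nat) (j : nat) :
  Posz (\sum_i f i ^ j) = (\sum_i (f i)%:Z ^+ j)%R.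
Proof.
by rewrite -natz natr_sum; apply: eq_bigr => i _; rewrite natrX natz.
Qed.

(** The binomial theorem expresses shifted sums by those of lower or equal degree. Degree 0 enters
    too: its equation says that both families have the same number of terms. *)
Lemma psum_shift (I I' : finType) (x : I -> int) (y : I' -> int) (c : int) (k : nat) :
    (forall j, j <= k -> (\sum_i x i ^+ j = \sum_i y i ^+ j)%R) ->
  (forall j, j <= k -> (\sum_i (x i - c) ^+ j = \sum_i (y i - c) ^+ j)%R).
Proof.
move=> Hxy j jk.
have E (J : finType) (z : J -> int) : (\sum_i (z i - c) ^+ j =
    \sum_(l < j.+1) (\sum_i z i ^+ (j - l)) * ((-1) ^+ l * c ^+ l *+ 'C(j, l)))%R.
  under eq_bigr do rewrite exprBn.
  rewrite exchange_big; apply: eq_bigr => l _ /=.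
  rewrite mulr_suml; apply: eq_bigr => i _.
  by rewrite -!mulrnAr mulrCA mulrA.
rewrite !E; apply: eq_bigr => l _; rewrite Hxy //.
by apply: leq_trans jk; apply: leq_subr.
Qed.

(** After translation by [c] the second block has its sum of degree [j] divisible by [q ^ j]. The
    first blocks of a coincidence therefore satisfy the congruences of [card_distinct_mod]: at most
    [X ^ k] choices for one of them, then [P ^ k * q ^ 'C(k, 2)] for the other. With both fixed,
    dividing by [q ^ j] leaves an inhomogeneous system on [[0, P ^ (m - a))], which has at most as
    many solutions as the homogeneous one. *)
Lemma energy_class_le (P a k t m c : nat) (q := P ^ a) (X := P ^ m) :
    prime P -> k < P -> 0 < a <= m -> X <= q ^ k ->
  energy (fun z : {ffun 'I_k -> 'I_X} * {ffun 'I_t -> 'I_X} =>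
     distinct_mod P z.1 && [forall i, z.2 i %% q == c]) (@pair_psums k k t X)
  <= X ^ k * (P ^ k * q ^ 'C(k, 2)) * vino k t (P ^ (m - a)).
Proof.
move=> pP kP /andP[a0 am] Xq.
have P0 := prime_gt0 pP.
have q0 : 0 < q by rewrite expn_gt0 P0.
pose S := @shifted_psum k X c.
pose cong (d d' : {ffun 'I_k -> 'I_X}) :=
  [forall j : 'I_k, ((q ^ j.+1)%:Z %| (S d j.+1 - S d' j.+1)%R)%Z].
pose Bx (x : {ffun 'I_t -> 'I_X}) := [forall i, x i %% q == c].
pose Y := P ^ (m - a).
have XE : X = Y * q by rewrite /X /Y /q -expnD subnK.
have hlt (x : 'I_X) : x %/ q < Y by rewrite ltn_divLR // -XE.
pose h (x : {ffun 'I_t -> 'I_X}) : {ffun 'I_t -> 'I_Y} :=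
  [ffun i => Ordinal (hlt (x i))].
have hI : {in Bx &, injective h}.
  move=> x y /forallP Hx /forallP Hy /ffunP Hh; apply/ffunP => i; apply/val_inj => /=.
  rewrite (divn_eq (x i) q) (divn_eq (y i) q) (eqP (Hx i)) (eqP (Hy i)).
  by have := congr1 val (Hh i); rewrite !ffunE /= => ->.
pose f1 (u : {ffun 'I_t -> 'I_Y}) : {ffun 'I_k.+1 -> int} :=
  [ffun j : 'I_k.+1 => \sum_i (u i)%:Z ^+ j]%R.
pose f2 (w : nat -> int) (u : {ffun 'I_t -> 'I_Y}) : {ffun 'I_k.+1 -> int} :=
  [ffun j : 'I_k.+1 => w j + \sum_i (u i)%:Z ^+ j]%R.
have psE (u v : {ffun 'I_t -> 'I_Y}) :
    (forall j : 'I_k.+1, \sum_i (u i)%:Z ^+ j = \sum_i (v i)%:Z ^+ j)%R ->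
    psums k u = psums k v.
  move=> Huv; apply/ffunP => j; rewrite !ffunE; apply/eqP; rewrite -eqz_nat.
  by rewrite !PoszD_sum; apply/eqP; apply: Huv.
have inner (d d' : {ffun 'I_k -> 'I_X}) :
    \sum_(x | Bx x) \sum_(x' | Bx x') (pair_psums k (d, x) == pair_psums k (d', x'))
    <= cong d d' * vino k t Y.
  have key x x' : Bx x -> Bx x' -> pair_psums k (d, x) = pair_psums k (d', x') ->
     forall j, j <= k -> (S d j - S d' j =
       (q ^ j)%:Z * (\sum_i (h x' i)%:Z ^+ j - \sum_i (h x i)%:Z ^+ j))%R.
    move=> Hx Hx' /ffunP E j jk.
    pose y (d : {ffun 'I_k -> 'I_X}) (x : {ffun 'I_t -> 'I_X}) (i : 'I_k + 'I_t) : int :=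
      match i with inl i => d i | inr i => x i end.
    have Ey l : l <= k -> (\sum_i y d x i ^+ l = \sum_i y d' x' i ^+ l)%R.
      move=> lk; rewrite !big_sumType /= -!PoszD_sum -!PoszD; congr Posz.
      by have := E (Ordinal (lk : l < k.+1)); rewrite !pair_psumsE.
    have qx z : Bx z -> (\sum_i ((z i)%:Z - c%:Z) ^+ j = (q ^ j)%:Z * \sum_i (h z i)%:Z ^+ j)%R.
      move=> /forallP Hz; rewrite mulr_sumr; apply: eq_bigr => i _.
      rewrite ffunE /= -[Posz (q ^ j)]natz natrX natz -exprMn; congr (_ ^+ _)%R.
      rewrite {1}(divn_eq (z i) q) (eqP (Hz i)) PoszD PoszM; ring.
    have := psum_shift (Posz c) Ey jk; rewrite !big_sumType /= !qx // => H.
    by rewrite mulrBr; apply/eqP; rewrite subr_eq addrAC eq_sym subr_eq addrC -H.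
  case: (boolP (cong d d')) => [dd|Ndd]; last first.
    rewrite mul0n leqn0; apply/eqP; rewrite big1 // => x Hx; rewrite big1 // => x' Hx'.
    case: eqP => // /key Hk; case/negP: Ndd; apply/forallP => j.
    by rewrite Hk // dvdz_mulr.
  (* [w] is the right-hand side of the inhomogeneous system. A translate of [f1] has the same energy
     as [f1], so [coinc_energy] disposes of it. *)
  rewrite mul1n; pose w j := ((S d' j - S d j) %/ (q ^ j)%:Z)%Z.
  apply: (@leq_trans (coinc predT predT f1 (f2 w))).
    apply: (leq_sum_inj (h := h)) => // x Hx.
    apply: (leq_sum_inj (h := h)) => // x' Hx'.
    case: eqP => // /key Hk; rewrite (_ : f1 _ == _) //.
    apply/eqP/ffunP => j; rewrite !ffunE /w -opprB Hk //; last by rewrite -ltnS.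
    rewrite -mulrN mulKz; last by rewrite eqz_nat expn_eq0 negb_and -lt0n q0.
    by rewrite opprB subrK.
  rewrite -(leq_pmul2l (isT : 0 < 2)); apply: leq_trans (coinc_energy _ _ _ _) _.
  rewrite mul2n -addnn; apply: leq_add.
    apply: (energy_inj (h := id)) => // u v _ _ /ffunP Huv; apply: psE => j.
    by have := Huv j; rewrite !ffunE.
  apply: (energy_inj (h := id)) => // u v _ _ /ffunP Huv; apply: psE => j.
  by have := Huv j; rewrite !ffunE => /addrI.
rewrite /energy /coinc.
have split (G : {ffun 'I_k -> 'I_X} * {ffun 'I_t -> 'I_X} -> nat) :
    \sum_(z : {ffun 'I_k -> 'I_X} * {ffun 'I_t -> 'I_X} | distinct_mod P z.1 && [forall i, z.2 i %% q == c]) G z =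
    \sum_(d : {ffun 'I_k -> 'I_X} | distinct_mod P d) \sum_(x | Bx x) G (d, x).
  exact: (sum_pair_split (fun d : {ffun 'I_k -> 'I_X} => distinct_mod P d) Bx).
rewrite split.
apply: (@leq_trans (\sum_(d : {ffun 'I_k -> 'I_X} | distinct_mod P d)
   \sum_(d' : {ffun 'I_k -> 'I_X} | distinct_mod P d') cong d d' * vino k t Y)).
  apply: leq_sum => d _.
  under eq_bigr => x _.
    rewrite split.
    over.
  rewrite exchange_big; apply: leq_sum => d' _; exact: inner.
rewrite exchange_big /=.
under eq_bigr => d' _ do rewrite -big_distrl.
rewrite -big_distrl leq_mul2r; apply/orP; right.
apply: (@leq_trans (\sum_(d' : {ffun 'I_k -> 'I_X} | distinct_mod P d') P ^ k * q ^ 'C(k, 2))).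
  apply: leq_sum => d' _.
  apply: leq_trans (card_distinct_mod c d' pP kP a0 Xq).
  rewrite [X in _ <= X]big_mkcondr; apply: leq_sum => d _.
  by rewrite -/S -/(cong d d'); case: (cong d d').
rewrite sum_nat_const leq_mul2r; apply/orP; right.
by apply: leq_trans (max_card _) _; rewrite card_ffun !card_ord.
Qed.

(** The residues modulo [q] of the second block form [q ^ t] patterns, and [energy_cover] pays for
    them twice. [energy_holder] replaces a pattern by a single common residue; the factor [t] is the
    [1 / t] given away there. *)
Lemma energy_distinct_le (P a k t m : nat) (q := P ^ a) (X := P ^ m) :
    prime P -> k < P -> 0 < a <= m -> X <= q ^ k -> 0 < t ->
  energy (fun z : {ffun 'I_k -> 'I_X} * {ffun 'I_t -> 'I_X} => distinct_mod P z.1)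
     (@pair_psums k k t X)
  <= q ^ (2 * t) * t * (X ^ k * (P ^ k * q ^ 'C(k, 2)) * vino k t (P ^ (m - a))).
Proof.
move=> pP kP a0m Xq t0; have P0 := prime_gt0 pP.
have q0 : 0 < q by rewrite expn_gt0 P0.
set E := _ * vino _ _ _.
pose Ac (c : {ffun 'I_t -> 'I_q}) (z : {ffun 'I_k -> 'I_X} * {ffun 'I_t -> 'I_X}) :=
  distinct_mod P z.1 && [forall i, z.2 i %% q == c i].
apply: leq_trans (energy_cover (Ai := Ac) _ _) _.
  move=> z Hz; exists [ffun i => Ordinal (ltn_pmod (z.2 i) q0)].
  by rewrite /Ac Hz; apply/forallP => i; rewrite ffunE.
rewrite card_ffun !card_ord mul2n -addnn expnD -!mulnA leq_mul2l; apply/orP; right.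
apply: (@leq_trans (\sum_(c : {ffun 'I_t -> 'I_q}) t * E)); last first.
  by rewrite sum_nat_const card_ffun !card_ord.
apply: leq_sum => c _.
apply: leq_trans (@energy_holder k.+1 t _ _
  (fun d : {ffun 'I_k -> 'I_X} => distinct_mod P d)
  (fun i (x : 'I_X) => x %% q == c i) (@psums k k X)
  (fun u : 'I_X => [ffun l : 'I_k.+1 => u ^ l]) t0) _.
rewrite -[t in t * E]card_ord -sum_nat_const; apply: leq_sum => i _.
exact: energy_class_le.
Qed.

(** Translation and dilation invariance: [x = c + P y] turns the system for [x] into the same system
    for [y]. *)
Lemma energy_class1_le (P k s m c : nat) (X := P ^ m) : 0 < P -> 0 < m ->
  energy (fun x : {ffun 'I_s -> 'I_X} => [forall i, x i %% P == c]) (@psums k s X)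
    <= vino k s (P ^ m.-1).
Proof.
move=> P0 m0.
have hlt (x : 'I_X) : x %/ P < P ^ m.-1.
  by rewrite ltn_divLR // -expnSr prednK.
pose h (x : {ffun 'I_s -> 'I_X}) : {ffun 'I_s -> 'I_(P ^ m.-1)} :=
  [ffun i => Ordinal (hlt (x i))].
apply: (energy_inj (h := h)) => // [x y|x y] /forallP Hx /forallP Hy /ffunP Hh.
  apply/ffunP => i; apply/val_inj => /=.
  rewrite (divn_eq (x i) P) (divn_eq (y i) P) (eqP (Hx i)) (eqP (Hy i)).
  by have := congr1 val (Hh i); rewrite !ffunE /= => ->.
have E j : j <= k -> (\sum_i (Posz (x i)) ^+ j = \sum_i (Posz (y i)) ^+ j)%R.
  move=> jk; rewrite -!PoszD_sum.
  by have := Hh (Ordinal (jk : j < k.+1)); rewrite !ffunE /= => ->.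
apply/ffunP => j; rewrite !ffunE; apply/eqP; rewrite -eqz_nat !PoszD_sum.
have jk : j <= k by rewrite -ltnS.
have qx (z : {ffun 'I_s -> 'I_X}) : (forall i, z i %% P == c) ->
   (\sum_i ((z i)%:Z - c%:Z) ^+ j = (P ^ j)%:Z * \sum_i (h z i)%:Z ^+ j)%R.
  move=> Hz; rewrite mulr_sumr; apply: eq_bigr => i _.
  rewrite ffunE /= -[Posz (P ^ j)]natz natrX natz -exprMn; congr (_ ^+ _)%R.
  rewrite {1}(divn_eq (z i) P) (eqP (Hz i)) PoszD PoszM; ring.
have := psum_shift (Posz c) E jk; rewrite !qx // => /mulfI -> //.
by rewrite eqz_nat expn_eq0 negb_and -lt0n P0.
Qed.

(** Such a tuple is described by [k] residues and a map from its [s] coordinates to them, which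
    gives [P ^ k * k ^ s] covering sets. Hoelder's inequality then makes all residues of a set
    equal. *)
Lemma energy_few_classes_le (P k s m : nat) (X := P ^ m) :
    0 < P -> 0 < m -> 0 < s -> 0 < k ->
  energy (fun x : {ffun 'I_s -> 'I_X} => size (undup (codom (fun i => x i %% P))) < k)
    (@psums k s X) <= (P ^ k * k ^ s) ^ 2 * s * vino k s (P ^ m.-1).
Proof.
move=> P0 m0 s0 k0.
pose I := ({ffun 'I_k -> 'I_P} * {ffun 'I_s -> 'I_k})%type.
pose Ai (ab : I) (x : {ffun 'I_s -> 'I_X}) := [forall i, x i %% P == ab.1 (ab.2 i)].
have cI : #|{: I}| = P ^ k * k ^ s by rewrite card_prod !card_ffun !card_ord.
apply: leq_trans (energy_cover (Ai := Ai) _ _) _.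
  move=> x; set l := undup _ => lk.
  have inl i : x i %% P \in l by rewrite mem_undup (codom_f (fun i => x i %% P)).
  have ilt i : index (x i %% P) l < k by apply: ltn_trans lk; rewrite index_mem.
  exists ([ffun j : 'I_k => Ordinal (ltn_pmod (nth 0 l j) P0)], [ffun i => Ordinal (ilt i)]).
  apply/forallP => i; rewrite !ffunE /= nth_index //.
  by rewrite modn_mod.
rewrite cI; move: (P ^ k * k ^ s) cI => Q cI.
rewrite -mulnn -!mulnA leq_mul2l; apply/orP; right.
rewrite -cI -sum_nat_const.
apply: leq_sum => ab _.
(* A one-point first block brings the situation into the shape of [energy_holder]. *)
pose A1 (u : unit) := true.
pose f1 (u : unit) : {ffun 'I_k.+1 -> nat} := [ffun=> 0].
pose g (u : 'I_X) : {ffun 'I_k.+1 -> nat} := [ffun l : 'I_k.+1 => u ^ l].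
have := @energy_holder k.+1 s _ _ A1 (fun i (x : 'I_X) => x %% P == ab.1 (ab.2 i)) f1 g s0.
pose F := fun z : unit * {ffun 'I_s -> 'I_X} =>
            [ffun j => f1 z.1 j + \sum_i g (z.2 i) j].
rewrite -/F => H.
have FE u x : F (u, x) = psums k x.
  by apply/ffunP => j; rewrite !ffunE; apply: eq_bigr => i _; rewrite ffunE.
apply: leq_trans (leq_trans H _).
  apply: (energy_inj (h := pair tt)) => // [x y _ _ []//|x y _ _ E].
  by rewrite !FE.
rewrite -[s in s * _]card_ord -sum_nat_const; apply: leq_sum => i _.
apply: leq_trans (energy_class1_le k s (ab.1 (ab.2 i)) P0 m0).
apply: (energy_inj (h := snd)) => // [[[] x] [[] y] _ _ /= -> //|[u x] [v y] _ _].
by rewrite !FE.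
Qed.

(** Some permutation of the coordinates brings [k] pairwise incongruent ones to the front; the
    permutations index the cover, hence the squared factorial. *)
Lemma energy_many_classes_le (P k t m : nat) (X := P ^ m) : 0 < P ->
  energy (fun x : {ffun 'I_(k + t) -> 'I_X} => k <= size (undup (codom (fun i => x i %% P))))
    (@psums k (k + t) X) <= (k + t)`! ^ 2 *
  energy (fun z : {ffun 'I_k -> 'I_X} * {ffun 'I_t -> 'I_X} => distinct_mod P z.1)
     (@pair_psums k k t X).
Proof.
move=> P0.
pose As (p : 'S_(k + t)) (x : {ffun 'I_(k + t) -> 'I_X}) :=
  distinct_mod P (fun i : 'I_k => x (p (lshift t i))).
have cS : #|{: 'S_(k + t)}| = (k + t)`! by rewrite card_Sn.
apply: leq_trans (energy_cover (Ai := As) _ _) _.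
  move=> x; set g := fun i => _; set l := undup _ => kl.
  (* The list [l] of distinct residues is a subsequence of all residues, so a permutation of the
     coordinates places it first. *)
  have [s3 Hs3] := perm_to_subseq (undup_subseq (codom g)).
  have /tuple_permP[p Hp] : perm_eq (l ++ s3) [tuple g i | i < k + t].
    by rewrite perm_sym.
  exists p; apply/forallP => i; apply/forallP => j; apply/implyP => ij.
  have Hn (i0 : 'I_k) : nth 0 l i0 = g (p (lshift t i0)).
    transitivity (nth 0 (l ++ s3) (lshift t i0)).
      by rewrite nth_cat (leq_trans (ltn_ord i0) kl).
    by rewrite Hp -tnth_nth !tnth_mktuple.
  rewrite -![x _ %% P]/(g _) -!Hn nth_uniq ?undup_uniq ?(leq_trans (ltn_ord _) kl) //.
rewrite cS -mulnn -mulnA leq_mul2l; apply/orP; right.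
rewrite -cS -sum_nat_const; apply: leq_sum => p _.
pose h (x : {ffun 'I_(k + t) -> 'I_X}) : {ffun 'I_k -> 'I_X} * {ffun 'I_t -> 'I_X} :=
  ([ffun i => x (p (lshift t i))], [ffun i => x (p (rshift k i))]).
apply: (energy_inj (h := h)).
- move=> x y _ _ [/ffunP Hl /ffunP Hr]; apply/ffunP => i.
  rewrite -(permKV p i); case: (split_ordP ((p^-1)%g i)) => j ->.
    by have := Hl j; rewrite !ffunE.
  by have := Hr j; rewrite !ffunE.
- move=> x Hx; apply/forallP => i; apply/forallP => j; rewrite !ffunE.
  by move/forallP/(_ i)/forallP/(_ j): Hx.
move=> x y _ _ /ffunP E; apply/ffunP => j; rewrite !pair_psumsE.
have S (z : {ffun 'I_(k + t) -> 'I_X}) : \sum_i (h z).1 i ^ j + \sum_i (h z).2 i ^ j = psums k z j.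
  rewrite ffunE (reindex_inj (@perm_inj _ p)) big_split_ord /=.
  by congr addn; apply: eq_bigr => i _; rewrite ffunE.
by rewrite !S E.
Qed.

(* The p-adic recursion: tuples meeting at least [k] classes mod [P] are
   counted by lifting solutions of a triangular system of congruences, the
   others lie in few boxes on which the system rescales. *)
Lemma vino_recursion (P a k t m : nat) :
    prime P -> k < P -> 0 < k -> 0 < t -> 0 < a <= m -> m <= a * k ->
  vino k (k + t) (P ^ m) <=
    2 * ((k + t)`! ^ 2 * (P ^ (a * (2 * t)) * t *
       (P ^ (m * k) * (P ^ k * P ^ (a * 'C(k, 2))) * vino k t (P ^ (m - a)))))
    + 2 * ((P ^ k * k ^ (k + t)) ^ 2 * (k + t) * vino k (k + t) (P ^ m.-1)).
Proof.
move=> pP kP k0 t0 am mak; have P0 := prime_gt0 pP.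
have m0 : 0 < m by case/andP: am => a0; apply: leq_trans.
pose Ab (b : bool) (x : {ffun 'I_(k + t) -> 'I_(P ^ m)}) :=
  if b then k <= size (undup (codom (fun i => x i %% P)))
  else size (undup (codom (fun i => x i %% P))) < k.
apply: leq_trans (energy_cover (Ai := Ab) _ _) _.
  by move=> x _; case: (leqP k (size (undup (codom (fun i => x i %% P))))) => H;
    [exists true|exists false].
rewrite card_bool big_bool /= mulnDr; apply: leq_add; rewrite leq_mul2l /=.
  apply: leq_trans (energy_many_classes_le _ _ _ P0) _.
  rewrite leq_mul2l; apply/orP; right.
  rewrite !(expnM P); apply: energy_distinct_le => //.
  by rewrite -expnM leq_exp2l // prime_gt1.
by apply: energy_few_classes_le => //; rewrite addn_gt0 k0.
Qed.

End PowerSums.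

(** * Vinogradov's mean value theorem *)
Module MeanValue.
Import all_boot all_order all_fingroup all_algebra all_field.
Import zify PowerSums.
Set Implicit Arguments. Unset Strict Implicit. Unset Printing Implicit Defensive.
Local Open Scope R_scope.

Lemma INR_addn m n : INR (m + n)%N = INR m + INR n.
Proof. exact: plus_INR. Qed.

Lemma INR_muln m n : INR (m * n)%N = INR m * INR n.
Proof. exact: mult_INR. Qed.

Lemma INR_expn m n : INR (m ^ n)%N = INR m ^ n.
Proof. by elim: n => // n IH; rewrite expnS INR_muln IH. Qed.

Lemma INR_le m n : (m <= n)%N -> INR m <= INR n.
Proof. by move=> /leP; apply: le_INR. Qed.

Lemma exp_le x y : x <= y -> exp x <= exp y.
Proof. by case=> [/exp_increasing|->]; lra. Qed.

Lemma ln_mono x y : 0 < x -> x <= y -> ln x <= ln y.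
Proof. by move=> x0 [xy|->]; [left; apply: ln_increasing | right]. Qed.

Lemma exp_natmul (x : R) (n : nat) : exp x ^ n = exp (INR n * x).
Proof.
elim: n => [|n IH]; first by rewrite Rmult_0_l exp_0.
by rewrite /= IH -exp_plus -/(INR n.+1) S_INR; congr exp; ring.
Qed.

Lemma INR_expn_exp (P n : nat) : (0 < P)%N ->
  INR (P ^ n)%N = exp (INR n * ln (INR P)).
Proof.
move=> P0; rewrite INR_expn -{1}[INR P]exp_ln; last by apply: lt_0_INR; apply/ltP.
exact: exp_natmul.
Qed.

Lemma fact_le_expn s : (s`! <= s ^ s)%N.
Proof.
have H n : (n <= s -> n`! <= s ^ n)%N.
  elim: n => // n IH ns; rewrite factS expnS leq_mul // IH //; exact: ltnW.
exact: H.
Qed.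

Lemma INR_bin2 (k : nat) : INR 'C(k, 2) = INR k * (INR k - 1) / 2.
Proof.
elim: k => [|k IH]; first by rewrite /=; lra.
by rewrite binS bin1 INR_addn IH S_INR; field.
Qed.

Lemma vino_trivial (k s X : nat) : (vino k s X <= (X ^ s) ^ 2)%N.
Proof.
rewrite /vino /energy /coinc -mulnn.
have <- : (\sum_(x : {ffun 'I_s -> 'I_X}) \sum_(y : {ffun 'I_s -> 'I_X}) 1 = X ^ s * X ^ s)%N.
  by rewrite !sum_nat_const card_ffun !card_ord muln1.
by apply: leq_sum => x _; apply: leq_sum => y _; case: eqP.
Qed.

Section Iteration.
Variables (k P S : nat).
Hypotheses (k0 : (0 < k)%N) (pP : prime P) (kP : (4 * k ^ 2 <= P)%N).

Let p := ln (INR P).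
Let kr := INR k.
(** The sum of the degrees [1, ..., k]: the saving aimed at in the exponent. *)
Let K := kr * (kr + 1) / 2.
(** Logarithm of the loss in one step: [4] from the cover and from splitting the target into halves,
    [S ^ (2 S + 1)] for the factorials and the factor [t], [P ^ k] for the residues, [P ^ (k ^ 2)]
    for rounding [a]. *)
Let A := ln 4 + (2 * INR S + 1) * ln (INR S) + p * (kr + kr ^ 2).

Let kr1 : 1 <= kr.
Proof. by rewrite /kr -[1]/(INR 1); apply: INR_le. Qed.

Let P4 : 4 * kr ^ 2 <= INR P.
Proof.
have := INR_le kP; rewrite INR_muln INR_expn -/kr [INR 4]/=; lra.
Qed.

Let Ppos : 0 < INR P. Proof. nra. Qed.

Let p0 : 0 < p.
Proof. rewrite /p -ln_1; apply: ln_increasing; nra. Qed.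

(** [eta] is the excess over the exponent [2 t - K]. In the first term of the recursion everything
    that involves [a] adds up to [a * (k ^ 2 - eta)]. With [a] close to [m / k], the part [m * k] is
    what the [k] new variables allow, and [- eta * m / k] is the gain. The second term keeps the
    number of variables and lowers [m], which calls for an induction on [m]. *)
Lemma vino_iteration_step (t : nat) (eta Q : R) :
    (k ^ 2 + k <= t)%N -> (k + t <= S)%N -> 0 <= eta <= K -> 0 <= Q ->
    (forall m, INR (vino k t (P ^ m)) <= exp (Q + p * INR m * (2 * INR t - K + eta))) ->
  forall m, INR (vino k (k + t) (P ^ m)) <=
    exp (Q + A + p * INR m * (2 * INR (k + t) - K + eta * (1 - / kr))).
Proof.
move=> kt tS eta0 Q0 IHt.
set s := (k + t)%N; set F := 2 * INR s - K + _.
have s0 : 0 < INR s by apply: lt_0_INR; apply/ltP; rewrite addn_gt0 k0.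
have Sr : INR s <= INR S by apply: INR_le.
have s1 : 1 <= INR s by rewrite -[1]/(INR 1); apply: INR_le; rewrite addn_gt0 k0.
have lS : 0 <= ln (INR S) by rewrite -ln_1; apply: ln_mono; lra.
have l4 : 0 <= ln 4 by rewrite -ln_1; apply: ln_mono; lra.
have A0 : 0 <= A by rewrite /A; nra.
elim=> [|m IHm].
  rewrite Rmult_0_r Rmult_0_l; apply: Rle_trans (_ : 1 <= _); last first.
    by rewrite -exp_0; apply: exp_le; lra.
  rewrite -[1]/(INR 1); apply: INR_le.
  by apply: leq_trans (vino_trivial _ _ _) _; rewrite expn0 !exp1n.
set Fm := _ + _ * F.
(* The ceiling of [(m + 1) / k], the least exponent with [P ^ m.+1 <= (P ^ a) ^ k]. *)
pose a := ((m.+1 + k.-1) %/ k)%N.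
have akE := divn_eq (m.+1 + k.-1) k.
have akr := ltn_pmod (m.+1 + k.-1) k0.
have mak : (m.+1 <= a * k)%N by rewrite -/a in akE; lia.
have akm : (a * k <= m + k)%N by rewrite -/a in akE; lia.
have am : (0 < a <= m.+1)%N by clear -mak akm k0; apply/andP; split; nia.
have kP' : (k < P)%N by apply: leq_trans kP; nia.
have t0 : (0 < t)%N by nia.
apply: Rle_trans (INR_le (vino_recursion pP kP' k0 t0 am mak)) _.
rewrite INR_addn (_ : exp Fm = exp Fm / 2 + exp Fm / 2); last by field.
have ar : INR a * kr <= INR m.+1 + kr.
  by rewrite /kr -INR_muln -INR_addn; apply: INR_le; lia.
have ma : INR (m.+1 - a)%N = INR m.+1 - INR a.
  by rewrite -[in RHS](@subnK a m.+1) ?INR_addn; [lra | lia].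
have sE : INR s = kr + INR t by rewrite /s INR_addn.
have etak : eta <= kr ^ 2 by rewrite /K in eta0; nra.
have ik : / kr * kr = 1 by field; lra.
apply: Rplus_le_compat.
  rewrite !INR_muln !(INR_expn_exp _ (prime_gt0 pP)) -/p !INR_muln INR_bin2 -/kr -/s.
  rewrite (_ : INR s`! * INR s`! = INR s`! ^ 2); last by rewrite /=; ring.
  have fS : INR s`! <= exp (INR S * ln (INR S)).
    rewrite -INR_expn_exp; last by lia.
    apply: INR_le; apply: leq_trans (fact_le_expn s) _.
    by apply: (@leq_trans (S ^ s)%N); [rewrite leq_exp2r; lia | rewrite leq_pexp2l; lia].
  have tSr : INR t <= exp (ln (INR S)).
    rewrite exp_ln; last lra. by apply: INR_le; lia.
  have := IHt (m.+1 - a)%N; rewrite ma.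
  set V := INR (vino _ _ _) => HV.
  have f0 := pos_INR s`!. have t0' := pos_INR t. have V0 : 0 <= V by apply: pos_INR.
  set G := exp (INR S * _) in fS.
  have HG : INR s`! ^ 2 <= G ^ 2 by apply: pow_incr.
  set e1 := exp (INR a * _ * p); set e2 := exp (_ * kr * p); set e3 := exp (kr * p).
  set e4 := exp (INR a * (_ / 2) * p).
  set e5 := exp _ in HV.
  have e10 : 0 < e1 by apply: exp_pos.
  have e20 : 0 < e2 by apply: exp_pos.
  have e30 : 0 < e3 by apply: exp_pos.
  have e40 : 0 < e4 by apply: exp_pos.
  apply: (@Rle_trans _ (2 * (G ^ 2 * (e1 * exp (ln (INR S)) * (e2 * (e3 * e4) * e5))))).
    apply: Rmult_le_compat_l; first by rewrite /=; lra.
    apply: Rmult_le_compat => //; first by apply: pow_le.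
      by repeat (apply: Rmult_le_pos => //); left.
    apply: Rmult_le_compat; try by repeat (apply: Rmult_le_pos => //); left.
      by apply: Rmult_le_compat_l => //; left.
    by apply: Rmult_le_compat_l => //; left; repeat apply: Rmult_lt_0_compat.
  apply: (Rmult_le_reg_l 2); first lra.
  rewrite (_ : 2 * (exp Fm / 2) = exp Fm); last by field.
  rewrite -[X in X <= _]Rmult_assoc (_ : 2 * 2 = exp (ln 4)); last by rewrite exp_ln; lra.
  rewrite /G /e1 /e2 /e3 /e4 /e5 exp_natmul -!exp_plus; apply: exp_le.
  rewrite /Fm /F /A sE [INR 2]/=.
  suff : p * (2 * INR t * INR a + INR m.+1 * kr + kr + INR a * (kr * (kr - 1) / 2)
       + (INR m.+1 - INR a) * (2 * INR t - K + eta)) <=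
     p * (kr + kr ^ 2 + INR m.+1 * (2 * (kr + INR t) - K + eta * (1 - / kr))) by nra.
  apply: Rmult_le_compat_l; first lra.
  have : INR a * (kr ^ 2 - eta) <= (INR m.+1 * / kr + 1) * (kr ^ 2 - eta).
    apply: Rmult_le_compat_r; first lra.
    apply: (Rmult_le_reg_r kr); first lra.
    by rewrite Rmult_plus_distr_r Rmult_assoc ik; lra.
  have -> : (INR m.+1 * / kr + 1) * (kr ^ 2 - eta) =
     INR m.+1 * kr * (/ kr * kr) + kr ^ 2 - INR m.+1 * eta * / kr - eta by field; lra.
  rewrite ik /K; lra.
rewrite [m.+1.-1]/= !INR_muln (INR_expn_exp _ (prime_gt0 pP)) INR_expn -/p -/kr -/s.
have V0 := pos_INR (vino k s (P ^ m)).
have kr0 : 0 <= kr ^ s by apply: pow_le; lra.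
have e0 := exp_pos (kr * p).
have Fs : INR s + 2 * kr <= F.
  have : INR (k ^ 2 + k)%N <= INR t by apply: INR_le.
  rewrite INR_addn INR_expn -/kr => kt'.
  have : 0 <= eta * (1 - / kr).
    apply: Rmult_le_pos; first lra.
    by have := Rinv_le_contravar 1 kr Rlt_0_1 kr1; rewrite Rinv_1; lra.
  by rewrite /F /K sE; nra.
(* Tuples in few classes: [4 * s <= 4 ^ s] and [4 * k ^ 2 <= P] bound [4 * s * k ^ (2 * s)] by
   [P ^ s], next to a factor [P ^ (2 * k)]. The bound [Fs] pays for both. *)
have key : 4 * (exp (kr * p) * kr ^ s) ^ 2 * INR s <= exp (p * F).
  apply: Rle_trans (exp_le (_ : INR s * p + INR 2 * (kr * p) <= _)); last first.
    by rewrite [INR 2]/=; nra.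
  rewrite exp_plus -!exp_natmul [exp p]exp_ln //.
  have : 4 ^ s * (kr ^ s) ^ 2 <= INR P ^ s.
    rewrite -pow_mult [(s * 2)%coq_nat]Nat.mul_comm pow_mult -Rpow_mult_distr.
    by apply: pow_incr; nra.
  have : 4 * INR s <= 4 ^ s.
    have H : INR s + 1 <= 2 ^ s.
      by rewrite -[1]/(INR 1) -INR_addn addn1 -[2]/(INR 2) -INR_expn; apply: INR_le; apply: ltn_expl.
    by rewrite (_ : 4 = 2 * 2); [rewrite Rpow_mult_distr; nra | lra].
  rewrite Rpow_mult_distr; move: (exp (kr * p) ^ 2) (pow_lt _ 2 e0) => E E0.
  move: (kr ^ s) kr0 (4 ^ s) (INR P ^ s) => y y0 z w zs zw.
  have y2 : 0 <= y ^ 2 by nra.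
  have : 4 * INR s * y ^ 2 <= w by nra.
  nra.
apply: (Rmult_le_reg_l 2); first lra.
rewrite (_ : 2 * (exp Fm / 2) = exp Fm); last by field.
have -> : Fm = (p * F) + (Q + A + p * INR m * F) by rewrite /Fm S_INR; ring.
rewrite exp_plus [INR 2]/=.
have W0 : 0 <= 4 * (exp (kr * p) * kr ^ s) ^ 2 * INR s.
  by apply: Rmult_le_pos; [apply: Rmult_le_pos; [lra | apply: pow2_ge_0] | lra].
apply: Rle_trans (_ : (4 * (exp (kr * p) * kr ^ s) ^ 2 * INR s) * INR (vino k s (P ^ m)) <= _).
  by right; ring.
by apply: Rmult_le_compat.
Qed.

(** The start is the trivial bound at [k ^ 2 + k] variables, that is, excess [eta = K]. *)
Lemma vino_iteration (r : nat) : (r * k + (k ^ 2 + k) <= S)%N ->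
  forall m, INR (vino k (r * k + (k ^ 2 + k)) (P ^ m)) <=
    exp (INR r * A + p * INR m *
      (2 * INR (r * k + (k ^ 2 + k))%N - K + K * (1 - / kr) ^ r)).
Proof.
have k1 : 0 <= 1 - / kr <= 1.
  have := Rinv_le_contravar 1 kr Rlt_0_1 kr1; rewrite Rinv_1.
  have : 0 < / kr by apply: Rinv_0_lt_compat; lra.
  lra.
have K0 : 0 <= K by rewrite /K; nra.
elim: r => [|r IH] rS m.
  apply: Rle_trans (INR_le (vino_trivial _ _ _)) _.
  rewrite Rmult_0_l Rplus_0_l -!expnM INR_expn_exp ?prime_gt0 // !INR_muln.
  by apply: exp_le; rewrite -/p [INR 2]/= pow_O; right; ring.
have S1 : 1 <= INR S by rewrite -[1]/(INR 1); apply: INR_le; lia.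
have lS : 0 <= ln (INR S) by rewrite -ln_1; apply: ln_mono; lra.
have l4 : 0 <= ln 4 by rewrite -ln_1; apply: ln_mono; lra.
have A0 : 0 <= A by rewrite /A; nra.
have rS' : (r * k + (k ^ 2 + k) <= S)%N by lia.
have sE : (r.+1 * k + (k ^ 2 + k) = k + (r * k + (k ^ 2 + k)))%N by lia.
have pw : 0 <= (1 - / kr) ^ r <= 1.
  split; first by apply: pow_le; lra.
  by have := pow_incr _ 1 r k1; rewrite pow1.
have := @vino_iteration_step (r * k + (k ^ 2 + k)) (K * (1 - / kr) ^ r) (INR r * A).
rewrite -sE => H; apply: Rle_trans (H _ _ _ _ (IH rS') m) _ => //.
- by lia.
- by nra.
- by apply: Rmult_le_pos => //; apply: pos_INR.
by apply: exp_le; right; rewrite S_INR /=; ring.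
Qed.

End Iteration.

(* [k ^ 2] steps of the recursion, each shrinking the excess exponent by [1 - 1 / k]. *)
Lemma vinogradov_mean_value (k P m : nat) (s := (k ^ 3 + k ^ 2 + k)%N) :
    (0 < k)%N -> prime P -> (4 * k ^ 2 <= P)%N ->
  INR (vino k s (P ^ m)) <=
    exp (INR k ^ 2 * (ln 4 + (2 * INR s + 1) * ln (INR s) +
                      ln (INR P) * (INR k + INR k ^ 2))
         + ln (INR P) * INR m * (2 * INR s - INR k * (INR k + 1) / 2 +
             INR k * (INR k + 1) / 2 * exp (- INR k))).
Proof.
move=> k0 pP kP.
have sE : ((k ^ 2) * k + (k ^ 2 + k) = s)%N by rewrite /s -expnSr addnA.
have := @vino_iteration k P s k0 pP kP (k ^ 2) _ m.
rewrite sE => H; apply: Rle_trans (H (leqnn _)) _; apply: exp_le.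
rewrite INR_expn; apply: Rplus_le_compat_l.
have kr1 : 1 <= INR k by rewrite -[1]/(INR 1); apply: INR_le.
have P1 : 1 <= INR P by rewrite -[1]/(INR 1); apply: INR_le; apply: prime_gt0.
have p0 : 0 <= ln (INR P) by rewrite -ln_1; apply: ln_mono; lra.
apply: Rmult_le_compat_l; first by apply: Rmult_le_pos => //; apply: pos_INR.
apply: Rplus_le_compat_l; apply: Rmult_le_compat_l; first nra.
have -> : - INR k = INR (k ^ 2) * (- / INR k) by rewrite INR_expn; field; lra.
rewrite -exp_natmul; apply: pow_incr; split.
  by have := Rinv_le_contravar 1 (INR k) Rlt_0_1 kr1; rewrite Rinv_1; lra.
have := exp_ineq1_le (- / INR k); lra.
Qed.

End MeanValue.

(** * The double large sieve *)
Module LargeSieve.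
Import all_boot all_order all_fingroup all_algebra all_field.
Import zify ring PowerSums.
Set Implicit Arguments. Unset Strict Implicit. Unset Printing Implicit Defensive.
Import Order.TTheory GRing.Theory Num.Theory.
Local Open Scope ring_scope.

(** Induction on the exponent by Chebyshev's sum inequality, that is,
    [(a ^ n - b ^ n) * (a - b) >= 0] for nonnegative [a] and [b]. *)
Lemma power_mean_le (F : numDomainType) (I : finType) (a : I -> F) (s : nat) :
    (0 < s)%N -> (forall i, 0 <= a i) ->
  (\sum_i a i) ^+ s <= #|I|%:R ^+ s.-1 * \sum_i a i ^+ s.
Proof.
case: s => // s _ a0; elim: s => [|s IH].
  by rewrite expr1 expr0 mul1r.
have S0 : 0 <= \sum_i a i by apply: sumr_ge0.
rewrite exprSr; apply: le_trans (ler_wpM2r S0 IH) _.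
rewrite exprSr -!mulrA ler_wpM2l ?exprn_ge0 //.
have cheb i j : a i ^+ s.+1 * a j + a j ^+ s.+1 * a i <= a i ^+ s.+2 + a j ^+ s.+2.
  rewrite -subr_ge0 [a i ^+ s.+2]exprSr [a j ^+ s.+2]exprSr.
  rewrite (_ : _ - _ = (a i ^+ s.+1 - a j ^+ s.+1) * (a i - a j)); last by ring.
  have [ij|ji] := real_leP (ger0_real (a0 i)) (ger0_real (a0 j)).
    by rewrite mulr_le0 ?subr_le0 // lerXn2r // nnegrE.
  by rewrite mulr_ge0 ?subr_ge0 ?(ltW ji) // lerXn2r ?nnegrE // ltW.
have sym (G : I -> I -> F) : (\sum_i \sum_j G i j) *+ 2 = \sum_i \sum_j (G i j + G j i).
  rewrite mulr2n {2}exchange_big -big_split; apply: eq_bigr => i _.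
  by rewrite big_split.
rewrite big_distrlr -(ler_pMn2r (isT : (0 < 2)%N)) sym.
apply: le_trans (ler_sum _ (fun i _ => ler_sum _ (fun j _ => cheb i j))) _.
rewrite -sym; under eq_bigr do rewrite sumr_const.
by rewrite sumrMnl mulr_natl.
Qed.

(** Lagrange's identity, for real elements of a domain that may be complex. *)
Lemma cauchy_schwarz_sum (F : numDomainType) (I : finType) (A : pred I) (a b : I -> F) :
    (forall i, a i \is Num.real) -> (forall i, b i \is Num.real) ->
  (\sum_(i | A i) a i * b i) ^+ 2 <=
    (\sum_(i | A i) a i ^+ 2) * (\sum_(i | A i) b i ^+ 2).
Proof.
move=> ar br.
have : 0 <= \sum_(i | A i) \sum_(j | A j) (a i * b j - a j * b i) ^+ 2.
  apply: sumr_ge0 => i _; apply: sumr_ge0 => j _.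
  by rewrite real_exprn_even_ge0 // rpredB ?rpredM.
have -> : \sum_(i | A i) \sum_(j | A j) (a i * b j - a j * b i) ^+ 2 =
   2%:R * ((\sum_(i | A i) a i ^+ 2) * (\sum_(i | A i) b i ^+ 2)
     - (\sum_(i | A i) a i * b i) ^+ 2).
  rewrite expr2 !big_distrlr mulrBr !mulr_sumr.
  rewrite [X in _ = _ - X](eq_bigr (fun i => \sum_(j | A j) 2%:R * (a i * b i * (a j * b j))));
    last by move=> i _; rewrite mulr_sumr.
  have -> : \sum_(i | A i) 2%:R * (\sum_(j | A j) a i ^+ 2 * b j ^+ 2) =
     \sum_(i | A i) \sum_(j | A j) (a i ^+ 2 * b j ^+ 2 + a j ^+ 2 * b i ^+ 2).
    under [RHS]eq_bigr do rewrite big_split.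
    rewrite big_split [X in _ = _ + X]exchange_big -mulr_sumr mulr_natl mulr2n.
    by congr (_ + _).
  rewrite -sumrB; apply: eq_bigr => i _; rewrite -sumrB; apply: eq_bigr => j _; ring.
by rewrite pmulr_rge0 // subr_ge0.
Qed.

(** Replaces absolute values by bounded coefficients, after which sums can be interchanged. *)
Lemma norm_phase (F : numClosedFieldType) (z : F) :
  exists2 t, `|t| <= 1 & `|z| = t * z.
Proof.
have [->|z0] := eqVneq z 0; first by exists 0; rewrite ?normr0 ?mulr0.
exists (z^* / `|z|); first by rewrite normrM normfV norm_conjC normr_id divff ?normr_eq0.
by rewrite mulrAC [_^* * _]mulrC -normCK expr2 mulfK // normr_eq0.
Qed.

Lemma sum_exp_tuples (F : comNzRingType) (s : nat) (I : finType) (f : I -> F) :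
  (\sum_y f y) ^+ s = \sum_(y : {ffun 'I_s -> I}) \prod_i f (y i).
Proof.
rewrite -[s in LHS]card_ord -prodr_const.
by rewrite (bigA_distr_bigA (fun (_ : 'I_s) y => f y)).
Qed.

Section DoubleLargeSieve.
Variables (F : numClosedFieldType) (k s M : nat) (chi : 'I_k.+1 -> nat -> F).
Hypothesis chi0 : forall j, chi j 0%N = 1.
Hypothesis chiD : forall j m n, chi j (m + n)%N = chi j m * chi j n.

Definition bichar (u v : 'I_k.+1 -> nat) : F := \prod_j chi j (u j * v j)%N.

Lemma chi_sum j (I : finType) (n : I -> nat) : chi j (\sum_i n i)%N = \prod_i chi j (n i).
Proof. by apply: (big_morph _ (chiD j) (chi0 j)). Qed.

Lemma bichar_psumsr (X : nat) (u : 'I_k.+1 -> nat) (y : {ffun 'I_s -> 'I_X}) :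
  bichar u (psums k y) = \prod_i bichar u (fun j => y i ^ j)%N.
Proof.
rewrite exchange_big; apply: eq_bigr => j _.
by rewrite ffunE big_distrr chi_sum.
Qed.

Lemma bicharC u v : bichar u v = bichar v u.
Proof. by apply: eq_bigr => j _; rewrite mulnC. Qed.

Lemma bichar_ext u u' v v' : u =1 u' -> v =1 v' -> bichar u v = bichar u' v'.
Proof. by move=> uu vv; apply: eq_bigr => j _; rewrite uu vv. Qed.

Definition bilinear_sum : F :=
  \sum_(x < M) \sum_(y < M) bichar (fun j => x ^ j)%N (fun j => y ^ j)%N.

(* Hoelder's inequality in each of the two variables. *)
Lemma bilinear_sum_le : (0 < s)%N ->
  exists2 a : {ffun 'I_s -> 'I_M} -> F, (forall x, `|a x| <= 1) &
  `|bilinear_sum| ^+ (s * s) <= (M ^ (s * s.-1) * M ^ (s * s.-1))%:R *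
    \sum_(y : {ffun 'I_s -> 'I_M})
      `|\sum_x a x * bichar (psums k x) (psums k y)|.
Proof.
move=> s0.
pose inner (x : 'I_M) := \sum_(y : {ffun 'I_s -> 'I_M})
   bichar (fun j => x ^ j)%N (psums k y).
have innerE (x : 'I_M) :
    (\sum_(y < M) bichar (fun j => x ^ j)%N (fun j => y ^ j)%N) ^+ s = inner x.
  rewrite sum_exp_tuples; apply: eq_bigr => y _.
  by rewrite bichar_psumsr.
have /fin_all_exists2[eta eta1 etaE] := fun x => norm_phase (inner x).
exists (fun x => \prod_i eta (x i)).
  by move=> x; rewrite normr_prod; apply: prodr_ile1 => i _; rewrite normr_ge0 eta1.
have step1 : `|bilinear_sum| ^+ s <= M%:R ^+ s.-1 *
    \sum_(y : {ffun 'I_s -> 'I_M}) `|\sum_(x < M) eta x * bichar (fun j => x ^ j)%N (psums k y)|.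
  apply: (@le_trans _ _ ((\sum_(x < M) `|\sum_(y < M)
      bichar (fun j => x ^ j)%N (fun j => y ^ j)%N|) ^+ s)).
    by rewrite lerXn2r ?nnegrE ?sumr_ge0 // ler_norm_sum.
  apply: le_trans (power_mean_le s0 _) _ => //.
  rewrite card_ord ler_wpM2l ?exprn_ge0 ?ler0n //.
  rewrite (eq_bigr (fun x => `|inner x|)) => [|x _]; last by rewrite -normrX innerE.
  have S0 : 0 <= \sum_x `|inner x| by apply: sumr_ge0.
  rewrite -(ger0_norm S0) (eq_bigr (fun x => \sum_(y : {ffun 'I_s -> 'I_M})
    eta x * bichar (fun j => x ^ j)%N (psums k y))) => [|x _]; last by rewrite etaE mulr_sumr.
  by rewrite exchange_big; apply: ler_norm_sum.
rewrite exprM; apply: (@le_trans _ _ ((M%:R ^+ s.-1 *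
    \sum_(y : {ffun 'I_s -> 'I_M}) `|\sum_(x < M) eta x * bichar (fun j => x ^ j)%N (psums k y)|) ^+ s)).
  by rewrite lerXn2r // nnegrE ?exprn_ge0 ?mulr_ge0 ?sumr_ge0 ?exprn_ge0 ?ler0n.
rewrite exprMn natrM -mulrA -exprM [(s.-1 * s)%N]mulnC natrX ler_wpM2l ?exprn_ge0 ?ler0n //.
apply: le_trans (power_mean_le s0 _) _ => //.
rewrite card_ffun !card_ord natrX -exprM.
rewrite ler_wpM2l ?exprn_ge0 ?ler0n // le_eqVlt; apply/orP; left; apply/eqP.
apply: eq_bigr => y _; rewrite -normrX sum_exp_tuples; congr `|_|.
apply: eq_bigr => x _; rewrite big_split /= bicharC bichar_psumsr; congr (_ * _).
by apply: eq_bigr => i _; rewrite bicharC.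
Qed.

Let H (j : 'I_k.+1) := (s * M ^ j).+1.
(** A common bound for the ranges [H j]: vectors live in one finite type, and [box] restores the
    range of each coordinate. *)
Let N := (s * M ^ k).+1.

Hypothesis M0 : (0 < M)%N.

Let HN j : (H j <= N)%N.
Proof. by rewrite ltnS leq_mul2l leq_pexp2l ?orbT // -ltnS. Qed.

Let box (v : {ffun 'I_k.+1 -> 'I_N}) := v \in family (fun j => [pred w : 'I_N | w < H j]%N).

Let pv (x : {ffun 'I_s -> 'I_M}) : {ffun 'I_k.+1 -> 'I_N} :=
  [ffun j => inord (psums k x j)].

Let psums_lt x j : (@psums k s M x j < H j)%N.
Proof.
rewrite ffunE ltnS -[s in (s * _)%N]card_ord -sum_nat_const; apply: leq_sum => i _.
by case: (val j) => // l; rewrite leq_exp2r // ltnW.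
Qed.

Let pvE x j : pv x j = psums k x j :> nat.
Proof. by rewrite [LHS]/= ffunE inordK // (leq_trans (psums_lt x j)). Qed.

Let pv_box x : box (pv x).
Proof. by apply/familyP => j; rewrite inE pvE. Qed.

(** The number of representations of [v] by power sums; [vino] is its second moment. *)
Let r v := #|[pred x | pv x == v]|.

Let pv_sum (f : {ffun 'I_k.+1 -> 'I_N} -> F) :
  \sum_x f (pv x) = \sum_(v | box v) (r v)%:R * f v.
Proof.
rewrite (partition_big pv box) //=; apply: eq_bigr => v _.
rewrite (eq_bigr (fun=> f v)) => [|x /eqP->//].
by rewrite sumr_const mulr_natl.
Qed.

Let vinoE : (vino k s M)%:R = \sum_(v | box v) (r v)%:R ^+ 2 :> F.
Proof.
rewrite /vino /energy /coinc natr_sum.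
rewrite (eq_bigr (fun x => (r (pv x))%:R)) => [|x _].
  by rewrite (pv_sum (fun v => (r v)%:R)); apply: eq_bigr => v _; rewrite expr2.
congr _%:R; rewrite /r -sum1_card [RHS]big_mkcond; apply: eq_bigr => y _ /=.
rewrite (_ : (psums k x == psums k y) = (pv y == pv x)); first by rewrite inE; case: (_ == _).
apply/eqP/eqP => [E|/ffunP E]; apply/ffunP => j.
  by apply: val_inj => /=; rewrite !pvE E.
by have := congr1 val (E j); rewrite /= !pvE.
Qed.

(** The kernel of degree [j] that appears when a square is expanded and summed over the box. *)
Definition cross (j : 'I_k.+1) (u v : nat) : F :=
  \sum_(w < (s * M ^ j).+1) chi j (w * u)%N * (chi j (w * v)%N)^*.

Let crossC j u v : `|cross j u v| = `|cross j v u|.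
Proof.
rewrite -[LHS]norm_conjC rmorph_sum; congr `|_|; apply: eq_bigr => w _.
by rewrite rmorphM /= conjCK mulrC.
Qed.

Let box_prod (f : 'I_k.+1 -> nat -> F) :
  \sum_(v | box v) \prod_j f j (v j) = \prod_j \sum_(w < H j) f j w.
Proof.
rewrite (eq_bigr (fun j => \sum_(w < N | (w < H j)%N) f j w)) => [|j _]; last first.
  exact: (big_ord_widen _ (f j)).
by rewrite (bigA_distr_big_dep (fun j (w : 'I_N) => (w < H j)%N) (fun j w => f j w)).
Qed.

(** Group the [x] by their power sums [v] and apply Cauchy-Schwarz: one factor is [vino]. In the
    other, [v] runs over the whole box with weight 1, so the expanded square factors into kernels
    [cross], one per degree. Schur's test, with row sums at most the product of the [U j], yields
    the second [vino]. *)
Lemma double_large_sieve (a : {ffun 'I_s -> 'I_M} -> F) (U : 'I_k.+1 -> F) :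
    (forall x, `|a x| <= 1) ->
    (forall (j : 'I_k.+1) (u : 'I_(s * M ^ j).+1),
       \sum_(v < (s * M ^ j).+1) `|cross j u v| <= U j) ->
  (\sum_(y : {ffun 'I_s -> 'I_M}) `|\sum_x a x * bichar (psums k x) (psums k y)|) ^+ 2
    <= (vino k s M)%:R ^+ 2 * \prod_j U j.
Proof.
move=> a1 HU.
have /fin_all_exists2[z z1 zE] := fun y : {ffun 'I_s -> 'I_M} => norm_phase (\sum_x a x * bichar (psums k x) (psums k y)).
pose g (u : 'I_k.+1 -> nat) := \sum_(y : {ffun 'I_s -> 'I_M}) z y * bichar u (psums k y).
set B := \sum_y _.
have B0 : 0 <= B by apply: sumr_ge0.
have BE : B = \sum_x a x * g (psums k x).
  rewrite /B (eq_bigr (fun y => \sum_x a x * (z y * bichar (psums k x) (psums k y)))).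
    by rewrite exchange_big; apply: eq_bigr => x _; rewrite mulr_sumr.
  by move=> y _; rewrite zE mulr_sumr; apply: eq_bigr => x _; rewrite mulrCA.
have {BE}Bg : B <= \sum_(v | box v) (r v)%:R * `|g (fun j => v j)|.
  rewrite -(ger0_norm B0) BE; apply: le_trans (ler_norm_sum _ _ _) _.
  rewrite -(pv_sum (fun v => `|g (fun j => v j)|)); apply: ler_sum => x _.
  rewrite normrM (_ : g (fun j => pv x j) = g (psums k x)).
    by rewrite ler_piMl.
  by apply: eq_bigr => y _; congr (_ * _); apply: bichar_ext => // j; apply: pvE.
have rr v : (r v)%:R \is (@Num.real F) by apply: realn.
have {Bg}BG : B ^+ 2 <= (vino k s M)%:R * \sum_(v | box v) `|g (fun j => v j)| ^+ 2.
  apply: le_trans (_ : (\sum_(v | box v) (r v)%:R * `|g (fun j => v j)|) ^+ 2 <= _).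
    by rewrite lerXn2r // nnegrE; apply: le_trans Bg.
  rewrite vinoE; apply: cauchy_schwarz_sum => v //; exact: normr_real.
apply: le_trans BG _; rewrite expr2 -mulrA ler_wpM2l ?ler0n //.
pose T (u v : 'I_k.+1 -> nat) : F := \prod_j `|cross j (u j) (v j)|.
have TC u v : T u v = T v u by apply: eq_bigr => j _; apply: crossC.
have key : \sum_(v | box v) `|g (fun j => v j)| ^+ 2 <=
    \sum_y \sum_y' T (fun j => pv y j) (fun j => pv y' j).
  have S0 : 0 <= \sum_(v | box v) `|g (fun j => v j)| ^+ 2.
    by apply: sumr_ge0 => v _; apply: exprn_ge0.
  rewrite -(ger0_norm S0) (eq_bigr (fun v : {ffun 'I_k.+1 -> 'I_N} => \sum_y \sum_y' (z y * (z y')^*) *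
    \prod_j (chi j (v j * pv y j)%N * (chi j (v j * pv y' j)%N)^*))) => [|v _]; last first.
    rewrite normCK rmorph_sum big_distrlr; apply: eq_bigr => y _; apply: eq_bigr => y' _.
    rewrite rmorphM /= mulrACA big_split -rmorph_prod /=; congr (_ * (_ * _^*));
      by apply: eq_bigr => j _; rewrite pvE.
  rewrite exchange_big; apply: le_trans (ler_norm_sum _ _ _) _; apply: ler_sum => y _.
  rewrite exchange_big; apply: le_trans (ler_norm_sum _ _ _) _; apply: ler_sum => y' _.
  rewrite -mulr_sumr normrM normrM norm_conjC.
  rewrite (box_prod (fun j w => chi j (w * pv y j)%N * (chi j (w * pv y' j)%N)^*)).
  rewrite normr_prod ler_piMl ?prodr_ge0 //.
  by rewrite -[X in _ <= X]mul1r ler_pM.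
apply: le_trans key _.
have U1 v : box v -> \sum_(v' | box v') T (fun j => v j) (fun j => v' j) <= \prod_j U j.
  move=> /familyP Hv; rewrite (box_prod (fun j w => `|cross j (v j) w|)).
  apply: ler_prod => j _; rewrite sumr_ge0 //=.
  have := Hv j; rewrite inE => vj; exact: (HU j (Ordinal vj)).
have T0 u v : 0 <= T u v by apply: prodr_ge0.
pose rT (v v' : {ffun 'I_k.+1 -> 'I_N}) : F := (r v)%:R ^+ 2 * T (fun j => v j) (fun j => v' j).
have -> : \sum_y \sum_y' T (fun j => pv y j) (fun j => pv y' j) =
    \sum_(v | box v) \sum_(v' | box v') (r v)%:R * (r v')%:R * T (fun j => v j) (fun j => v' j).
  rewrite (pv_sum (fun v => \sum_y' T (fun j => v j) (fun j => pv y' j))); apply: eq_bigr => v _.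
  rewrite (pv_sum (fun v' => T (fun j => v j) (fun j => v' j))) mulr_sumr.
  by apply: eq_bigr => v' _; rewrite mulrA.
rewrite -(ler_pMn2r (isT : (0 < 2)%N)).
(* Schur's test for a symmetric kernel: [2 r(v) r(v') <= r(v)^2 + r(v')^2]. *)
have key2 : (\sum_(v | box v) \sum_(v' | box v') (r v)%:R * (r v')%:R *
      T (fun j => v j) (fun j => v' j)) *+ 2 <=
    \sum_(v | box v) \sum_(v' | box v') (rT v v' + rT v' v).
  rewrite -sumrMnl; apply: ler_sum => v _; rewrite -sumrMnl; apply: ler_sum => v' _.
  rewrite /rT [X in _ + _ * X]TC -mulrDl -mulrnAl ler_wpM2r //.
  by rewrite -subr_ge0 addrAC -sqrrB real_exprn_even_ge0 // rpredB.
apply: le_trans key2 _.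
rewrite (eq_bigr (fun v => \sum_(v' | box v') rT v v' + \sum_(v' | box v') rT v' v)) => [|v _];
  last by rewrite big_split.
rewrite big_split /= [X in _ + X]exchange_big /= -mulr2n ler_pMn2r //.
rewrite vinoE mulr_suml; apply: ler_sum => v bv.
by rewrite -mulr_sumr ler_wpM2l ?exprn_ge0 ?ler0n // U1.
Qed.

End DoubleLargeSieve.

End LargeSieve.

(** * Addition formulas and chord lengths on the unit circle *)

Module UnitCircle.

Lemma e_fst_add x y : fst (e (x + y)) = fst (e x) * fst (e y) - snd (e x) * snd (e y).
Proof. unfold e; simpl; rewrite <- cos_plus; f_equal; ring. Qed.

Lemma e_snd_add x y : snd (e (x + y)) = fst (e x) * snd (e y) + snd (e x) * fst (e y).
Proof.
  unfold e; simpl.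
  replace (2 * PI * (x + y)) with (2 * PI * x + 2 * PI * y) by ring.
  rewrite sin_plus; ring.
Qed.

Lemma e_unit x : fst (e x) ^ 2 + snd (e x) ^ 2 = 1.
Proof. unfold e; simpl. pose proof (sin2_cos2 (2 * PI * x)) as H; unfold Rsqr in H; lra. Qed.

Lemma e_opp x : e (- x) = (fst (e x), - snd (e x)).
Proof.
  unfold e; simpl.
  replace (2 * PI * - x) with (- (2 * PI * x)) by ring.
  now rewrite cos_neg, sin_neg.
Qed.

(** The chord is [2 sin (pi x)]. For [0 <= a <= 2] one has [sin a >= a - a^3 / 6 >= a / 3], and
    [pi >= 3] then gives [sin (pi x) >= x]. *)
Lemma e_chord x : 0 <= x <= 1 / 2 -> (2 * x) ^ 2 <= (fst (e x) - 1) ^ 2 + snd (e x) ^ 2.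
Proof.
  intros Hx.
  pose proof (e_unit x) as U.
  pose proof PI_4; pose proof PI2_3_2.
  replace ((fst (e x) - 1) ^ 2 + snd (e x) ^ 2) with (2 - 2 * fst (e x)) by lra.
  unfold e; simpl.
  replace (2 * PI * x) with (2 * (PI * x)) by ring.
  rewrite cos_2a_sin.
  assert (Hs : x <= sin (PI * x)).
  { assert (Ha : 0 <= PI * x <= 2) by nra.
    pose proof (pre_sin_bound (PI * x) 0) as [Hs _]; try nra.
    unfold sin_approx, sin_term in Hs; simpl in Hs.
    assert (PI * x / 3 <= sin (PI * x)); [|nra].
    eapply Rle_trans; [|exact Hs].
    set (a := PI * x) in *.
    assert (0 <= a * (4 - a * a)) by (apply Rmult_le_pos; nra).
    nra. }
  nra.
Qed.

(** The chord is [2 |sin (pi x)| <= 2 pi |x|], and [pi <= 4]. *)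
Lemma e_lipschitz x : (fst (e x) - 1) ^ 2 + snd (e x) ^ 2 <= (8 * Rabs x) ^ 2.
Proof.
  pose proof (e_unit x) as U; pose proof PI_4; pose proof PI_RGT_0.
  replace ((fst (e x) - 1) ^ 2 + snd (e x) ^ 2) with (2 - 2 * fst (e x)) by lra.
  unfold e; simpl fst.
  replace (2 * PI * x) with (2 * (PI * x)) by ring.
  rewrite cos_2a_sin.
  assert (Hs : sin (PI * x) ^ 2 <= (PI * x) ^ 2).
  { rewrite <- (pow2_abs (sin _)), <- (pow2_abs (PI * x)).
    apply pow_incr; split; [apply Rabs_pos|].
    assert (Hpos : forall y, 0 <= y -> Rabs (sin y) <= y).
    { intros y Hy. destruct Hy as [Hy|<-]; [|rewrite sin_0, Rabs_R0; lra].
      pose proof (sin_lt_x y Hy).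
      destruct (Rle_lt_dec y PI) as [Hp|Hp].
      - pose proof (sin_ge_0 y); rewrite Rabs_right; lra.
      - pose proof (SIN_bound y); pose proof PI2_3_2.
        apply Rabs_le; lra. }
    destruct (Rle_lt_dec 0 (PI * x)) as [Hx|Hx].
    - rewrite (Rabs_right (PI * x)) by lra. now apply Hpos.
    - rewrite (Rabs_left (PI * x)), <- Rabs_Ropp, <- sin_neg by lra.
      apply Hpos; lra. }
  rewrite Rpow_mult_distr, pow2_abs.
  assert (HP : (PI * x) ^ 2 <= 16 * x ^ 2).
  { rewrite Rpow_mult_distr. apply Rmult_le_compat_r; [apply pow2_ge_0|nra]. }
  simpl in *; lra.
Qed.

End UnitCircle.

(** * Exponential sums *)
Module ExponentialSums.
Import all_boot all_order all_fingroup all_algebra all_field.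
Import all_classical all_reals Rstruct complex.
Import zify ring lra PowerSums LargeSieve UnitCircle.
Set Implicit Arguments. Unset Strict Implicit. Unset Printing Implicit Defensive.
Import Order.TTheory GRing.Theory Num.Theory.
Local Open Scope ring_scope.
Local Open Scope complex_scope.

(** [cis] moves [e] into [R[i]], the field in which the double large sieve is applied; [nm] is the
    modulus there as a real number. *)
Definition cis (x : R) : R[i] := fst (Defs.e x) +i* snd (Defs.e x).
Arguments cis x%_ring_scope.
Definition nm (z : R[i]) : R := complex.Re `|z|.

Lemma nmE z : `|z| = (nm z)%:C.
Proof. by rewrite /nm RRe_real // normr_real. Qed.

Lemma cisD x y : cis (x + y) = cis x * cis y.
Proof. by rewrite /cis e_fst_add e_snd_add. Qed.

Lemma cis0 : cis 0 = 1.
Proof. by rewrite /cis /Defs.e /= Rmult_0_r cos_0 sin_0. Qed.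

Lemma nm_sqr z : nm z ^+ 2 = complex.Re z ^+ 2 + complex.Im z ^+ 2.
Proof.
have := add_Re2_Im2 z; rewrite nmE -rmorphXn => /eqP.
by rewrite eq_complex /= eqxx andbT => /eqP.
Qed.

Lemma nm_ge0 z : 0 <= nm z.
Proof. by rewrite -lecR -nmE normr_ge0. Qed.

Lemma nm_cis x : nm (cis x) = 1.
Proof.
apply/eqP; rewrite -(@pexpr_eq1 _ _ 2) ?nm_ge0 // nm_sqr.
by have := e_unit x; rewrite !RpowE => H; apply/eqP; exact: H.
Qed.

Lemma cisN x : cis (- x) = (cis x)^*%R.
Proof.
by rewrite /cis (_ : Defs.e (- x)%R = (fst (Defs.e x), Ropp (snd (Defs.e x)))) //; exact: e_opp.
Qed.

Lemma nmM x y : nm (x * y) = nm x * nm y.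
Proof.
by apply/eqP; rewrite -(inj_eq (fmorph_inj (real_complex R))) rmorphM /= -!nmE normrM.
Qed.

Lemma nm_sum (I : finType) (P : pred I) (f : I -> R[i]) :
  nm (\sum_(i | P i) f i) <= \sum_(i | P i) nm (f i).
Proof.
rewrite -lecR -nmE rmorph_sum; apply: le_trans (ler_norm_sum _ _ _) _.
by under eq_bigr do rewrite nmE.
Qed.

Lemma nmD x y : nm (x + y) <= nm x + nm y.
Proof. by rewrite -lecR rmorphD /= -!nmE ler_normD. Qed.

Lemma nmN x : nm (- x) = nm x.
Proof. by rewrite /nm normrN. Qed.

Lemma nmJ x : nm (x^*%R) = nm x.
Proof. by rewrite /nm norm_conjC. Qed.

Lemma cis_chord (x : R) : 0 <= x <= 1 / 2 -> 2 * x <= nm (cis x - 1).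
Proof.
move=> /andP[x0 x1]; rewrite -(@ler_pXn2r _ 2) ?nnegrE ?nm_ge0 ?mulr_ge0 //.
rewrite nm_sqr (_ : complex.Im _ = snd (Defs.e x)); last by rewrite /= subr0.
have := @e_chord x; rewrite !RpowE => H; apply/RleP; apply: H.
by split; apply/RleP.
Qed.

Lemma geometric_cis (H : nat) (b : R) :
  nm (\sum_(w < H) cis (b *+ w)) * nm (cis b - 1) <= 2.
Proof.
have E w : cis (b *+ w) = cis b ^+ w.
  by elim: w => [|w IH]; rewrite ?mulr0n ?cis0 // mulrS cisD IH exprS.
under eq_bigr do rewrite E.
rewrite -nmM mulrC -subrX1 -E; apply: le_trans (nmD _ _) _.
by rewrite nmN nm_cis -cis0 nm_cis.
Qed.

Lemma cis_sub1_norm (x : R) : nm (cis `|x| - 1) = nm (cis x - 1).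
Proof.
have [x0|x0] := leP 0 x; first by rewrite ger0_norm.
by rewrite ltr0_norm // cisN -(rmorph1 (@Num.conj R[i])) -rmorphB nmJ rmorph1.
Qed.

(** Cut the range into blocks of length [B]; inside a block, the elements of [G] lie within [D] of
    the least one. *)
Lemma card_clustered (H B D : nat) (G : pred nat) : (0 < B)%N ->
    (forall u v, G u -> G v -> (u <= v)%N -> (v - u < B)%N -> (v - u < D)%N) ->
  (\sum_(u < H | G u) 1 <= (H %/ B).+1 * D)%N.
Proof.
move=> B0 HG.
have bl (u : 'I_H) : (u %/ B < (H %/ B).+1)%N.
  by rewrite ltnS leq_div2r // ltnW.
rewrite (partition_big (fun u : 'I_H => Ordinal (bl u)) predT) //=.
apply: (@leq_trans (\sum_(b < (H %/ B).+1) D)); last by rewrite sum_nat_const card_ord.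
apply: leq_sum => b _.
set A := fun u : 'I_H => G u && (Ordinal (bl u) == b).
have [u0 Au0|A0] := pickP A; last by rewrite big_pred0.
case: (arg_minnP (fun u : 'I_H => u : nat) Au0) => m /andP[Gm /eqP bm] Hm.
have mE : (m %/ B = b)%N by rewrite -bm.
have dist u : A u -> (u - m < D)%N.
  move=> Au; have mu := Hm u Au; case/andP: Au => Gu /eqP bu.
  apply: HG => //; have uE : (u %/ B = b)%N by rewrite -bu.
  by have := ltn_pmod u B0; have := divn_eq u B; have := divn_eq m B; rewrite uE mE; lia.
have D0 : (0 < D)%N by apply: leq_ltn_trans (dist m _); rewrite // /A Gm; apply/eqP.
apply: (@leq_trans (\sum_(i < D) 1)); last by rewrite sum1_card card_ord.
pose h (u : 'I_H) : 'I_D := Ordinal (ltn_pmod (u - m) D0).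
apply: (leq_sum_inj (h := h)) => // u v Au Av [].
rewrite !modn_small ?dist // => E; apply: val_inj => /=.
by have := Hm u Au; have := Hm v Av; lia.
Qed.

(** The inner sum is geometric with phase [al * (u - v)]. Where the chord of this phase is at least
    [eta], it is at most [2 / eta]; elsewhere it is bounded by [H]. Such exceptional [v] are
    clustered: two of them at distance [n < B] satisfy [2 |al| n < 2 eta]. The threshold
    [eta = sqrt |al|] balances the two contributions. *)
Lemma cross_sum_le (H u : nat) (al eta : R) :
    (0 < H)%N -> 0 < eta -> eta ^+ 2 = `|al| -> `|al| <= 1 / 2 ->
  \sum_(v < H) nm (\sum_(w < H) cis (al *+ (w * u)) * (cis (al *+ (w * v)))^*%R)
    <= H%:R ^+ 2 * (8 * eta + 4 / (H%:R * eta)).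
Proof.
move=> H0 e0 ea a2.
have a0 : 0 < `|al| by rewrite -ea exprn_gt0.
have H1 : 1 <= H%:R :> R by rewrite ler1n.
pose d (v : nat) : R := al *+ u - al *+ v.
have tE v : \sum_(w < H) cis (al *+ (w * u)) * (cis (al *+ (w * v)))^*%R =
    \sum_(w < H) cis (d v *+ w).
  apply: eq_bigr => w _; rewrite -cisN -cisD; congr cis.
  by rewrite /d mulrnBl -!mulrnA mulnC [(v * w)%N]mulnC.
pose G (v : nat) : bool := nm (cis (d v) - 1) < eta.
have tG v : nm (\sum_(w < H) cis (d v *+ w)) <= H%:R *+ G v + 2 / eta.
  have [Gv|Gv] := boolP (G v).
    rewrite mulr1n; apply: le_trans (nm_sum _ _) _.
    under eq_bigr do rewrite nm_cis.
    by rewrite sumr_const card_ord lerDl divr_ge0 // ltW.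
  rewrite mulr0n add0r ler_pdivlMr //; apply: le_trans (geometric_cis H (d v)).
  by rewrite ler_wpM2l ?nm_ge0 // leNgt.
(* At distances below [B] the number [|al| * n] stays below [1 / 2], where the chord bound
   applies. *)
pose B := Num.truncn ((2 * `|al|)^-1).
pose D := (Num.truncn (eta / `|al|)).+1.
have inv1 : 1 <= (2 * `|al|)^-1 by rewrite invf_ge1; nra.
have B0 : (0 < B)%N by rewrite truncn_gt0.
have Ble : B%:R <= (2 * `|al|)^-1 by rewrite truncn_le; nra.
have Bge : (4 * `|al|)^-1 <= B%:R.
  have B1 : 1 <= B%:R :> R by rewrite ler1n.
  have := @truncnS_gt R (2 * `|al|)^-1; rewrite -/B -(natr1 B).
  rewrite (_ : (4 * `|al|)^-1 = (2 * `|al|)^-1 / 2); last by field; lra.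
  by move: B1; move: (B%:R : R) ((2 * `|al|)^-1) => b x; lra.
have Dle : D%:R <= eta / `|al| + 1.
  by rewrite -(natr1 (Num.truncn _)) lerD2r truncn_le divr_ge0 // ltW.
have Dgt : eta / `|al| < D%:R by apply: truncnS_gt.
have cnt : (\sum_(v < H | G v) 1 <= (H %/ B).+1 * D)%N.
  apply: card_clustered => // v1 v2 G1 G2 v12 vB.
  rewrite -(ltr_nat R); apply: lt_trans Dgt; set n := (v2 - v1)%N.
  have nB : n%:R <= B%:R :> R by rewrite ler_nat ltnW.
  have x2 : `|al| * n%:R <= 1 / 2.
    apply: le_trans (ler_wpM2l (ltW a0) (le_trans nB Ble)) _.
    by rewrite le_eqVlt; apply/orP; left; apply/eqP; field; lra.
  have x0 : 0 <= `|al| * n%:R by rewrite mulr_ge0 ?ler0n.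
  have := cis_chord (introT andP (conj x0 x2)).
  rewrite -[n%:R]ger0_norm ?ler0n // -normrM cis_sub1_norm normrM normr_nat => ch.
  rewrite ltr_pdivlMr // mulrC.
  suff : nm (cis (al * n%:R) - 1) < 2 * eta by lra.
  have -> : cis (al * n%:R) - 1 = (cis (d v1) - cis (d v2)) * cis (- d v2).
    rewrite mulrBl -!cisD addrN cis0; congr (cis _ - 1).
    rewrite /d mulr_natr mulrnBr //; ring.
  rewrite nmM nm_cis mulr1.
  rewrite (_ : _ - _ = (cis (d v1) - 1) - (cis (d v2) - 1)); last first.
    by rewrite opprB addrA subrK.
  apply: le_lt_trans (nmD _ _) _; rewrite nmN mulr2n mulrDl mul1r.
  exact: ltrD.
rewrite (eq_bigr (fun v : 'I_H => nm (\sum_(w < H) cis (d v *+ w)))) => [|v _];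
  last by rewrite tE.
have S1 : \sum_(v < H) nm (\sum_(w < H) cis (d v *+ w)) <=
    \sum_(v < H) (H%:R *+ G v + 2 / eta) by apply: ler_sum => v _; apply: tG.
apply: le_trans S1 _.
rewrite big_split sumr_const card_ord /=.
have -> : \sum_(v < H) (H%:R *+ G v) = H%:R * (\sum_(v < H | G v) 1)%:R :> R.
  rewrite natr_sum mulr_sumr [RHS]big_mkcond; apply: eq_bigr => v _.
  by case: (G v); rewrite ?mulr1 ?mulr0n ?mulr1n.
have cntR : (\sum_(v < H | G v) 1)%:R <= (H%:R * (4 * `|al|) + 1) * (eta / `|al| + 1) :> R.
  apply: le_trans (_ : ((H %/ B).+1 * D)%:R <= _); first by rewrite ler_nat.
  rewrite natrM -(natr1 (H %/ B)); apply: ler_pM => //; rewrite ?addr_ge0 ?ler0n // lerD2r.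
  have BR : 0 < B%:R :> R by rewrite ltr0n.
  have h1 : (H %/ B)%:R * B%:R <= H%:R :> R by rewrite -natrM ler_nat leq_trunc_div.
  have h2 : 1 <= B%:R * (4 * `|al|).
    by rewrite -ler_pdivrMr ?mul1r // mulr_gt0.
  have h0 : 0 <= (H %/ B)%:R :> R by rewrite ler0n.
  nra.
have eta1 : eta <= 1 by nra.
have ie : eta / `|al| = eta^-1 by rewrite -ea; field; lra.
rewrite ie -ea in cntR.
have ie0 : 0 < eta^-1 by rewrite invr_gt0.
have iee : eta * eta^-1 = 1 by rewrite divff // gt_eqF.
rewrite -[(2 / eta) *+ H]mulr_natl.
rewrite (_ : H%:R ^+ 2 * (8 * eta + 4 / (H%:R * eta)) =
   H%:R * (8 * eta * H%:R + 4 * eta^-1)); last by field; apply/andP; split; lra.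
rewrite -mulrDr ler_pM2l ?ltr0n //.
have E : (H%:R * (4 * eta ^+ 2) + 1) * (eta^-1 + 1) =
   4 * (H%:R * eta) * (eta * eta^-1) + 4 * ((H%:R * eta) * eta) + eta^-1 + 1 by ring.
rewrite {}E iee in cntR.
have i1 : 1 <= eta^-1 by rewrite invf_ge1.
have He : (H%:R * eta) * eta <= H%:R * eta by rewrite ler_piMr // mulr_ge0 ?ler0n // ltW.
move: cntR He i1; rewrite [8 * eta * _]mulrAC -[8 * H%:R * _]mulrA.
move: (_%:R) (H%:R * eta) (H%:R * eta * eta) (eta^-1) => c x y i; lra.
Qed.

Lemma cis_sum (I : finType) (f : I -> R) : cis (\sum_i f i) = \prod_i cis (f i).
Proof. exact: (big_morph _ cisD cis0). Qed.

Definition poly_phase_sum (k M : nat) (al : nat -> R) : R[i] :=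
  \sum_(x < M) \sum_(y < M) cis (\sum_(j < k.+1) al j *+ ((x * y) ^ j)%N).

(** Since [(x y)^j = x^j y^j], the phase is bilinear in the vectors of powers. Only the degree [j0]
    receives the nontrivial row bound; every other kernel is bounded by its number of terms. *)
Lemma poly_phase_sum_bound (k s M j0 : nat) (al : nat -> R) (eta : R) :
    (0 < s)%N -> (0 < M)%N -> (j0 <= k)%N ->
    0 < eta -> eta ^+ 2 = `|al j0| -> `|al j0| <= 1 / 2 ->
  nm (poly_phase_sum k M al) ^+ (s * s * 2) <=
    ((M ^ (s * s.-1) * M ^ (s * s.-1)) ^ 2 * vino k s M ^ 2 *
     \prod_(j < k.+1) (s * M ^ j).+1 ^ 2)%N%:R *
    (8 * eta + 4 / ((s * M ^ j0).+1%:R * eta)).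
Proof.
move=> s0 M0 jk e0 ea a2.
pose chi (j : 'I_k.+1) (n : nat) : R[i] := cis (al j *+ n).
have chi0 j : chi j 0%N = 1 by rewrite /chi mulr0n cis0.
have chiD j m n : chi j (m + n)%N = chi j m * chi j n by rewrite /chi mulrnDr cisD.
have WE : poly_phase_sum k M al = bilinear_sum M chi.
  apply: eq_bigr => x _; apply: eq_bigr => y _; rewrite cis_sum; apply: eq_bigr => j _.
  by rewrite /chi expnMn.
have [a a1] := bilinear_sum_le M chi0 chiD s0.
rewrite -WE; set B := \sum_y _ => HB.
pose V := (8 * eta + 4 / ((s * M ^ j0).+1%:R * eta))%R.
have e0' := ltW e0.
have V0 : 0 <= V.
  by rewrite /V !(addr_ge0, mulr_ge0, invr_ge0, ler0n).
pose U (j : 'I_k.+1) := ((s * M ^ j).+1 ^ 2)%:R * (if j == j0 :> nat then V else 1).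
have HU (j : 'I_k.+1) (u : 'I_(s * M ^ j).+1) :
    \sum_(v < (s * M ^ j).+1) `|cross s M chi j u v| <= (U j)%:C.
  under eq_bigr do rewrite nmE.
  rewrite -rmorph_sum lecR /U; case: eqP => [jj|_].
    by rewrite natrX /V -jj; apply: (@cross_sum_le (s * M ^ j).+1 u (al j) eta); rewrite ?jj.
  rewrite mulr1 natrX expr2.
  have -> : (s * M ^ j).+1%:R * (s * M ^ j).+1%:R =
     \sum_(v < (s * M ^ j).+1) (s * M ^ j).+1%:R :> R.
    by rewrite sumr_const card_ord mulr_natr.
  apply: ler_sum => v _; apply: le_trans (nm_sum _ _) _.
  under eq_bigr do rewrite nmM nmJ !nm_cis mulr1.
  by rewrite sumr_const card_ord.
have H2 := double_large_sieve M0 a1 HU.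
have UE : \prod_j (U j)%:C = ((\prod_(j < k.+1) (s * M ^ j).+1 ^ 2)%N%:R * V)%:C.
  rewrite -rmorph_prod /=; congr _%:C; rewrite /U big_split /= natr_prod; congr (_ * _).
  rewrite (bigD1 (Ordinal (jk : (j0 < k.+1)%N))) //= eqxx big1 ?mulr1 // => j.
  by rewrite -val_eqE /= => /negPf->.
rewrite {}UE in H2.
rewrite -lecR rmorphXn /= -nmE exprM -/V.
move: (M ^ (s * s.-1) * M ^ (s * s.-1))%N HB => c HB.
move: (\prod_(j < k.+1) _)%N H2 => p H2.
have natC n : (n%:R : R)%:C = n%:R by exact: rmorph_nat.
have C0 : 0 <= `|poly_phase_sum k M al| ^+ (s * s) by apply: exprn_ge0.
have B0 : 0 <= B by apply: sumr_ge0.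
have H1 : (`|poly_phase_sum k M al| ^+ (s * s)) ^+ 2 <= (c%:R * B) ^+ 2.
  by rewrite lerXn2r // nnegrE // mulr_ge0 ?ler0n.
apply: le_trans H1 _.
rewrite exprMn -mulnA natrM -mulrA rmorphM /= natC natrX ler_wpM2l ?exprn_ge0 ?ler0n //.
apply: le_trans H2 _.
by rewrite natrM -mulrA [X in _ <= X]rmorphM /= natC natrX.
Qed.

Lemma cis_lipschitz (a b : R) : nm (cis a - cis b) <= 8 * `|a - b|.
Proof.
have -> : cis a - cis b = (cis (a - b) - 1) * cis b.
  by rewrite mulrBl mul1r -cisD subrK.
rewrite nmM nm_cis mulr1; move: (a - b) => x.
rewrite -(@ler_pXn2r _ 2) ?nnegrE ?nm_ge0 ?mulr_ge0 //.
rewrite nm_sqr (_ : complex.Im _ = snd (Defs.e x)); last by rewrite /= subr0.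
have e8 : IZR 8 = 8%:R :> R by rewrite -INRE INR_IZR_INZ.
have := e_lipschitz x; rewrite !RpowE RabsE e8 => H; apply/RleP; exact: H.
Qed.

(** A shift by one exchanges a single term at either end, at a cost of at most 2. *)
Lemma shift_sum_le (F : nat -> R[i]) (a N z : nat) :
    (forall n, nm (F n) <= 1) ->
  nm (\sum_(i < N) F (a + i)%N - \sum_(i < N) F (a + i + z)%N) <= (2 * z)%:R.
Proof.
move=> F1; elim: z => [|z IH].
  rewrite [X in _ - X](_ : _ = \sum_(i < N) F (a + i)%N).
    by rewrite subrr /nm normr0.
  by apply: eq_bigr => i _; rewrite addn0.
have step : nm (\sum_(i < N) F (a + i + z)%N - \sum_(i < N) F (a + i + z.+1)%N) <= 2.
  case: N {IH} => [|N]; first by rewrite !big_ord0 subrr /nm normr0.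
  rewrite big_ord_recl [X in _ - X]big_ord_recr /=.
  have -> : \sum_(i < N) F (a + bump 0 i + z)%N = \sum_(i < N) F (a + i + z.+1)%N.
    by apply: eq_bigr => i _; rewrite /bump add1n !addnS addSn.
  rewrite opprD [X in _ + X]addrC addrACA subrr addr0.
  by apply: le_trans (nmD _ _) _; rewrite nmN mulr2n; apply: lerD.
have -> : \sum_(i < N) F (a + i)%N - \sum_(i < N) F (a + i + z.+1)%N =
  (\sum_(i < N) F (a + i)%N - \sum_(i < N) F (a + i + z)%N) +
  (\sum_(i < N) F (a + i + z)%N - \sum_(i < N) F (a + i + z.+1)%N).
  by rewrite addrA subrK.
apply: le_trans (nmD _ _) _; rewrite mulnS addnC natrD; exact: lerD.
Qed.

Lemma nm_nat n : nm n%:R = n%:R.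
Proof. by rewrite /nm normr_nat -(rmorph_nat (real_complex R)). Qed.

Lemma averaging (F : nat -> R[i]) (a N M : nat) :
    (forall n, nm (F n) <= 1) ->
  nm (\sum_(i < N) F (a + i)%N) * (M * M)%:R <=
    \sum_(i < N) nm (\sum_(x < M) \sum_(y < M) F (a + i + x * y)%N) +
    (2 * (M * M))%:R * (M * M)%:R.
Proof.
move=> F1; set S := \sum_(i < N) F _.
have -> : nm S * (M * M)%:R = nm (\sum_(x < M) \sum_(y < M) S).
  rewrite -nm_nat -nmM; congr nm.
  under eq_bigr do rewrite sumr_const card_ord.
  by rewrite sumr_const card_ord -mulrnA mulr_natr.
have -> : \sum_(x < M) \sum_(y < M) S =
   \sum_(i < N) \sum_(x < M) \sum_(y < M) F (a + i + x * y)%N +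
   \sum_(x < M) \sum_(y < M) (S - \sum_(i < N) F (a + i + x * y)%N).
  rewrite [X in _ = X + _]exchange_big -big_split; apply: eq_bigr => x _ /=.
  rewrite [X in _ = X + _]exchange_big -big_split; apply: eq_bigr => y _ /=.
  by rewrite addrC subrK.
apply: le_trans (nmD _ _) _; apply: lerD; first exact: nm_sum.
have -> : (2 * (M * M))%:R * (M * M)%:R = \sum_(x < M) \sum_(y < M) (2 * (M * M))%:R :> R.
  under eq_bigr do rewrite sumr_const card_ord.
  by rewrite sumr_const card_ord -mulrnA mulr_natr.
apply: le_trans (nm_sum _ _) _; apply: ler_sum => x _.
apply: le_trans (nm_sum _ _) _; apply: ler_sum => y _.
apply: le_trans (shift_sum_le _ _ _ F1) _.
by rewrite ler_nat leq_mul2l /= leq_mul // ltnW.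
Qed.

Lemma averaging_poly (f : nat -> R) (al : nat -> nat -> R) (a N M k : nat) (err B : R) :
    (forall i, (i < N)%N -> nm (poly_phase_sum k M (al i)) <= B) ->
    (forall i z, (i < N)%N -> (z <= M * M)%N ->
       `|f (a + i + z)%N - \sum_(j < k.+1) al i j *+ (z ^ j)| <= err) ->
    (0 < M)%N ->
  nm (\sum_(i < N) cis (f (a + i)%N)) <=
    N%:R * (B / (M * M)%:R + 8 * err) + (2 * (M * M))%:R.
Proof.
move=> HB Herr M0.
have MM : 0 < (M * M)%:R :> R by rewrite ltr0n muln_gt0 M0.
rewrite -(ler_pM2r MM).
have F1 n : nm (cis (f n)) <= 1 by rewrite nm_cis.
apply: le_trans (averaging a N M F1) _.
rewrite mulrDl lerD2r.
have -> : N%:R * (B / (M * M)%:R + 8 * err) * (M * M)%:R =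
   \sum_(i < N) (B + (8 * err) * (M * M)%:R).
  by rewrite sumr_const card_ord -[RHS]mulr_natl -mulrA mulrDl divfK // gt_eqF.
apply: ler_sum => i _.
have -> : \sum_(x < M) \sum_(y < M) cis (f (a + i + x * y)%N) = poly_phase_sum k M (al i) +
   \sum_(x < M) \sum_(y < M) (cis (f (a + i + x * y)%N) -
      cis (\sum_(j < k.+1) al i j *+ ((x * y) ^ j)%N)).
  rewrite /poly_phase_sum -big_split; apply: eq_bigr => x _.
  by rewrite -big_split; apply: eq_bigr => y _ /=; rewrite addrC subrK.
apply: le_trans (nmD _ _) _; apply: lerD; first exact: HB.
have -> : 8 * err * (M * M)%:R = \sum_(x < M) \sum_(y < M) 8 * err.
  under eq_bigr do rewrite sumr_const card_ord.
  by rewrite sumr_const card_ord -mulrnA mulr_natr.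
apply: le_trans (nm_sum _ _) _; apply: ler_sum => x _.
apply: le_trans (nm_sum _ _) _; apply: ler_sum => y _.
apply: le_trans (cis_lipschitz _ _) _; rewrite ler_pM2l //.
by apply: Herr => //; rewrite leq_mul // ltnW.
Qed.

Lemma Cmod_sum_cis (g : nat -> R) (a N : nat) :
  Cmod (sum_n_m (fun n : nat => Defs.e (g n)) a.+1 (a + N)) =
  nm (\sum_(i < N) cis (g (a.+1 + i)%N)).
Proof.
have E : sum_n_m (fun n : nat => Defs.e (g n)) a.+1 (a + N) =
   (complex.Re (\sum_(i < N) cis (g (a.+1 + i)%N)), complex.Im (\sum_(i < N) cis (g (a.+1 + i)%N))).
  elim: N => [|N IH]; first by rewrite addn0 big_ord0 sum_n_m_zero //; apply/ssrnat.ltP.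
  rewrite addnS sum_n_Sm; last by apply/ssrnat.leP; rewrite ltnS leq_addr.
  rewrite IH big_ord_recr /= addSn.
  by case: (\sum_(i < N) _) => u v.
by rewrite E /Cmod RsqrtE !RpowE /nm normc_def.
Qed.

End ExponentialSums.

(** * The bilinear Weyl sum bound in exponential form *)

Module WeylBound.
Import all_boot all_order all_fingroup all_algebra all_field.
Import all_classical all_reals Rstruct complex.
Import zify PowerSums MeanValue ExponentialSums.
Set Implicit Arguments. Unset Strict Implicit. Unset Printing Implicit Defensive.
Import Order.TTheory GRing.Theory Num.Theory.
Local Open Scope R_scope.

Lemma natr_IZR n : (n%:R)%R = IZR (Z.of_nat n) :> R.
Proof. by rewrite -INRE INR_IZR_INZ. Qed.

Lemma prod_box_le (s k M : nat) : (0 < s)%N -> (0 < M)%N ->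
  (\prod_(j < k.+1) (s * M ^ j).+1 ^ 2 <= (2 * s) ^ (2 * k.+1) * M ^ (k.+1 * k))%N.
Proof.
move=> s0 M0; apply: (@leq_trans (\prod_(j < k.+1) ((2 * s) ^ 2 * M ^ (2 * j)))%N).
  apply: leq_prod => j _; rewrite [(2 * j)%N]mulnC expnM -expnMn leq_exp2r //.
  rewrite -mulnA mul2n -addnn -addn1 leq_add2l muln_gt0 s0 expn_gt0 M0 //.
have E : (2 * 'C(k.+1, 2) = k.+1 * k)%N.
  by elim: (k) => // n IH; rewrite binS bin1 mulnDr IH; lia.
rewrite big_split /= prod_nat_const card_ord -expnM leq_mul // -expn_sum -big_distrr /=.
by rewrite -(big_mkord predT (fun i => i)) bin2_sum E.
Qed.

Lemma pow_lt_mono (x y : R) (n : nat) : 0 < x < y -> x ^ n.+1 < y ^ n.+1.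
Proof.
move=> Hx; elim: n => [|n IH]; first by rewrite !pow_1; lra.
rewrite -[x ^ _]/(x * x ^ n.+1) -[y ^ _]/(y * y ^ n.+1).
have xn : 0 < x ^ n.+1 by apply: pow_lt; lra.
by apply: Rmult_le_0_lt_compat; lra.
Qed.

Lemma le_exp_of_pow (x y : R) (n : nat) : (0 < n)%N -> 0 <= x ->
  x ^ n <= exp (INR n * y) -> x <= exp y.
Proof.
move=> n0 x0; rewrite -exp_natmul => H.
case: (Rle_lt_dec x (exp y)) => // xy; exfalso.
have e0 := exp_pos y.
have : exp y ^ n < x ^ n by case: n n0 {H} => // n _; apply: pow_lt_mono; lra.
lra.
Qed.

(** Powers of [M = P ^ m]: [4 s (s - 1)] from Hoelder, [4 s - k (k + 1)] from the squared mean
    value, [k (k + 1)] from the box. They add up to [4 s^2], the trivial bound. What remains are the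
    losses and the saving [v], divided by [2 s^2] when the root is taken. *)
Lemma weyl_exp_bound (k P m j0 : nat) (al : nat -> R) (eta v : R)
    (s := (k ^ 3 + k ^ 2 + k)%N) (kr := INR k) (sr := INR s) (mu := INR m * ln (INR P)) :
    (0 < k)%N -> prime P -> (4 * k ^ 2 <= P)%N -> (j0 <= k)%N ->
    0 < eta -> eta ^ 2 = Rabs (al j0) -> Rabs (al j0) <= 1 / 2 ->
    eta <= exp (- v) -> exp v <= INR (s * (P ^ m) ^ j0).+1 * eta ->
  nm (poly_phase_sum k (P ^ m) al) <=
    exp (2 * mu + (kr * (kr + 1) * exp (- kr) * mu +
      2 * kr ^ 2 * (ln 4 + (2 * sr + 1) * ln sr + ln (INR P) * (kr + kr ^ 2)) +
      (2 * kr + 2) * ln (2 * sr) + 4 - v) / (2 * sr ^ 2)).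
Proof.
move=> k0 pP kP jk e0 ea a2 ev Hv.
have s0 : (0 < s)%N by rewrite /s addn_gt0 k0 orbT.
have P0 : (0 < P)%N := prime_gt0 pP.
have M0 : (0 < P ^ m)%N by rewrite expn_gt0 P0.
pose a := (s * s.-1)%N.
pose N1 := (((P ^ m) ^ a * (P ^ m) ^ a) ^ 2 * vino k s (P ^ m) ^ 2 *
     \prod_(j < k.+1) (s * (P ^ m) ^ j).+1 ^ 2)%N.
set Hn := (s * (P ^ m) ^ j0).+1 in Hv.
have H : nm (poly_phase_sum k (P ^ m) al) ^ (s * s * 2) <=
    INR N1 * (8 * eta + 4 / (INR Hn * eta)).
  have a2' : (`|al j0| <= 1 / 2)%R by apply/RleP; rewrite -RabsE.
  have ea' : (eta ^+ 2 = `|al j0|)%R by rewrite -RpowE -RabsE.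
  have e0' : (0 < eta)%R by apply/RltP.
  have e8 : (8%:R)%R = IZR 8 :> R by rewrite natr_IZR.
  have e4 : (4%:R)%R = IZR 4 :> R by rewrite natr_IZR.
  have := poly_phase_sum_bound s0 M0 jk e0' ea' a2'; rewrite e8 e4 => /RleP H.
  by rewrite RpowE !INRE; exact: H.
have kr1 : 1 <= kr by rewrite /kr -[1]/(INR 1); apply: INR_le.
have sr1 : 1 <= sr by rewrite /sr -[1]/(INR 1); apply: INR_le.
have ME n : INR ((P ^ m) ^ n)%N = exp (INR n * mu).
  by rewrite -expnM INR_expn_exp // INR_muln /mu; congr exp; ring.
set A0 := ln 4 + (2 * sr + 1) * ln sr + ln (INR P) * (kr + kr ^ 2).
set K := kr * (kr + 1) * exp (- kr) * mu.
set T := (_ + _ + _ + 4 - v).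
have aE : INR a = sr * (sr - 1).
  rewrite /a INR_muln -/sr; congr (_ * _).
  have := S_INR s.-1; rewrite prednK // -/sr; lra.
have HJ : INR (vino k s (P ^ m)) <= exp (kr ^ 2 * A0 + mu * (2 * sr - kr * (kr + 1) / 2) + K / 2).
  apply: Rle_trans (vinogradov_mean_value m k0 pP kP) _.
  by apply: exp_le; right; rewrite -/kr -/s -/sr -/A0 /K /mu; field.
have HN1 : INR N1 <= exp (4 * sr ^ 2 * mu + (K + 2 * kr ^ 2 * A0 + (2 * kr + 2) * ln (2 * sr))).
  rewrite /N1 !INR_muln ME aE.
  have Hp : INR (\prod_(j < k.+1) (s * (P ^ m) ^ j).+1 ^ 2)%N <=
     exp ((2 * kr + 2) * ln (2 * sr) + kr * (kr + 1) * mu).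
    apply: Rle_trans (INR_le (prod_box_le k s0 M0)) _; right.
    rewrite INR_muln ME INR_expn_exp ?muln_gt0 // -exp_plus; congr exp.
    rewrite !INR_muln (S_INR k) -/kr -/sr (_ : INR 2 = 2) //; ring.
  set J := INR (vino _ _ _) in HJ *; have J0 : 0 <= J by apply: pos_INR.
  set p := INR _ in Hp *; have p0 : 0 <= p by apply: pos_INR.
  have E0 := exp_pos (sr * (sr - 1) * mu).
  have -> : 4 * sr ^ 2 * mu + (K + 2 * kr ^ 2 * A0 + (2 * kr + 2) * ln (2 * sr)) =
    ((sr * (sr - 1) * mu + sr * (sr - 1) * mu) + (sr * (sr - 1) * mu + sr * (sr - 1) * mu)) +
    ((kr ^ 2 * A0 + mu * (2 * sr - kr * (kr + 1) / 2) + K / 2) +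
     (kr ^ 2 * A0 + mu * (2 * sr - kr * (kr + 1) / 2) + K / 2)) +
    ((2 * kr + 2) * ln (2 * sr) + kr * (kr + 1) * mu) by field.
  rewrite 5!exp_plus; apply: Rmult_le_compat => //.
    by apply: Rmult_le_pos; [left; repeat apply: Rmult_lt_0_compat | apply: Rmult_le_pos].
  apply: Rmult_le_compat_l; first by left; repeat apply: Rmult_lt_0_compat.
  exact: Rmult_le_compat.
have ev0 := exp_pos v.
have HH : 0 < INR Hn * eta by lra.
(* Both summands are multiples of [exp (- v)], with [8 + 4 = 12 <= exp 4]. *)
have HV : 8 * eta + 4 / (INR Hn * eta) <= exp (4 - v).
  have -> : 4 - v = 4 + - v by ring.
  rewrite exp_plus.
  have i1 : / (INR Hn * eta) <= exp (- v).
    by rewrite exp_Ropp; apply: Rinv_le_contravar.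
  have e4 : 12 <= exp 4.
    have := exp_ineq1_le 1; have -> : 4 = INR 4 * 1 by rewrite /=; ring.
    by rewrite -exp_natmul => H1; have := pow_incr 2 (exp 1) 4; rewrite /=; lra.
  have := exp_pos (- v); rewrite /Rdiv; nra.
have x0 : 0 <= nm (poly_phase_sum k (P ^ m) al) by apply/RleP; apply: nm_ge0.
have n0 : (0 < s * s * 2)%N by rewrite !muln_gt0 s0.
apply: (le_exp_of_pow n0 x0); apply: Rle_trans H _.
have -> : INR (s * s * 2) * (2 * mu + T / (2 * sr ^ 2)) =
   (4 * sr ^ 2 * mu + (K + 2 * kr ^ 2 * A0 + (2 * kr + 2) * ln (2 * sr))) + (4 - v).
  by rewrite !INR_muln -/sr [INR 2]/= /T; field; lra.
rewrite exp_plus; apply: Rmult_le_compat => //; first exact: pos_INR.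
have := Rinv_0_lt_compat _ HH; rewrite /Rdiv; lra.
Qed.

(* As in Euclid: a prime divisor of [n`! + 1] with [n = 4 * k ^ 2]. *)
Lemma prime_large (k : nat) : (0 < k)%N ->
  exists P, [/\ prime P, (4 * k ^ 2 <= P)%N & ln (INR P) <= 17 * INR k ^ 3].
Proof.
move=> k0; set n := (4 * k ^ 2)%N.
have n0 : (0 < n)%N by rewrite muln_gt0 expn_gt0 k0.
pose P := pdiv n`!.+1.
have pP : prime P by apply: pdiv_prime; rewrite ltnS fact_gt0.
exists P; split => //.
  rewrite leqNgt; apply/negP => Pn.
  have : P %| n`!.+1 by apply: pdiv_dvd.
  rewrite -addn1 dvdn_addr ?dvdn1; first by move=> /eqP P1; rewrite P1 in pP.
  by rewrite dvdn_fact // prime_gt0 //= ltnW.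
have Pl : (P <= 2 * n ^ n)%N.
  apply: leq_trans (pdiv_leq _) _ => //.
  have := fact_le_expn n; have : (0 < n ^ n)%N by rewrite expn_gt0 n0.
  lia.
have kr1 : 1 <= INR k by rewrite -[1]/(INR 1); apply: INR_le.
apply: Rle_trans (ln_mono _ (INR_le Pl)) _.
  by apply: lt_0_INR; apply/ssrnat.ltP; apply: prime_gt0.
have nR : INR n = (2 * INR k) ^ 2 by rewrite INR_muln INR_expn [INR 4]/=; ring.
have nRp : 0 < INR n by apply: lt_0_INR; apply/ssrnat.ltP.
rewrite INR_muln INR_expn ln_mult; [|by rewrite [INR 2]/=; lra|exact: pow_lt].
rewrite ln_pow // {2}nR ln_pow; last lra.
have ln_le x : 0 < x -> ln x <= x - 1.
  by move=> x1; have := exp_ineq1_le (ln x); rewrite exp_ln; lra.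
have := ln_le 2; have := ln_le (2 * INR k); rewrite nR [INR 2]/= => H1 H2.
have {}H1 := H1 ltac:(lra); have {}H2 := H2 ltac:(lra).
have k2 : 0 <= INR k ^ 2 by apply: pow2_ge_0.
rewrite (_ : 1 + 1 = 2); last ring.
nra.
Qed.

End WeylBound.

(** * Local polynomial approximation of the phase *)
Module FormalExpansion.
Import all_boot all_order all_algebra.
Import zify ring lra.
Set Implicit Arguments. Unset Strict Implicit. Unset Printing Implicit Defensive.
Import Order.TTheory GRing.Theory Num.Theory.
Local Open Scope ring_scope.

Section Poly.
Variable K : realFieldType.
Implicit Types (mu r : K).

(** Cauchy's majorants: they pass through sums, products and compositions, so that an absolute bound
    at radius [r] becomes one evaluation. *)
Definition majorizes (a p : {poly K}) := forall i, `|p`_i| <= a`_i.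

Lemma majorizesD (a b p q : {poly K}) : majorizes a p -> majorizes b q -> majorizes (a + b) (p + q).
Proof. by move=> Hp Hq i; rewrite !coefD; apply: le_trans (ler_normD _ _) (lerD _ _). Qed.

Lemma majorizesM (a b p q : {poly K}) : majorizes a p -> majorizes b q -> majorizes (a * b) (p * q).
Proof.
move=> Hp Hq i; rewrite !coefM; apply: le_trans (ler_norm_sum _ _ _) _.
by apply: ler_sum => j _; rewrite normrM ler_pM.
Qed.

Lemma majorizesZ c a p : majorizes a p -> majorizes (`|c| *: a) (c *: p).
Proof. by move=> Hp i; rewrite !coefZ normrM ler_wpM2l. Qed.

Lemma majorizes1 : majorizes 1 1.
Proof. by move=> i; rewrite coef1; case: eqP; rewrite ?normr1 ?normr0. Qed.

Lemma majorizes0 : majorizes 0 0.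
Proof. by move=> i; rewrite coef0 normr0. Qed.

Lemma majorizesX a p n : majorizes a p -> majorizes (a ^+ n) (p ^+ n).
Proof.
move=> Hp; elim: n => [|n IH]; first exact: majorizes1.
by rewrite !exprS; apply: majorizesM.
Qed.

Lemma majorizes_sum (I : Type) (s : seq I) (P : pred I) (a p : I -> {poly K}) :
  (forall i, majorizes (a i) (p i)) ->
  majorizes (\sum_(i <- s | P i) a i) (\sum_(i <- s | P i) p i).
Proof.
move=> H; apply: (big_ind2 majorizes) => //; first exact: majorizes0.
by move=> *; apply: majorizesD.
Qed.

Lemma majorizes_horner a p r n : 0 <= r -> majorizes a p ->
  \sum_(i < n) `|p`_i| * r ^+ i <= a.[r].
Proof.
move=> r0 Hp; rewrite (@horner_coef_wide _ (maxn n (size a))) ?leq_maxr //.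
rewrite (big_ord_widen (maxn n (size a)) (fun i => `|p`_i| * r ^+ i)) ?leq_maxl //.
rewrite big_mkcond; apply: ler_sum => i _; case: ifP => _.
  by rewrite ler_wpM2r ?exprn_ge0.
by rewrite mulr_ge0 ?exprn_ge0 // (le_trans _ (Hp i)).
Qed.

(* Truncation of ln (1 + t) = - ln (1 - u) as a power series in u = t / (1 + t): unlike
   the series in t, it has nonnegative coefficients. *)
Definition log_poly k : {poly K} := \sum_(i < k) i.+1%:R^-1 *: 'X^(i.+1).

(** The powers start at 2: in the exponent of [h(n + z) / h(n)] the constant term cancels, and the
    linear one is kept apart as the factor [(1 + t)^lam]. *)
Definition comp_poly_sum (b : nat -> K) k : {poly K} :=
  \sum_(i < k.-1) b i.+2 *: log_poly k ^+ i.+2.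

Definition exp_poly k : {poly K} := \sum_(q < k.+1) (q`!%:R)^-1 *: 'X^q.

Definition series_poly b k : {poly K} := exp_poly k \Po comp_poly_sum b k.

Lemma log_poly_horner k x : (log_poly k).[x] = \sum_(i < k) x ^+ i.+1 / i.+1%:R.
Proof.
rewrite horner_sum; apply: eq_bigr => i _.
by rewrite hornerZ hornerXn mulrC.
Qed.

Lemma comp_poly_sum_horner b k x :
  (comp_poly_sum b k).[x] = \sum_(i < k.-1) b i.+2 * (log_poly k).[x] ^+ i.+2.
Proof.
by rewrite horner_sum; apply: eq_bigr => i _; rewrite hornerZ horner_exp.
Qed.

Lemma exp_poly_horner k x : (exp_poly k).[x] = \sum_(q < k.+1) x ^+ q / q`!%:R.
Proof.
by rewrite horner_sum; apply: eq_bigr => i _; rewrite hornerZ hornerXn mulrC.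
Qed.

Lemma series_poly_horner b k x :
  (series_poly b k).[x] = (exp_poly k).[(comp_poly_sum b k).[x]].
Proof. exact: horner_comp. Qed.

Lemma series_poly0 b k : (series_poly b k)`_0 = 1.
Proof.
rewrite -horner_coef0 series_poly_horner comp_poly_sum_horner log_poly_horner.
rewrite [X in _.[X]]big1 => [|i _].
  rewrite exp_poly_horner big_ord_recl expr0 fact0 divr1 big1 ?addr0 // => i _.
  by rewrite expr0n mul0r.
rewrite [X in X ^+ _]big1 ?expr0n ?mulr0 // => j _.
by rewrite expr0n mul0r.
Qed.

Lemma log_poly_majorizes k : majorizes (log_poly k) (log_poly k).
Proof.
apply: majorizes_sum => i j; rewrite coefZ coefXn normrM ger0_norm ?invr_ge0 ?ler0n //.
by case: eqP; rewrite ?normr1 ?normr0.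
Qed.

Lemma geo_sum_le (S : K) n : 0 <= S <= 1 / 2 -> \sum_(q < n) S ^+ q.+1 <= 2 * S.
Proof.
move=> /andP[S0 S1]; have y0 m : 0 <= S ^+ m by apply: exprn_ge0.
suff : \sum_(q < n) S ^+ q.+1 <= 2 * S * (1 - S ^+ n).
  move=> H; apply: le_trans H _; rewrite ler_piMr ?mulr_ge0 //.
  by rewrite gerBl.
elim: n => [|n IH]; first by rewrite big_ord0 expr0 subrr mulr0.
rewrite big_ord_recr /=; apply: le_trans (lerD IH (lexx _)) _.
rewrite exprS; have := y0 n; move: (S ^+ n) => y y_ge0.
have S2 : 0 <= 1 - 2 * S by lra.
have := mulr_ge0 (mulr_ge0 S0 y_ge0) S2; nra.
Qed.

(** [log_poly] has nonnegative coefficients and majorizes itself, so the composite is majorized by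
    the one with [|b|]. Without its constant term, the latter is at [r] at most the geometric sum of
    the powers of [S], the factorials being dropped. *)
Lemma series_poly_norm b k r S n :
    0 <= r -> \sum_(i < k.-1) `|b i.+2| * (log_poly k).[r] ^+ i.+2 <= S -> S <= 1 / 2 ->
  \sum_(i < n) `|(series_poly b k)`_i.+1| * r ^+ i.+1 <= 2 * S.
Proof.
move=> r0 HS S2.
pose a : {poly K} := \sum_(i < k.-1) `|b i.+2| *: log_poly k ^+ i.+2.
have aY : majorizes a (comp_poly_sum b k).
  apply: majorizes_sum => i; apply: majorizesZ; apply: majorizesX.
  exact: log_poly_majorizes.
have ar : a.[r] <= S.
  apply: le_trans HS; rewrite horner_sum; apply: ler_sum => i _.
  by rewrite hornerZ horner_exp.
have a0 : 0 <= a.[r].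
  by have := majorizes_horner 0 r0 aY; rewrite big_ord0.
have S0 : 0 <= S by apply: le_trans ar.
pose Q1 : {poly K} := \sum_(q < k) (q.+1`!%:R)^-1 *: comp_poly_sum b k ^+ q.+1.
have QE : series_poly b k = 1 + Q1.
  rewrite /series_poly /exp_poly big_ord_recl raddfD /= raddf_sum /=.
  rewrite fact0 invr1 scale1r expr0 comp_polyC; congr (_ + _).
  by apply: eq_bigr => i _; rewrite comp_polyZ comp_Xn_poly.
have maj : majorizes (\sum_(q < k) `|(q.+1`!%:R)^-1| *: a ^+ q.+1) Q1.
  by apply: majorizes_sum => i; apply: majorizesZ; apply: majorizesX.
have := majorizes_horner n.+1 r0 maj.
rewrite big_ord_recl => H.
apply: (@le_trans _ _ (\sum_(i < n) `|Q1`_i.+1| * r ^+ i.+1)).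
  by apply: ler_sum => i _; rewrite QE coefD coef1 add0r.
apply: (@le_trans _ _ (\sum_(q < k) S ^+ q.+1)); last by apply: geo_sum_le; rewrite S0 /=.
apply: le_trans (le_trans _ H) _; first by rewrite lerDr mulr_ge0 ?exprn_ge0.
rewrite horner_sum; apply: ler_sum => q _.
rewrite hornerZ horner_exp ger0_norm ?invr_ge0 ?ler0n //.
apply: (@le_trans _ _ (a.[r] ^+ q.+1)); last by rewrite lerXn2r.
by rewrite ler_piMl ?exprn_ge0 // invf_le1 ?ltr0n ?ler1n fact_gt0.
Qed.

(** * Generalised binomials and the coefficients of the local polynomial *)

Definition gbin mu q : K := (\prod_(l < q) (mu - l%:R)) / q`!%:R.

Lemma gbin0 mu : gbin mu 0 = 1.
Proof. by rewrite /gbin big_ord0 fact0 divr1. Qed.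

Lemma gbinS mu q : gbin mu q.+1 = mu / q.+1%:R * gbin (mu - 1) q.
Proof.
rewrite /gbin big_ord_recl subr0 factS natrM.
have -> : \prod_(i < q) (mu - (lift ord0 i)%:R) = \prod_(i < q) (mu - 1 - i%:R).
  by apply: eq_bigr => i _; rewrite /= /bump add1n -natr1; ring.
by rewrite invfM mulrACA.
Qed.

Lemma gbin_ge1 mu j : j%:R <= mu -> 1 <= gbin mu j.
Proof.
elim: j mu => [|j IH] mu jm; first by rewrite gbin0.
have j1 : 1 <= gbin (mu - 1) j by apply: IH; rewrite -natr1 in jm; lra.
rewrite gbinS -[X in X <= _]mulr1 ler_pM // ler_pdivlMr ?ltr0n // mul1r.
by [].
Qed.

(** The ratio of consecutive values is [(j - i) / (mu - i)], at most [r] because [j <= r * mu] and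
    [r <= 1]. *)
Lemma gbin_shift mu r j i : (i <= j)%N -> j%:R <= mu -> j%:R <= r * mu -> 0 <= r <= 1 ->
  0 <= gbin (mu - i%:R) (j - i) <= r ^+ i * gbin mu j.
Proof.
elim: i => [|i IH] ij jm jr r1.
  rewrite subr0 subn0 expr0 mul1r lexx andbT.
  by apply: le_trans (gbin_ge1 jm).
have /andP[g0 gi] := IH (ltnW ij) jm jr r1.
have E : gbin (mu - i%:R) (j - i) = (mu - i%:R) / (j - i)%:R * gbin (mu - i.+1%:R) (j - i.+1).
  have -> : (j - i = (j - i.+1).+1)%N by rewrite subnSK.
  by rewrite gbinS -[in RHS](natr1 i) opprD addrA.
have ijr : i.+1%:R <= j%:R :> K by rewrite ler_nat.
have jiE : (j - i)%:R = j%:R - i%:R :> K by rewrite natrB // ltnW.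
have ji0 : 0 < j%:R - i%:R :> K by rewrite -natr1 in ijr; lra.
have mi0 : 0 < mu - i%:R by lra.
have E2 : gbin (mu - i.+1%:R) (j - i.+1) =
    (j%:R - i%:R) / (mu - i%:R) * gbin (mu - i%:R) (j - i).
  by rewrite E jiE; field; apply/andP; split; lra.
have f0 : 0 <= (j%:R - i%:R) / (mu - i%:R) by rewrite divr_ge0 // ltW.
have fr : (j%:R - i%:R) / (mu - i%:R) <= r.
  rewrite ler_pdivrMr //; have : 0 <= (i%:R : K) by rewrite ler0n.
  nra.
rewrite E2 mulr_ge0 //=; apply: le_trans (ler_wpM2l f0 gi) _.
have /andP[r0 _] := r1; have G0 : 0 <= gbin mu j by apply: le_trans (gbin_ge1 jm).
by rewrite exprS -mulrA ler_wpM2r // mulr_ge0 ?exprn_ge0.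
Qed.

Lemma gbin_abs_le mu q : `|gbin mu q| <= (`|mu| + q%:R) ^+ q.
Proof.
rewrite /gbin normrM normfV normr_nat.
apply: (@le_trans _ _ (`|\prod_(l < q) (mu - l%:R)| * 1)).
  by rewrite ler_wpM2l // invf_le1 ?ltr0n ?ler1n ?fact_gt0.
rewrite mulr1 normr_prod -[q in X in _ <= X]card_ord -prodr_const.
apply: ler_prod => l _; rewrite normr_ge0 /=.
by apply: le_trans (ler_normB _ _) _; rewrite normr_nat lerD2l ler_nat card_ord ltnW.
Qed.

Definition binom_poly mu m : {poly K} := \poly_(q < m) gbin mu q.

(* Truncation of (1 + t)^mu Q(t / (1 + t)), as (1 + t)^mu (t / (1 + t))^i =
   t^i (1 + t)^(mu - i). *)
Definition local_poly mu (Q : {poly K}) k : {poly K} :=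
  \sum_(i < k.+1) Q`_i *: ('X^i * binom_poly (mu - i%:R) (k.+1 - i)).

Lemma local_poly_coef mu (Q : {poly K}) k j : (j <= k)%N ->
  (local_poly mu Q k)`_j = \sum_(i < j.+1) Q`_i * gbin (mu - i%:R) (j - i).
Proof.
move=> jk; rewrite coef_sum (big_ord_widen k.+1 (fun i => Q`_i * gbin (mu - i%:R) (j - i))) //.
rewrite [RHS]big_mkcond; apply: eq_bigr => i _; rewrite coefZ coefXnM ltnS.
case: leqP => ij; last by rewrite mulr0.
by rewrite coef_poly ltn_sub2r // ltnS.
Qed.

Lemma local_poly_size mu (Q : {poly K}) k : (size (local_poly mu Q k) <= k.+1)%N.
Proof.
apply: leq_trans (size_sum _ _ _) _; apply/bigmax_leqP => i _.
apply: leq_trans (size_scale_leq _ _) _.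
rewrite mulrC; apply: leq_trans (size_polyMleq _ _) _; rewrite size_polyXn addnS /=.
apply: leq_trans (leq_add (size_poly _ _) (leqnn _)) _.
by rewrite subnK // ltnW.
Qed.

(** By [gbin_shift], the [i]-th correction is at most [|Q_i| r^i] times the main term [gbin mu j];
    all together they reach at most half of it. *)
Lemma local_poly_coef_near mu (Q : {poly K}) k j r :
    (j <= k)%N -> j%:R <= mu -> j%:R <= r * mu -> 0 <= r <= 1 -> Q`_0 = 1 ->
    \sum_(i < j) `|Q`_i.+1| * r ^+ i.+1 <= 1 / 2 ->
  gbin mu j / 2 <= (local_poly mu Q k)`_j <= 2 * gbin mu j.
Proof.
move=> jk jm jr r1 Q0 HQ; rewrite local_poly_coef // big_ord_recl Q0 mul1r subr0 subn0.
set T := \sum_(i < j) _.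
have g1 := gbin_ge1 jm.
suff : `|T| <= 1 / 2 * gbin mu j by rewrite ler_norml => /andP[]; lra.
apply: le_trans (ler_norm_sum _ _ _) _; apply: le_trans (ler_wpM2r _ HQ); last by lra.
rewrite mulr_suml; apply: ler_sum => i _; rewrite normrM -mulrA ler_wpM2l //=.
have /andP[h0 h1] := gbin_shift (ltn_ord i) jm jr r1.
by rewrite /bump add1n ger0_norm.
Qed.

End Poly.

End FormalExpansion.

(** * Taylor remainders with explicit constants *)

Module Taylor.
Import all_boot all_order all_algebra.
Import all_classical all_reals Rstruct.
Import MeanValue FormalExpansion.
Set Implicit Arguments. Unset Strict Implicit. Unset Printing Implicit Defensive.
Import Order.TTheory GRing.Theory Num.Theory.
Local Open Scope ring_scope.
Local Open Scope R_scope.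

Lemma is_derive_horner (p : {poly R}) (x : R) :
  is_derive (fun y : R => p.[y]%R) x (p^`().[x])%R.
Proof.
elim/poly_ind: p => [|p c IH].
  rewrite deriv0 horner0; apply: (is_derive_ext (fun _ => 0)) => [y|].
    by rewrite horner0.
  exact: is_derive_const.
rewrite derivMXaddC hornerD hornerMX.
apply: (is_derive_ext (fun y => p.[y]%R * y + c)) => [y|].
  by rewrite hornerMXaddC.
have H1 := is_derive_mult (fun y : R => p.[y]%R) (fun y => y) x _ _ IH (is_derive_id x) Rmult_comm.
have H2 := is_derive_plus _ _ x _ _ H1 (@is_derive_const _ _ c x).
suff -> : (p.[x] + (p^`()).[x] * x)%R =
  plus (plus (mult (p^`().[x])%R x) (mult p.[x]%R Hierarchy.one)) Hierarchy.zero by [].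
by rewrite /plus /mult /Hierarchy.one /Hierarchy.zero /= -!RplusE -RmultE; ring.
Qed.

(** The mean value theorem raises the order of vanishing by one; the Taylor bounds below
    differentiate a remainder and return through it. *)
Lemma mean_value_power (g g' : R -> R) (x K : R) (m : nat) :
    0 <= K -> g 0 = 0 ->
    (forall y, Rmin 0 x <= y <= Rmax 0 x ->
       is_derive g y (g' y) /\ Rabs (g' y) <= K * Rabs y ^ m) ->
  Rabs (g x) <= K * Rabs x ^ m.+1.
Proof.
move=> K0 g0 Hg.
have [c [Hc E]] : exists c, Rmin 0 x <= c <= Rmax 0 x /\ g x - g 0 = g' c * (x - 0).
  apply: (MVT_gen g 0 x g') => y Hy; first by apply: (Hg y _).1; lra.
  apply/continuity_pt_filterlim; apply: (@ex_derive_continuous _ _ g y).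
  by exists (g' y); apply: (Hg y _).1.
have -> : g x = g' c * x by rewrite g0 in E; lra.
rewrite Rabs_mult /= [Rabs x * _]Rmult_comm -Rmult_assoc.
apply: Rmult_le_compat_r; first exact: Rabs_pos.
apply: Rle_trans (Hg c Hc).2 _; apply: Rmult_le_compat_l => //.
apply: pow_incr; split; first exact: Rabs_pos.
move: Hc; rewrite /Rmin /Rmax; case: Rle_dec => x0 Hc.
  by rewrite !Rabs_right; lra.
by rewrite !Rabs_left1; lra.
Qed.

Lemma binom_poly_deriv (mu : R) m :
  (binom_poly mu m.+1)^`()%R = (mu *: binom_poly (mu - 1) m)%R.
Proof.
apply/polyP => i; rewrite coef_deriv coefZ !coef_poly ltnS.
case: ltnP => im; last by rewrite mul0rn mulr0.
by rewrite gbinS -[LHS]mulr_natr mulrAC divfK ?pnatr_eq0.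
Qed.

Lemma Rpower_mono (x X mu A : R) : 0 <= x <= X -> mu <= A -> 0 <= A ->
  Rpower (1 + x) mu <= Rpower (1 + X) A.
Proof.
move=> Hx mA A0; apply: Rle_trans (_ : Rpower (1 + x) A <= _).
  by apply: Rle_Rpower; lra.
by apply: Rle_Rpower_l; lra.
Qed.

(** Differentiation lowers both [mu] and the order by one. The common upper bound [A] for all these
    exponents keeps one factor [Rpower (1 + X) A] through the induction. *)
Lemma taylor_power (A X : R) (m : nat) (mu x : R) :
    0 <= A -> mu <= A -> 0 <= x <= X ->
  Rabs (Rpower (1 + x) mu - (binom_poly mu m).[x]%R) <=
    (Rabs mu + INR m) ^ m * Rpower (1 + X) A * x ^ m.
Proof.
move=> A0; elim: m mu x => [|m IH] mu x mA Hx.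
  rewrite /binom_poly poly_def big_ord0 horner0 Rminus_0_r /= !Rmult_1_r Rmult_1_l.
  rewrite Rabs_right; first exact: Rpower_mono.
  by apply: Rle_ge; left; apply: exp_pos.
rewrite -{3}(Rabs_right x); last lra.
pose g (y : R) := Rpower (1 + y) mu - (binom_poly mu m.+1).[y]%R.
pose g' (y : R) := mu * Rpower (1 + y) (mu - 1) - ((binom_poly mu m.+1)^`().[y])%R.
have W0 : 0 < Rpower (1 + X) A by apply: exp_pos.
apply: (@mean_value_power g g') => //.
- by apply: Rmult_le_pos; [apply: pow_le; have := Rabs_pos mu; have := pos_INR m.+1; lra | lra].
- rewrite /g Rplus_0_r /Rpower ln_1 Rmult_0_r exp_0 horner_coef0 coef_poly /= gbin0.
  by rewrite Rminus_diag.
rewrite Rmin_left ?Rmax_right; [|lra|lra] => y Hy; split.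
  apply: is_derive_minus; last exact: is_derive_horner.
  have H : is_derive (fun y : R => exp (mu * ln (1 + y))) y (mu * Rpower (1 + y) (mu - 1)).
    auto_derive; first lra.
    rewrite /Rpower (_ : (mu - 1) * ln (1 + y) = mu * ln (1 + y) + - ln (1 + y)); last by ring.
    rewrite exp_plus exp_Ropp exp_ln; last lra.
    by field; lra.
  exact: H.
rewrite /g' binom_poly_deriv hornerZ -RmultE -Rmult_minus_distr_l Rabs_mult.
have := IH (mu - 1) y; rewrite -RminusE => /(_ _ _) H.
have {}H := H ltac:(lra) ltac:(lra).
apply: Rle_trans (Rmult_le_compat_l _ _ _ (Rabs_pos mu) H) _.
rewrite (Rabs_right y); last lra.
rewrite -!Rmult_assoc; apply: Rmult_le_compat_r; first by apply: pow_le; lra.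
apply: Rmult_le_compat_r; first lra.
have ab : Rabs (mu - 1) + INR m <= Rabs mu + INR m.+1.
  have := Rabs_triang mu (Ropp 1); rewrite Rabs_Ropp Rabs_R1 S_INR -/(mu - 1); lra.
have p1 : 0 <= Rabs (mu - 1) + INR m by have := Rabs_pos (mu - 1); have := pos_INR m; lra.
rewrite [in X in _ <= X]/pow -/pow; apply: Rmult_le_compat; first exact: Rabs_pos.
- exact: pow_le.
- by have := pos_INR m.+1; lra.
by apply: pow_incr.
Qed.

Lemma exp_poly_deriv k : ((exp_poly R k.+1)^`() = exp_poly R k)%R.
Proof.
rewrite /exp_poly raddf_sum big_ord_recl /= derivZ derivXn mulr0n scaler0 add0r.
apply: eq_bigr => i _; rewrite derivZ derivXn /= /bump add1n factS natrM invfM.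
rewrite -scaler_nat scalerA; congr (_ *: _)%R.
by rewrite mulrAC mulVf ?mul1r // pnatr_eq0.
Qed.

Lemma taylor_exp k (x : R) :
  Rabs (exp x - (exp_poly R k).[x]%R) <= exp (Rabs x) * Rabs x ^ k.+1.
Proof.
have E0 y : is_derive (fun y => exp y) y (exp y) by auto_derive => //; ring.
have mono y z : Rmin 0 z <= y <= Rmax 0 z -> Rabs y <= Rabs z.
  rewrite /Rmin /Rmax; case: Rle_dec => x0 Hc; first by rewrite !Rabs_right; lra.
  by rewrite !Rabs_left1; lra.
elim: k x => [|k IH] x.
  apply: (@mean_value_power (fun y => exp y - (exp_poly R 0).[y]%R) exp).
  - by left; apply: exp_pos.
  - by rewrite exp_poly_horner big_ord1 expr0 fact0 divr1 exp_0 Rminus_diag.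
  move=> y Hy; split.
    apply: (is_derive_ext (fun y => exp y - 1)) => [z|].
      by rewrite exp_poly_horner big_ord1 expr0 fact0 divr1.
    by auto_derive => //; ring.
  rewrite Rmult_1_r Rabs_right; last by apply: Rle_ge; left; apply: exp_pos.
  by apply: exp_le; apply: Rle_trans (Rle_abs y) (mono _ _ Hy).
apply: (@mean_value_power (fun y => exp y - (exp_poly R k.+1).[y]%R)
   (fun y => exp y - (exp_poly R k).[y]%R)).
- by left; apply: exp_pos.
- rewrite exp_poly_horner big_ord_recl expr0 fact0 divr1 exp_0 big1 ?addr0 ?Rminus_diag // => i _.
  by rewrite expr0n mul0r.
move=> y Hy; split.
  have H := is_derive_horner (exp_poly R k.+1) y; rewrite exp_poly_deriv in H.
  exact: is_derive_minus (E0 y) H.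
apply: Rle_trans (IH y) _; apply: Rmult_le_compat_r; first by apply: pow_le; apply: Rabs_pos.
by apply: exp_le; apply: mono.
Qed.

(** In the variable [u] the remainder has derivative exactly [u^k / (1 - u)], at most [2 u^k]; and
    [u <= t]. *)
Lemma taylor_log k (t : R) : 0 <= t <= 1 ->
  Rabs (ln (1 + t) - (log_poly R k).[t / (1 + t)]%R) <= 2 * t ^ k.+1.
Proof.
move=> Ht; set u := t / (1 + t).
have uE : u = 1 - / (1 + t) by rewrite /u; field; lra.
have i1 : / (1 + t) <= 1 by rewrite -{2}Rinv_1; apply: Rinv_le_contravar; lra.
have i2 : / 2 <= / (1 + t) by apply: Rinv_le_contravar; lra.
have u0 : 0 <= u <= 1 / 2 by lra.
have ut : u <= t.
  by apply: (Rle_trans _ (t * 1)); [apply: Rmult_le_compat_l; lra | lra].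
have -> : ln (1 + t) = - ln (1 - u).
  by rewrite uE (_ : 1 - (1 - / (1 + t)) = / (1 + t)) ?ln_Rinv; [ring|lra|ring].
apply: Rle_trans (_ : 2 * Rabs u ^ k.+1 <= _); last first.
  rewrite Rabs_right; last lra.
  by apply: Rmult_le_compat_l; [lra | apply: pow_incr; lra].
apply: (@mean_value_power (fun u => - ln (1 - u) - (log_poly R k).[u]%R)
   (fun u => / (1 - u) - ((log_poly R k)^`().[u])%R)); first lra.
- rewrite Rminus_0_r ln_1 log_poly_horner big1 ?Ropp_0 ?Rminus_diag // => i _.
  by rewrite expr0n mul0r.
rewrite Rmin_left ?Rmax_right; [|lra|lra] => y Hy; split.
  apply: is_derive_minus; last exact: is_derive_horner.
  by auto_derive; [lra | field; lra].
have -> : ((log_poly R k)^`().[y])%R = (1 - y ^ k) / (1 - y).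
  rewrite /log_poly raddf_sum horner_sum /=.
  rewrite (eq_bigr (fun i : 'I_k => y ^+ i)%R) => [|i _]; last first.
    by rewrite derivZ derivXn hornerZ hornerMn hornerXn -[(y ^+ i *+ _)%R]mulr_natl mulrA mulVf ?mul1r ?pnatr_eq0.
  apply: (Rmult_eq_reg_r (1 - y)); last lra.
  rewrite /Rdiv Rmult_assoc Rinv_l ?Rmult_1_r; last lra.
  have E : y ^ k - 1 = (y - 1) * (\sum_(i < k) y ^+ i)%R by rewrite RpowE; exact: subrX1.
  by move: E; move: (\sum_(i < k) y ^+ i)%R (y ^ k) => S w E; nra.
have -> : / (1 - y) - (1 - y ^ k) / (1 - y) = y ^ k * / (1 - y) by field; lra.
have i3 : / (1 - y) <= 2.
  by rewrite -[2]Rinv_inv; apply: Rinv_le_contravar; lra.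
have i4 : 0 < / (1 - y) by apply: Rinv_0_lt_compat; lra.
have p0 : 0 <= y ^ k by apply: pow_le; lra.
rewrite !Rabs_right; try lra; last first.
  by apply: Rle_ge; apply: Rmult_le_pos => //; lra.
by rewrite [2 * _]Rmult_comm; apply: Rmult_le_compat_l.
Qed.

End Taylor.

(** * Local expansion of h and the size of its coefficients *)

Module LocalExpansion.
Import all_boot all_order all_algebra.
Import all_classical all_reals Rstruct.
Import zify ring lra MeanValue FormalExpansion Taylor.
Set Implicit Arguments. Unset Strict Implicit. Unset Printing Implicit Defensive.
Import Order.TTheory GRing.Theory Num.Theory.
Local Open Scope ring_scope.

Lemma Rpower_ge0 (x a : R) : 0 <= Rpower x a.
Proof. by apply/RleP; left; apply: exp_pos. Qed.

Lemma Rpower_sub_nat (x a : R) (i : nat) : 0 < x ->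
  Rpower x (a - i%:R)%R = Rpower x a / x ^+ i.
Proof.
move=> /RltP x0; have -> : (a - i%:R)%R = Rplus a (Ropp (INR i)) by rewrite INRE.
by rewrite Rpower_plus Rpower_Ropp Rpower_pow // RpowE.
Qed.

Lemma Rpower_le_two (t lam : R) : 0 <= t <= 1 -> 0 <= lam ->
  Rpower (1 + t)%R lam <= Rpower 2 lam.
Proof.
move=> /andP[t0 t1] /RleP l0; apply/RleP; apply: Rle_Rpower_l => //.
have H x : Rle (IZR 0) x -> Rle x (IZR 1) ->
  Rlt (IZR 0) (Rplus (IZR 1) x) /\ Rle (Rplus (IZR 1) x) (IZR 2) by move=> *; Lra.lra.
by apply: H; apply/RleP.
Qed.

Lemma taylor_power_le (lam t : R) (k i : nat) :
    0 <= lam -> 0 <= t <= 1 -> (i <= k)%N ->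
  `|Rpower (1 + t)%R (lam - i%:R)%R - (binom_poly (lam - i%:R) (k.+1 - i)).[t]| <=
    (lam + (2 * k.+1)%:R) ^+ k.+1 * Rpower 2 lam * t ^+ (k.+1 - i).
Proof.
move=> l0 /andP[t0 t1] ik; have i0 : 0 <= i%:R :> R by rewrite ler0n.
have H : Rle (Rabs (Rpower (1 + t)%R (lam - i%:R)%R - (binom_poly (lam - i%:R)%R (k.+1 - i)).[t]%R))
   (Rmult (Rmult ((Rabs (lam - i%:R)%R + INR (k.+1 - i)) ^ (k.+1 - i)) (Rpower (1 + 1) lam))
      (t ^ (k.+1 - i))).
  apply: taylor_power; [exact/RleP | by apply/RleP; lra | by split; apply/RleP].
move: H; rewrite !RpowE !INRE RabsE => /RleP H; apply: le_trans H _.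
apply: ler_wpM2r; first exact: exprn_ge0.
apply: ler_wpM2r; first exact: Rpower_ge0.
rewrite RabsE RplusE; set z := `|_| + _.
have z1 : z <= lam + (2 * k.+1)%:R.
  have := ler_normB lam i%:R; rewrite (ger0_norm l0) (ger0_norm i0) => H.
  have : (k.+1 - i)%:R <= k.+1%:R :> R by rewrite ler_nat leq_subr.
  have : i%:R <= k.+1%:R :> R by rewrite ler_nat leqW.
  rewrite natrM /z; move: H; lra.
have z0 : 0 <= z by rewrite addr_ge0.
have z2 := le_trans z0 z1.
apply: (@le_trans _ _ ((lam + (2 * k.+1)%:R) ^+ (k.+1 - i))); first by rewrite lerXn2r.
rewrite ler_weXn2l ?leq_subr //.
have : 1 <= (2 * k.+1)%:R :> R by rewrite ler1n.
lra.
Qed.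

(** Two errors of order [t^(k + 1)]: the part of [Q] beyond degree [k], controlled by the norm at
    radius [1 / 2 >= u], and the Taylor remainders of [(1 + t)^(lam - i)] for [i <= k]. *)
Lemma local_poly_approx (lam t : R) (Q : {poly R}) (k : nat) :
    0 <= lam -> 0 <= t <= 1 -> Q`_0 = 1 ->
    (forall n, \sum_(i < n) `|Q`_i.+1| * (1 / 2) ^+ i.+1 <= 1) ->
  `|Rpower (1 + t)%R lam * Q.[t / (1 + t)] - (local_poly lam Q k).[t]| <=
    Rpower 2 lam * (2 ^+ k.+1 +
       k.+1%:R * 2 ^+ k.+1 * (lam + (2 * k.+1)%:R) ^+ k.+1) * t ^+ k.+1.
Proof.
move=> l0 t01 Q0 HQ; have /andP[t0 t1] := t01.
set u := t / (1 + t); set W := Rpower 2 lam.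
pose Z := (lam + (2 * k.+1)%:R) ^+ k.+1; rewrite -/Z.
have p1 : 0 < 1 + t by lra.
have u0 : 0 <= u by rewrite divr_ge0 // ltW.
have ut : u <= t by rewrite ler_pdivrMr // mulrDr mulr1 lerDl mulr_ge0.
have W0 : 0 <= W := Rpower_ge0 _ _.
have WE : Rpower (1 + t)%R lam <= W by apply: Rpower_le_two.
have Z0 : 0 <= Z by rewrite exprn_ge0 // addr_ge0 ?ler0n.
have h0 i : 0 <= `|Q`_i| * (1 / 2) ^+ i by rewrite mulr_ge0 ?exprn_ge0 //; lra.
have Qi i : `|Q`_i| <= 2 ^+ i.
  case: i => [|i]; first by rewrite Q0 normr1 expr0.
  have := HQ i.+1; rewrite big_ord_recr /= => H.
  have {}H : `|Q`_i.+1| * (1 / 2) ^+ i.+1 <= 1.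
    by apply: le_trans H; rewrite lerDr sumr_ge0.
  by move: H; rewrite div1r exprVn ler_pdivrMr ?mul1r // exprn_gt0.
have tail n : `|\sum_(i < n) Q`_(k.+1 + i) * u ^+ (k.+1 + i)| <= 2 ^+ k.+1 * t ^+ k.+1.
  apply: le_trans (ler_norm_sum _ _ _) _; rewrite -exprMn.
  have t2 : 0 <= (2 * t) ^+ k.+1 by rewrite exprn_ge0 // mulr_ge0.
  apply: (@le_trans _ _ (\sum_(i < n) (2 * t) ^+ k.+1 * (`|Q`_(k + i).+1| * (1 / 2) ^+ (k + i).+1))).
    apply: ler_sum => i _; rewrite addSn normrM mulrCA ler_wpM2l // ger0_norm ?exprn_ge0 //.
    have u2 : u <= 1 / 2 by rewrite ler_pdivrMr //; lra.
    have -> : (k + i).+1 = (k.+1 + i)%N by rewrite addSn.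
    have -> : (2 * t) ^+ k.+1 * (1 / 2) ^+ (k.+1 + i) = t ^+ k.+1 * (1 / 2) ^+ i.
      by rewrite exprD mulrA -exprMn; congr (_ ^+ _ * _); lra.
    rewrite exprD.
    by apply: ler_pM; rewrite ?exprn_ge0 // lerXn2r // nnegrE; lra.
  rewrite -mulr_sumr ler_piMr //; apply: le_trans (HQ (k + n)%N).
  by rewrite big_split_ord /= lerDr sumr_ge0.
rewrite (@horner_coef_wide _ (k.+1 + size Q)) ?leq_addl // big_split_ord /=.
rewrite mulrDr horner_sum mulr_sumr addrAC -sumrB.
apply: le_trans (ler_normD _ _) _.
rewrite addrC mulrDr mulrDl; apply: lerD.
  rewrite normrM (ger0_norm (Rpower_ge0 _ _)) -[X in _ <= X]mulrA.
  by apply: ler_pM (tail _) => //; apply: Rpower_ge0.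
apply: le_trans (ler_norm_sum _ _ _) _.
have bnd (i : 'I_k.+1) : `|Rpower (1 + t)%R lam * (Q`_i * u ^+ i) -
     (Q`_i *: ('X^i * binom_poly (lam - i%:R) (k.+1 - i))).[t]| <=
     2 ^+ k.+1 * Z * W * t ^+ k.+1.
  have ik : (i <= k)%N by rewrite -ltnS.
  have -> : Rpower (1 + t)%R lam * (Q`_i * u ^+ i) -
     (Q`_i *: ('X^i * binom_poly (lam - i%:R) (k.+1 - i))).[t] =
     Q`_i * (t ^+ i * (Rpower (1 + t)%R (lam - i%:R)%R - (binom_poly (lam - i%:R) (k.+1 - i)).[t])).
    rewrite hornerZ hornerM hornerXn Rpower_sub_nat // /u exprMn exprVn; ring.
  rewrite normrM normrM [`|t ^+ i|]ger0_norm ?exprn_ge0 //.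
  have -> : t ^+ k.+1 = t ^+ i * t ^+ (k.+1 - i) by rewrite -exprD subnKC // leqW.
  have -> : 2 ^+ k.+1 * Z * W * (t ^+ i * t ^+ (k.+1 - i)) =
    2 ^+ k.+1 * (t ^+ i * (Z * W * t ^+ (k.+1 - i))) by ring.
  apply: ler_pM => //; first by rewrite mulr_ge0 ?exprn_ge0.
    apply: le_trans (Qi i) _; rewrite ler_weXn2l ?leqW //; lra.
  by rewrite ler_wpM2l ?exprn_ge0 // taylor_power_le.
apply: le_trans (ler_sum _ (fun i _ => bnd i)) _.
rewrite sumr_const card_ord -mulr_natl.
rewrite le_eqVlt; apply/orP; left; apply/eqP; ring.
Qed.

Lemma gbinSr (K : realFieldType) (mu : K) q :
  gbin mu q.+1 = gbin mu q * ((mu - q%:R) / q.+1%:R).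
Proof.
by rewrite /gbin big_ord_recr factS mulnC natrM invfM mulrACA.
Qed.

(** [c (c - 1) / 2 <= 1], and every further factor [(c - q) / (q + 1)] has modulus at most 1. *)
Lemma gbin_le1 (K : realFieldType) (c : K) p : 1 <= c <= 2 -> `|gbin c p.+2| <= 1.
Proof.
move=> /andP[c1 c2]; elim: p => [|p IH].
  rewrite !gbinSr gbin0 subr0 mul1r ger0_norm; nra.
rewrite gbinSr normrM mulr_ile1 // normrM normfV normr_nat ler_pdivrMr ?ltr0n // mul1r.
rewrite ler_norml -!natr1; have := ler0n K p; lra.
Qed.

Lemma exp_dist_le (a b : R) :
  `|exp a - exp b| <= exp `|b| * exp `|a - b| * `|a - b|.
Proof.
have -> : exp a - exp b = exp b * (exp (a - b)%R - 1).
  rewrite mulrBr mulr1; congr (_ - _).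
  by rewrite expRD RplusE; congr exp; ring.
rewrite normrM -mulrA; apply: ler_pM => //.
  rewrite ger0_norm; last by apply/RleP; left; apply: exp_pos.
  by apply/RleP; apply: exp_le; apply/RleP; rewrite ler_norm.
have := @taylor_exp 0 (a - b)%R; rewrite exp_poly_horner big_ord1 expr0 fact0 divr1.
by rewrite pow_1 !RabsE => /RleP.
Qed.

Lemma sum_split2 (V : nmodType) (f : nat -> V) k : (0 < k)%N ->
  \sum_(i < k.+1) f i = f 0%N + (f 1%N + \sum_(i < k.-1) f i.+2).
Proof. by case: k => // k _; rewrite !big_ord_recl. Qed.

Section LocalExpansion.
Variables (c L t : R) (k : nat).
Hypotheses (c12 : 1 <= c <= 2) (L1 : 1 <= L) (k0 : (0 < k)%N).
Hypotheses (t0 : 0 <= t) (tk : (k + 3)%:R * t <= 1 / 16).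

Let Lc := Rpower L c.
(** The Taylor coefficient of order [p] of [(L + l)^c] at [l = 0]. *)
Definition phase_coef (p : nat) := gbin c p * (Lc / L ^+ p).
Let b := phase_coef.
Let lam := c * (Lc / L).
Let l := ln (1 + t)%R.
Let y := Rpower (L + l)%R c - Lc - lam * l.
Let u := t / (1 + t).
Let v := (log_poly R k).[u].
Let Y := (comp_poly_sum b k).[u].
Let a := (k + 3)%:R * t.

Let L0 : 0 < L := lt_le_trans ltr01 L1.

Let k3 : 4 <= (k + 3)%:R :> R.
Proof. by rewrite (ler_nat R 4) addn3. Qed.

Let ta : t <= a / 4.
Proof. by rewrite ler_pdivlMr // mulrC ler_wpM2r. Qed.

Let t1 : t <= 1 / 64.
Proof. by move: ta tk; rewrite -/a; lra. Qed.

Let a0 : 0 <= a.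
Proof. by rewrite mulr_ge0. Qed.

Let Lc_le p : Lc / L ^+ p.+2 <= 1.
Proof.
have Lp : 0 < L ^+ p.+2 by rewrite exprn_gt0.
rewrite ler_pdivrMr // mul1r; apply: le_trans (_ : L ^+ 2 <= _); last first.
  by rewrite ler_weXn2l.
apply/RleP; rewrite -RpowE -Rpower_pow; last exact/RltP.
apply: Rle_Rpower; first exact/RleP.
by apply/RleP; case/andP: c12.
Qed.

Let Lc0 : 0 <= Lc := Rpower_ge0 _ _.

Let b_le1 p : `|b p.+2| <= 1.
Proof.
rewrite /b /phase_coef normrM mulr_ile1 ?gbin_le1 //.
have Lp : 0 <= L ^+ p.+2 by rewrite exprn_ge0 // ltW.
by rewrite ger0_norm ?Lc_le ?divr_ge0.
Qed.

Let t0R : Rle (IZR 0) t.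
Proof. exact/RleP. Qed.

Let l0 : 0 <= l.
Proof.
apply/RleP; apply: (Rle_trans _ (ln (IZR 1))); first by rewrite ln_1; apply: Rle_refl.
have H x : Rle (IZR 0) x -> Rle (ln (IZR 1)) (ln (Rplus (IZR 1) x)).
  by move=> x0; apply: ln_mono; Lra.lra.
exact: H.
Qed.

Let lt : l <= t.
Proof.
apply/RleP; have H x : Rle (IZR 0) x -> Rle (ln (Rplus (IZR 1) x)) x.
  move=> x0; rewrite -[X in Rle _ X]ln_exp; apply: ln_mono; first by Lra.lra.
  exact: exp_ineq1_le.
exact: H.
Qed.

(** Taylor in [l / L]: the remainder carries [L^c / L^(k + 1) <= 1], and [(c + k + 1) * l <= a]
    since [c <= 2] and [l <= t]. *)
Let y_poly : `|y - \sum_(i < k.-1) b i.+2 * l ^+ i.+2| <= 4 * a ^+ k.+1.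
Proof.
have lL0 : 0 <= l / L by rewrite divr_ge0 // ltW.
have c0 : 0 <= c by case/andP: c12 => c1 _; apply: le_trans ler01 c1.
have lL1 : l / L <= 1 by rewrite ler_pdivrMr // mul1r; move: lt t1 L1; lra.
have H : Rle (Rabs (Rpower (1 + l / L)%R c - (binom_poly c k.+1).[l / L]%R))
   (Rmult (Rmult ((Rabs c + INR k.+1) ^ k.+1) (Rpower (1 + 1) c)) ((l / L)%R ^ k.+1)).
  apply: taylor_power; [exact/RleP | exact: Rle_refl |].
  by split; apply/RleP.
move: H; rewrite !RpowE INRE !RabsE !RplusE !RmultE => /RleP.
rewrite (_ : (1 + 1)%R = 2 :> R) // => H.
have -> : y - \sum_(i < k.-1) b i.+2 * l ^+ i.+2 =
    Lc * (Rpower (1 + l / L)%R c - (binom_poly c k.+1).[l / L]).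
  have E1 : Rpower (L + l)%R c = Lc * Rpower (1 + l / L)%R c.
    rewrite -RmultE Rpower_mult_distr; [|exact/RltP|by apply/RltP; rewrite ltr_wpDr].
    by rewrite RmultE mulrDr mulr1 mulrCA divff ?mulr1 // gt_eqF.
  rewrite mulrBr -E1 horner_poly mulr_sumr.
  rewrite (sum_split2 (fun i => Lc * (gbin c i * (l / L) ^+ i)) k0).
  rewrite gbin0 gbinS gbin0 expr0 expr1 !mulr1 divr1 /y /lam.
  have -> : \sum_(i < k.-1) Lc * (gbin c i.+2 * (l / L) ^+ i.+2) =
    \sum_(i < k.-1) b i.+2 * l ^+ i.+2.
    apply: eq_bigr => i _; rewrite /b /phase_coef expr_div_n.
    by move: (l ^+ _) ((L ^+ _)^-1) (gbin c _) => z1 z2 z3; ring.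
  by ring.
rewrite normrM (ger0_norm Lc0); apply: le_trans (ler_wpM2l Lc0 H) _.
have -> : Lc * ((`|c| + k.+1%:R) ^+ k.+1 * Rpower 2 c * (l / L) ^+ k.+1) =
   (Lc / L ^+ k.+1) * (Rpower 2 c * ((`|c| + k.+1%:R) * l) ^+ k.+1).
  rewrite expr_div_n exprMn.
  by move: (l ^+ _) ((L ^+ _)^-1) (_ ^+ k.+1) => z1 z2 z3; ring.
have R2 : Rpower 2 c <= 4.
  apply/RleP; apply: (Rle_trans _ (Rpower 2 (INR 2))).
    apply: Rle_Rpower; first by Lra.lra.
    by apply/RleP; rewrite INRE; case/andP: c12.
  rewrite Rpower_pow; last by Lra.lra.
  by apply/RleP; rewrite RpowE (_ : IZR 2 = 2 :> R) //; lra.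
have A0 : 0 <= ((`|c| + k.+1%:R) * l) ^+ k.+1 by rewrite exprn_ge0 // mulr_ge0 // addr_ge0.
have A1 : ((`|c| + k.+1%:R) * l) ^+ k.+1 <= a ^+ k.+1.
  rewrite lerXn2r ?nnegrE ?mulr_ge0 ?addr_ge0 // /a; apply: ler_pM => //; first exact: addr_ge0.
  rewrite ger0_norm // -addn1 !natrD; case/andP: c12; lra.
have R0 := Rpower_ge0 2 c.
have F1 : Lc / L ^+ k.+1 <= 1 by rewrite -(prednK k0) Lc_le.
have F0 : 0 <= Lc / L ^+ k.+1 by rewrite divr_ge0 // exprn_ge0 // ltW.
apply: (@le_trans _ _ (1 * (4 * a ^+ k.+1))); last by rewrite mul1r.
by apply: ler_pM => //; [rewrite mulr_ge0 | apply: ler_pM].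
Qed.

Let v_l : `|l - v| <= 2 * t ^+ k.+1.
Proof.
have t2 : t <= 1 by move: t1; lra.
have H : Rle (Rabs (l - v)%R) (Rmult 2 (t ^ k.+1)).
  by apply: taylor_log; split; exact/RleP.
by move: H; rewrite RpowE RabsE RmultE => /RleP.
Qed.

Let v0 : 0 <= v.
Proof.
rewrite /v log_poly_horner sumr_ge0 // => i _.
have p1 : 0 <= 1 + t by rewrite addr_ge0.
by rewrite divr_ge0 ?ler0n // exprn_ge0 // divr_ge0.
Qed.

Let v_le : v <= 2 * t.
Proof.
have : t ^+ k.+1 <= t * t.
  by rewrite -expr2 ler_wiXn2l //; move: t1; lra.
have tt : t * t <= t * (1 / 64) by rewrite ler_wpM2l.
move: v_l; rewrite ler_norml => /andP[]; move: lt t0 tt; move: (t * t) (t ^+ _) => p q; lra.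
Qed.

(** Both [l] and [v] are in [[0, 1]], so replacing one by the other in a power of exponent at most
    [k + 1] costs at most [(k + 1) * |l - v|]. *)
Let y_Y : `|y - Y| <= 6 * a ^+ k.+1.
Proof.
have -> : y - Y = (y - \sum_(i < k.-1) b i.+2 * l ^+ i.+2) +
   \sum_(i < k.-1) b i.+2 * (l ^+ i.+2 - v ^+ i.+2).
  rewrite /Y comp_poly_sum_horner -/v.
  under [X in _ = _ + X]eq_bigr do rewrite mulrBr.
  by rewrite sumrB addrA subrK.
apply: le_trans (ler_normD _ _) _.
suff H : `|\sum_(i < k.-1) b i.+2 * (l ^+ i.+2 - v ^+ i.+2)| <= 2 * a ^+ k.+1.
  by apply: le_trans (lerD y_poly H) _; lra.
have step (i : 'I_k.-1) : `|b i.+2 * (l ^+ i.+2 - v ^+ i.+2)| <= k.+1%:R * (2 * t ^+ k.+1).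
  rewrite normrM; apply: le_trans (ler_piMl _ (b_le1 i)) _ => //.
  rewrite subrXX normrM mulrC; apply: ler_pM => //.
  apply: le_trans (ler_norm_sum _ _ _) _.
  apply: (@le_trans _ _ (\sum_(j < i.+2) 1)).
    apply: ler_sum => j _; rewrite normrM !normrX mulr_ile1 ?exprn_ge0 // exprn_ile1 // ger0_norm //.
      by move: lt t1; lra.
    by move: v_le t1; lra.
  by rewrite sumr_const card_ord ler_nat leqW // -ltn_predRL.
apply: le_trans (ler_norm_sum _ _ _) _; apply: le_trans (ler_sum _ (fun i _ => step i)) _.
rewrite sumr_const card_ord -mulr_natl.
have : k.-1%:R * k.+1%:R * t ^+ k.+1 <= a ^+ k.+1.
  rewrite /a exprMn ler_wpM2r ?exprn_ge0 //.
  apply: (@le_trans _ _ ((k + 3)%:R ^+ 2)).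
    rewrite -natrM -natrX ler_nat -mulnn leq_mul //.
      by apply: leq_trans (leq_pred k) (leq_addr 3 k).
    by rewrite -addn1 leq_add2l.
  by rewrite ler_weXn2l // (le_trans _ k3) //; lra.
by move: (t ^+ k.+1) (a ^+ k.+1) => x z; rewrite -mulrA; nra.
Qed.

Let Y_le : `|Y| <= t.
Proof.
rewrite /Y comp_poly_sum_horner -/v; apply: le_trans (ler_norm_sum _ _ _) _.
apply: (@le_trans _ _ (\sum_(i < k.-1) (2 * t) * (2 * t) ^+ i.+1)).
  apply: ler_sum => i _; rewrite normrM -exprS.
  apply: le_trans (ler_piMl _ (b_le1 i)) _ => //.
  by rewrite ger0_norm ?exprn_ge0 // lerXn2r // nnegrE mulr_ge0.
rewrite -mulr_sumr.
have H : \sum_(q < k.-1) (2 * t) ^+ q.+1 <= 2 * (2 * t).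
  by apply: geo_sum_le; apply/andP; split; move: t0 t1; lra.
by move: H; move: (\sum_(q < _) _) => s H; move: t0 t1; nra.
Qed.

Let ak1 : a ^+ k.+1 <= 1 / 256.
Proof.
apply: (@le_trans _ _ (a ^+ 2)); last by move: a0 tk; rewrite -/a; nra.
by rewrite ler_wiXn2l //; move: tk; rewrite -/a; lra.
Qed.

Let exp_small (x : R) : `|x| <= 1 -> exp `|x| <= 3.
Proof.
move=> x1; apply/RleP; apply: Rle_trans (exp_le (_ : Rle _ 1)) exp_le_3.
exact/RleP.
Qed.

(** [57 = 3 * 3 * 6 + 3]: the first part comes from replacing [y] by [Y], the second from truncating
    the exponential series. *)
Let exp_y : `|exp y - (series_poly b k).[u]| <= 57 * a ^+ k.+1.
Proof.
rewrite series_poly_horner -/Y.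
have -> : exp y - (exp_poly R k).[Y] = (exp y - exp Y) + (exp Y - (exp_poly R k).[Y]).
  by rewrite addrA subrK.
apply: le_trans (ler_normD _ _) _.
have H1 : `|exp y - exp Y| <= 54 * a ^+ k.+1.
  apply: le_trans (exp_dist_le _ _) _.
  have e1 : exp `|Y| <= 3 by apply: exp_small; move: Y_le t1; lra.
  have e2 : exp `|y - Y| <= 3 by apply: exp_small; move: y_Y ak1; lra.
  have e0 z : 0 <= exp z by apply/RleP; left; apply: exp_pos.
  have -> : 54 * a ^+ k.+1 = (3 * 3) * (6 * a ^+ k.+1) by ring.
  apply: ler_pM => //; first by rewrite mulr_ge0.
  exact: ler_pM.
have H2 : `|exp Y - (exp_poly R k).[Y]| <= 3 * a ^+ k.+1.
  have := @taylor_exp k Y; rewrite RpowE !RabsE => /RleP H; apply: le_trans H _.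
  have e1 : exp `|Y| <= 3 by apply: exp_small; move: Y_le t1; lra.
  have e0 z : 0 <= exp z by apply/RleP; left; apply: exp_pos.
  apply: ler_pM => //; first exact: exprn_ge0.
  rewrite lerXn2r // ?nnegrE //; move: Y_le ta a0; lra.
by apply: le_trans (lerD H1 H2) _; lra.
Qed.

(** The quotient is [(1 + t)^lam * exp y]; [exp y] is replaced by its series at [u], then
    [local_poly_approx] applies. The factor [4 = 2 * 2] absorbs [2^(k + 1)] and
    [k + 1 <= 2^(k + 1)], and [60] covers [57 + 1 + 1]. *)
Lemma local_expansion :
    (forall n, \sum_(i < n) `|(series_poly b k)`_i.+1| * (1 / 2) ^+ i.+1 <= 1) ->
  `|exp (Rpower (L + l)%R c - Rpower L c)%R - (local_poly lam (series_poly b k) k).[t]| <=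
    60 * Rpower 2 lam * (4 * (lam + (2 * k + 4)%:R) * t) ^+ k.+1.
Proof.
move=> HQ.
have lam0 : 0 <= lam.
  case/andP: c12 => c1 _; rewrite mulr_ge0 ?divr_ge0 ?(ltW L0) //.
  exact: le_trans ler01 c1.
have t01 : 0 <= t <= 1 by rewrite t0 /=; move: t1; lra.
have W0 := Rpower_ge0 2 lam.
have := local_poly_approx k lam0 t01 (series_poly0 b k) HQ.
set Q := series_poly b k; set W := Rpower 2 lam in W0 *.
have -> : exp (Rpower (L + l)%R c - Rpower L c)%R = Rpower (1 + t)%R lam * exp y.
  have -> : Rpower (1 + t)%R lam = exp (lam * l)%R by [].
  by rewrite expRD RplusE; congr exp; rewrite /y -/Lc; ring.
rewrite -/u.
set p := Rpower (1 + t)%R lam; set z := (local_poly lam Q k).[t] => H.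
have -> : p * exp y - z = p * (exp y - Q.[u]) + (p * Q.[u] - z) by ring.
apply: le_trans (ler_normD _ _) _.
have p0 : 0 <= p := Rpower_ge0 _ _.
have pW : p <= W by apply: Rpower_le_two.
have H1 : `|p * (exp y - Q.[u])| <= W * (57 * a ^+ k.+1).
  by rewrite normrM (ger0_norm p0); apply: ler_pM.
apply: le_trans (lerD H1 H) _.
pose Z := lam + (2 * k + 4)%:R.
have Z1 : 1 <= Z.
  have : 1 <= (2 * k + 4)%:R :> R by rewrite ler1n addnS.
  by rewrite /Z; lra.
rewrite -/Z.
have -> : (4 * Z * t) ^+ k.+1 = 2 ^+ k.+1 * (2 ^+ k.+1 * (Z ^+ k.+1 * t ^+ k.+1)).
  by rewrite -!exprMn; congr (_ ^+ _); ring.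
have az : a ^+ k.+1 <= Z ^+ k.+1 * t ^+ k.+1.
  rewrite -exprMn lerXn2r ?nnegrE // ?mulr_ge0 //; first lra.
  rewrite ler_wpM2r // /Z; have : (k + 3)%:R <= (2 * k + 4)%:R :> R.
    by rewrite ler_nat leq_add // leq_pmull.
  lra.
have z2 : (lam + (2 * k.+1)%:R) ^+ k.+1 <= Z ^+ k.+1.
  have H0 : (2 * k.+1)%:R <= (2 * k + 4)%:R :> R.
    by rewrite ler_nat mulnS addnC leq_add2l.
  have H2 : 0 <= (2 * k.+1)%:R :> R by rewrite ler0n.
  rewrite lerXn2r ?nnegrE /Z; lra.
have k2 : k.+1%:R <= 2 ^+ k.+1 :> R.
  by rewrite -natrX ler_nat ltnW // ltn_expl.
have Zk : 1 <= Z ^+ k.+1 by rewrite exprn_ege1.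
have tk0 : 0 <= t ^+ k.+1 by apply: exprn_ge0.
have P1 : 1 <= 2 ^+ k.+1 :> R by rewrite exprn_ege1 //; lra.
move: (2 ^+ k.+1 : R) (Z ^+ k.+1) (t ^+ k.+1) (a ^+ k.+1) k2 Zk tk0 P1 az z2 => p2 zk x ak k2 Zk tk0 P1 az z2.
rewrite [60 * W]mulrC -[W * 60 * _]mulrA -[W * (_ + _) * x]mulrA -mulrDr ler_wpM2l //.
have h1 : 57 * ak <= 57 * (p2 * (p2 * (zk * x))).
  rewrite ler_pM2l //; apply: le_trans az _.
  have zx : 0 <= zk * x by rewrite mulr_ge0 //; lra.
  have pp : 1 <= p2 * p2 by nra.
  by rewrite mulrA ler_peMl.
have h2 : p2 * x <= p2 * (p2 * (zk * x)).
  rewrite ler_pM2l; last lra.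
  rewrite mulrA ler_peMl //; nra.
have h3 : k.+1%:R * p2 * (lam + (2 * k.+1)%:R) ^+ k.+1 * x <= p2 * (p2 * (zk * x)).
  have -> : p2 * (p2 * (zk * x)) = p2 * p2 * zk * x by ring.
  rewrite ler_wpM2r //; apply: ler_pM => //.
  - by rewrite mulr_ge0 //; lra.
  - by rewrite exprn_ge0 // addr_ge0.
  - by rewrite ler_pM2r //; lra.
have h0 : 0 <= p2 * x by rewrite mulr_ge0 //; lra.
rewrite [X in _ + X]mulrDl; move: h0 h1 h2 h3.
move: (p2 * (p2 * _)) (p2 * x) (_ * p2 * _ * x) => T q1 q2; lra.
Qed.
End LocalExpansion.

Lemma geo_sum_inv (r : R) n : 0 <= r < 1 -> \sum_(i < n) r ^+ i.+1 <= (1 - r)^-1.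
Proof.
move=> /andP[r0 r1]; have r2 : 0 < 1 - r by rewrite subr_gt0.
apply: (@le_trans _ _ (\sum_(i < n) r ^+ i)).
  by apply: ler_sum => i _; rewrite exprS ler_piMl ?exprn_ge0 // ltW.
rewrite -[X in _ <= X]mul1r ler_pdivlMr //.
have E := subrX1 r n.
have -> : (\sum_(i < n) r ^+ i) * (1 - r) = 1 - r ^+ n.
  by move: E; move: (\sum_(i < n) r ^+ i) (r ^+ n) => s z E; lra.
by rewrite gerBl exprn_ge0.
Qed.

(** [log_poly] at [r] is at most [1 / (1 - r)]. By [gbin_le1] the exponent is then at most [L^c]
    times the sum of the powers of [q] from [q ^ 2] on, hence at most [2 L^c q^2]. For fixed [r] and
    [c < 2] this tends to 0 as [L] grows. *)
Lemma series_coef_small (c L r : R) (k n : nat) :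
    1 <= c <= 2 -> 1 <= L -> 0 <= r < 1 ->
    (1 - r)^-1 / L <= 1 / 2 ->
    2 * (Rpower L c * ((1 - r)^-1 / L) ^+ 2) <= 1 / 4 ->
  \sum_(i < n) `|(series_poly (phase_coef c L) k)`_i.+1| * r ^+ i.+1 <= 1 / 2.
Proof.
move=> c12 L1 r01 q2 HS; have /andP[r0 r1] := r01.
set q := (1 - r)^-1 / L in q2 HS; set S := 2 * _ in HS.
have L0 : 0 < L by lra.
have q0 : 0 <= q by rewrite divr_ge0 ?invr_ge0 ?subr_ge0 // ltW.
have Lc0 := Rpower_ge0 L c.
have HS' : \sum_(i < k.-1) `|phase_coef c L i.+2| * (log_poly R k).[r] ^+ i.+2 <= S.
  apply: (@le_trans _ _ (\sum_(i < k.-1) (Rpower L c * q) * q ^+ i.+1)); last first.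
    rewrite -mulr_sumr.
    have H : \sum_(i < k.-1) q ^+ i.+1 <= 2 * q by apply: geo_sum_le; rewrite q0.
    have Lq : 0 <= Rpower L c * q by rewrite mulr_ge0.
    apply: le_trans (ler_wpM2l Lq H) _.
    by rewrite le_eqVlt; apply/orP; left; apply/eqP; rewrite /S; ring.
  apply: ler_sum => i _; rewrite -[Rpower L c * q * _]mulrA -exprS.
  have l0 : 0 <= (log_poly R k).[r].
    by rewrite log_poly_horner sumr_ge0 // => j _; rewrite divr_ge0 ?exprn_ge0.
  have lr : (log_poly R k).[r] <= (1 - r)^-1.
    apply: le_trans (geo_sum_inv k r01); rewrite log_poly_horner; apply: ler_sum => j _.
    by rewrite ler_pdivrMr ?ltr0n // ler_peMr ?exprn_ge0 // ler1n.
  rewrite /phase_coef normrM -mulrA; apply: le_trans (ler_piMl _ (gbin_le1 i c12)) _.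
    by rewrite mulr_ge0 ?exprn_ge0.
  rewrite ger0_norm ?divr_ge0 ?exprn_ge0 ?(ltW L0) // /q expr_div_n -mulrA ler_wpM2l //.
  rewrite mulrC ler_wpM2r ?invr_ge0 ?exprn_ge0 ?(ltW L0) //.
  by rewrite lerXn2r // nnegrE (le_trans l0).
have S2 : S <= 1 / 2 by lra.
by have := series_poly_norm n r0 HS' S2; lra.
Qed.

Definition expansion_coef (c L : R) (k j : nat) : R :=
  ((local_poly (c * (Rpower L c / L)) (series_poly (phase_coef c L) k) k)`_j)%R.

Lemma expansion_approx (c L r t : R) (k : nat) (lam := c * (Rpower L c / L)) :
    1 <= c <= 2 -> 1 <= L -> 1 / 2 <= r < 1 -> (0 < k)%N ->
    (1 - r)^-1 / L <= 1 / 2 ->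
    2 * (Rpower L c * ((1 - r)^-1 / L) ^+ 2) <= 1 / 4 ->
    0 <= t -> (k + 3)%:R * t <= 1 / 16 ->
  `|exp (Rpower (L + ln (1 + t)%R)%R c - Rpower L c)%R
    - \sum_(j < k.+1) expansion_coef c L k j * t ^+ j| <=
    60 * Rpower 2 lam * (4 * (lam + (2 * k + 4)%:R) * t) ^+ k.+1.
Proof.
move=> c12 L1 /andP[r2 r1] k0 q2 HS t0 tk.
have r01 : 0 <= r < 1 by rewrite r1 andbT; lra.
rewrite -(horner_coef_wide _ (local_poly_size _ _ _)).
apply: local_expansion => // n.
have := series_coef_small k n c12 L1 r01 q2 HS.
suff : \sum_(i < n) `|(series_poly (phase_coef c L) k)`_i.+1| * (1 / 2) ^+ i.+1 <=
   \sum_(i < n) `|(series_poly (phase_coef c L) k)`_i.+1| * r ^+ i.+1 by lra.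
apply: ler_sum => i _; rewrite ler_wpM2l // lerXn2r ?nnegrE; lra.
Qed.

Lemma expansion_coef_near (c L r : R) (k j : nat) (lam := c * (Rpower L c / L)) :
    1 <= c <= 2 -> 1 <= L -> 0 <= r < 1 -> (j <= k)%N ->
    (1 - r)^-1 / L <= 1 / 2 ->
    2 * (Rpower L c * ((1 - r)^-1 / L) ^+ 2) <= 1 / 4 ->
    j%:R <= r * lam ->
  1 / 2 <= expansion_coef c L k j <= 2 * (lam + j%:R) ^+ j.
Proof.
move=> c12 L1 r01 jk q2 HS jl; have /andP[r0 r1] := r01; have /andP[c1 _] := c12.
have lam0 : 0 <= lam.
  rewrite mulr_ge0 ?divr_ge0 ?Rpower_ge0 //; lra.
have jl1 : j%:R <= lam by apply: le_trans jl _; rewrite ler_piMl // ltW.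
have r01' : 0 <= r <= 1 by rewrite r0 ltW.
have := local_poly_coef_near jk jl1 jl r01' (series_poly0 _ k)
  (series_coef_small k j c12 L1 r01 q2 HS).
move=> /andP[h1 h2]; have g1 := gbin_ge1 jl1.
have g2 : gbin lam j <= (lam + j%:R) ^+ j.
  have := gbin_abs_le lam j; rewrite (ger0_norm lam0); apply: le_trans.
  exact: ler_norm.
apply/andP; split; first by apply: le_trans h1; lra.
by apply: le_trans h2 _; rewrite ler_wpM2l.
Qed.

End LocalExpansion.

(** * The dyadic sum *)
Module Numerics.
Set Implicit Arguments. Unset Strict Implicit. Unset Printing Implicit Defensive.

Section Numerics.
Variables (delta g kr L : R).
Hypotheses (Hd : 0 < delta <= 1 / 4) (Hg : 8 <= g) (Hk : 6 * g <= delta * kr)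
  (HL : 2000 * kr ^ 7 <= delta * L).

Lemma kr_large : 192 <= kr.
Proof. nra. Qed.

Lemma kr_g : 24 * g <= kr.
Proof. assert (H := kr_large). nra. Qed.

Lemma kr_pow_step (n : nat) : 192 * kr ^ n <= kr ^ S n.
Proof.
  assert (H := kr_large). simpl.
  apply Rmult_le_compat_r; [apply pow_le; lra | exact H].
Qed.

Lemma kr_pows : 192 * kr <= kr ^ 2 /\ 192 * kr ^ 2 <= kr ^ 3 /\ 192 * kr ^ 3 <= kr ^ 4 /\
  192 * kr ^ 4 <= kr ^ 5 /\ 192 * kr ^ 5 <= kr ^ 6 /\ 192 * kr ^ 6 <= kr ^ 7.
Proof.
  assert (H1 := kr_pow_step 1). rewrite pow_1 in H1.
  repeat split; auto; apply kr_pow_step.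
Qed.

Lemma L_large : 8000 * kr ^ 7 <= L.
Proof.
  assert (H := kr_pows). assert (H0 := kr_large).
  assert (0 < L) by (apply Rnot_le_lt; intro; nra).
  nra.
Qed.

(** The Taylor error has the factor [t^(k + 1)] with [t <= exp (- delta L)]. As
    [delta * kr >= 6 * g], it beats [|xi| h(n)], which is about [exp (kappa L)] with
    [kappa <= 2 * g]. *)
Lemma err_numeric (kappa : R) : kappa <= 2 * g ->
  kappa * L + 12 * g + 6 + kr + (kr + 1) * (16 * kr - delta * L) <= - L.
Proof.
  intros Hk2. assert (H1 := kr_pows). assert (H2 := kr_large). assert (H3 := L_large).
  assert (H4 := kr_g).
  assert (L0 : 0 < L) by lra.
  assert (A1 : kappa * L <= 2 * (g * L)) by nra.
  assert (A2 : 6 * (g * L) <= kr * (delta * L)) by nra.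
  assert (A3 : 8 * L <= g * L) by nra.
  replace ((kr + 1) * (16 * kr - delta * L)) with
    (16 * kr ^ 2 + 16 * kr - kr * (delta * L) - delta * L) by ring.
  lra.
Qed.

(** Here [d] is [kappa - j], with [j] the selected degree. *)
Lemma upper_numeric (d : R) : d <= -1 ->
  d * L + 12 * g + 1 + 2 * kr ^ 2 <= - (L / 2).
Proof.
  intros Hd2. assert (H1 := kr_pows). assert (H2 := kr_large). assert (H3 := L_large).
  assert (H4 := kr_g). nra.
Qed.

(** [kappa >= 8 * delta] and [j <= kappa + 2] give [kappa - delta * j >= 4 * delta], so the
    coefficient times [M ^ (2 * j)] stays large even for small [kappa]. The lower bound on [|xi|]
    enters here. *)
Lemma lower_numeric (kappa j lP : R) :
    8 * delta <= kappa -> 0 <= j <= kr -> j <= kappa + 2 -> 0 <= lP <= 17 * kr ^ 3 ->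
  2 * (delta * L) <= kappa * L - 1 - j * (L + 1) + j * ((1 - delta) * L - 2 * lP).
Proof.
  intros Hkap Hj Hjk HP.
  assert (H1 := kr_pows). assert (H2 := kr_large). assert (H3 := L_large).
  assert (A1 : 4 * delta <= kappa - delta * j) by nra.
  assert (A2 : j * lP <= kr * (17 * kr ^ 3)) by (apply Rmult_le_compat; lra).
  replace (kr * (17 * kr ^ 3)) with (17 * kr ^ 4) in A2 by ring.
  replace (kappa * L - 1 - j * (L + 1) + j * ((1 - delta) * L - 2 * lP)) with
    ((kappa - delta * j) * L - 1 - j - 2 * (j * lP)) by ring.
  assert (A3 : 4 * (delta * L) <= (kappa - delta * j) * L).
  { replace (4 * (delta * L)) with (4 * delta * L) by ring.
    apply Rmult_le_compat_r; lra. }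
  lra.
Qed.

Lemma exp_kr_large : kr ^ 4 / 256 <= exp kr.
Proof.
  assert (H := kr_large). assert (H1 := exp_ineq1_le (kr / 4)).
  replace kr with (kr / 4 + kr / 4 + kr / 4 + kr / 4) at 2 by field.
  rewrite 3!exp_plus.
  replace (kr ^ 4 / 256) with (kr / 4 * (kr / 4) * (kr / 4) * (kr / 4)) by field.
  repeat apply Rmult_le_compat; try lra;
    repeat apply Rmult_le_pos; lra.
Qed.

(** The excess of the mean value costs at most [delta * L / 4] thanks to [exp (- kr)]: this is what
    the many iteration steps buy. The constants are of order [kr ^ 7] and fit into another quarter
    by [HL]. *)
Lemma mean_numeric (mu lP sr : R) :
    0 <= mu <= L / 2 -> 0 <= lP <= 17 * kr ^ 3 -> 1 <= sr <= 3 * kr ^ 3 ->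
  kr * (kr + 1) * exp (- kr) * mu +
    2 * kr ^ 2 * (ln 4 + (2 * sr + 1) * ln sr + lP * (kr + kr ^ 2)) +
    (2 * kr + 2) * ln (2 * sr) + 4 - delta * L <= - (delta * L / 2).
Proof.
  intros Hmu HP Hs.
  assert (H1 := kr_pows). assert (H2 := kr_large). assert (H3 := L_large).
  assert (ln_le : forall x, 0 < x -> ln x <= x - 1).
  { intros x Hx. assert (H := exp_ineq1_le (ln x)). rewrite exp_ln in H; lra. }
  assert (l2 := ln_le 2 ltac:(lra)). assert (l3 := ln_le 3 ltac:(lra)).
  assert (l4 := ln_le 4 ltac:(lra)). assert (lk := ln_le kr ltac:(lra)).
  assert (l1 : 0 <= ln sr) by (rewrite <- ln_1; apply Rcomplements.ln_le; lra).
  assert (ls : ln sr <= 3 * kr).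
  { apply Rle_trans with (ln (3 * kr ^ 3)); [apply Rcomplements.ln_le; lra |].
    rewrite ln_mult, ln_pow by (try apply pow_lt; lra). simpl INR. lra. }
  rewrite (ln_mult 2 sr) by lra.
  assert (A1 : (2 * sr + 1) * ln sr <= (6 * kr ^ 3 + 1) * (3 * kr)) by
    (apply Rmult_le_compat; lra).
  assert (A2 : lP * (kr + kr ^ 2) <= 17 * kr ^ 3 * (kr + kr ^ 2)) by
    (apply Rmult_le_compat; lra).
  set (A := ln 4 + (2 * sr + 1) * ln sr + lP * (kr + kr ^ 2)).
  assert (A3 : A <= 18 * kr ^ 5).
  { unfold A.
    replace ((6 * kr ^ 3 + 1) * (3 * kr)) with (18 * kr ^ 4 + 3 * kr) in A1 by ring.
    replace (17 * kr ^ 3 * (kr + kr ^ 2)) with (17 * kr ^ 4 + 17 * kr ^ 5) in A2 by ring.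
    lra. }
  assert (A4 : 2 * kr ^ 2 * A <= 36 * kr ^ 7).
  { replace (36 * kr ^ 7) with (2 * kr ^ 2 * (18 * kr ^ 5)) by ring.
    apply Rmult_le_compat_l; lra. }
  assert (A5 : (2 * kr + 2) * (ln 2 + ln sr) <= (3 * kr) * (4 * kr)).
  { apply Rmult_le_compat; try lra. assert (0 <= ln 2); [|lra].
    rewrite <- ln_1; apply Rcomplements.ln_le; lra. }
  assert (A6 : kr * (kr + 1) * exp (- kr) <= delta / 2).
  { rewrite exp_Ropp. assert (H := exp_kr_large). assert (E := exp_pos kr).
    apply Rmult_le_reg_r with (exp kr); [exact E |].
    rewrite Rmult_assoc, Rinv_l, Rmult_1_r by lra.
    apply Rle_trans with (delta / 2 * (kr ^ 4 / 256)); [|apply Rmult_le_compat_l; lra].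
    replace (delta / 2 * (kr ^ 4 / 256)) with (delta * kr * (kr ^ 3 / 512)) by field.
    apply Rle_trans with (48 * (kr ^ 3 / 512)); [|apply Rmult_le_compat_r; lra].
    replace (kr * (kr + 1)) with (kr ^ 2 + kr) by ring. lra. }
  assert (A7 : kr * (kr + 1) * exp (- kr) * mu <= delta / 2 * (L / 2)).
  { apply Rmult_le_compat; try lra. apply Rmult_le_pos; [nra|]. left; apply exp_pos. }
  replace (3 * kr * (4 * kr)) with (12 * kr ^ 2) in A5 by ring.
  replace (delta / 2 * (L / 2)) with (delta * L / 4) in A7 by field.
  lra.
Qed.
End Numerics.

End Numerics.

(** * The bound for one dyadic block *)

Module Dyadic.
Import all_boot all_order all_fingroup all_algebra all_field.
Import all_classical all_reals Rstruct complex.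
Import zify MeanValue ExponentialSums WeylBound.
Import FormalExpansion Taylor LocalExpansion Numerics.
Set Implicit Arguments. Unset Strict Implicit. Unset Printing Implicit Defensive.
Import Order.TTheory GRing.Theory Num.Theory.
Local Open Scope ring_scope.
Local Open Scope R_scope.

Lemma exp_ge_id x : x <= exp x.
Proof. by have := exp_ineq1_le x; lra. Qed.

Lemma exp_neg_le x : 0 < x -> exp (- x) <= / x.
Proof.
by move=> x0; rewrite exp_Ropp; apply: Rinv_le_contravar => //; apply: exp_ge_id.
Qed.

Lemma natr_mulE (x : R) n : (x *+ n)%R = x * INR n.
Proof. by rewrite -mulr_natr -INRE. Qed.

Lemma expansion_approx_R (c L r t : R) (k : nat) (lam := c * (Rpower L c / L)) :
    1 <= c <= 2 -> 1 <= L -> 1 / 2 <= r < 1 -> (0 < k)%N ->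
    / (1 - r) / L <= 1 / 2 ->
    2 * (Rpower L c * (/ (1 - r) / L) ^ 2) <= 1 / 4 ->
    0 <= t -> INR (k + 3)%N * t <= 1 / 16 ->
  Rabs (exp (Rpower (L + ln (1 + t)) c - Rpower L c)
    - (\sum_(j < k.+1) expansion_coef c L k j * t ^+ j)%R) <=
    60 * Rpower 2 lam * (4 * (lam + INR (2 * k + 4)) * t) ^ k.+1.
Proof.
move=> [/RleP c1 /RleP c2] /RleP L1 [/RleP r1 /RltP r2] k0 q2 HS /RleP t0 tk.
have n16 : (16%:R)%R = IZR 16 :> R by rewrite natr_IZR.
have n4 : (4%:R)%R = IZR 4 :> R by rewrite natr_IZR.
have n60 : (60%:R)%R = IZR 60 :> R by rewrite natr_IZR.
have := @expansion_approx c L r t k.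
rewrite n16 n4 n60 => /(_ _ _ _ k0 _ _ _ _) H.
apply/RleP; rewrite RabsE RpowE INRE; apply: H => //.
- by apply/andP.
- by apply/andP.
- by apply/RleP; exact: q2.
- by move: HS; rewrite RpowE => /RleP.
by move: tk; rewrite INRE => /RleP.
Qed.

Lemma expansion_coef_near_R (c L r : R) (k j : nat) (lam := c * (Rpower L c / L)) :
    1 <= c <= 2 -> 1 <= L -> 0 <= r < 1 -> (j <= k)%N ->
    / (1 - r) / L <= 1 / 2 ->
    2 * (Rpower L c * (/ (1 - r) / L) ^ 2) <= 1 / 4 ->
    INR j <= r * lam ->
  1 / 2 <= expansion_coef c L k j <= 2 * (lam + INR j) ^ j.
Proof.
move=> [/RleP c1 /RleP c2] /RleP L1 [/RleP r1 /RltP r2] jk q2 HS jl.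
have n4 : (4%:R)%R = IZR 4 :> R by rewrite natr_IZR.
have := @expansion_coef_near c L r k j; rewrite n4 => /(_ _ _ _ jk _ _ _) H.
have /andP[/RleP H1 /RleP H2] : (1 / 2 <= expansion_coef c L k j <= 2 * (lam + j%:R) ^+ j)%R.
  apply: H => //.
  - by apply/andP.
  - by apply/andP.
  - by apply/RleP; exact: q2.
  - by move: HS; rewrite RpowE => /RleP.
  by move: jl; rewrite INRE => /RleP.
by rewrite RpowE INRE; split.
Qed.

Lemma h_exp (c x : R) : 1 < x -> h c x = exp (Rpower (ln x) c).
Proof.
move=> x1; rewrite /h /rpow; case: RIneq.Req_EM_T => // l0.
by have := ln_increasing 1 x; rewrite ln_1; lra.
Qed.

(** First-order Taylor for [(1 + u / L)^c]; the constant is [(c + 1) * 2^c <= 3 * 4]. *)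
Lemma Rpower_increment (c L u : R) : 1 <= c <= 2 -> 1 <= L -> 0 <= u <= 1 ->
  0 <= Rpower (L + u) c - Rpower L c <= 12 * Rpower L (c - 1).
Proof.
move=> c12 L1 u01.
have iL : 0 < / L <= 1.
  split; first by apply: Rinv_0_lt_compat; lra.
  by rewrite -Rinv_1; apply: Rinv_le_contravar; lra.
have uL : 0 <= u / L <= 1 by rewrite /Rdiv; nra.
have E : Rpower (L + u) c = Rpower L c * Rpower (1 + u / L) c.
  by rewrite Rpower_mult_distr; [congr Rpower; field; lra|lra|lra].
have E2 : Rpower L c = Rpower L (c - 1) * L.
  by rewrite -{3}(Rpower_1 L) -?Rpower_plus; [congr Rpower; ring|lra].
have g0 : 0 < Rpower L (c - 1) by apply: exp_pos.
have := @taylor_power c 1 1 c (u / L) ltac:(lra) ltac:(lra) uL.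
have -> : (binom_poly c 1).[(u / L)%R]%R = 1.
  by rewrite horner_poly big_ord1 gbin0 expr0 mulr1.
rewrite pow_1 pow_1 (Rabs_right c); last lra.
have R2 : Rpower (1 + 1) c <= 4.
  apply: (Rle_trans _ (Rpower 2 (INR 2))); first by apply: Rle_Rpower; rewrite /=; lra.
  by rewrite Rpower_pow /=; lra.
have R1 : 1 <= Rpower (1 + u / L) c.
  by have := Rle_Rpower (1 + u / L) 0 c; rewrite Rpower_O; lra.
rewrite Rabs_right; last lra.
move=> H; split.
  by rewrite E; have : 0 < Rpower L c by [apply: exp_pos]; nra.
have H2 : Rpower (1 + u / L) c - 1 <= 12 * (u / L).
  have R0 : 0 < Rpower (1 + 1) c by apply: exp_pos.
  have : (c + INR 1) * Rpower (1 + 1) c <= 12 by rewrite [INR 1]/=; nra.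
  move: H; set q := _ * Rpower (1 + 1) c; move: (Rpower (1 + _) c) => z; nra.
have -> : Rpower (L + u) c - Rpower L c = Rpower L (c - 1) * (L * (Rpower (1 + u / L) c - 1)).
  by rewrite E E2; ring.
rewrite [12 * _]Rmult_comm; apply: Rmult_le_compat_l; first lra.
have : L * (12 * (u / L)) = 12 * u by field; lra.
nra.
Qed.

Lemma exp_le_le_inv x y : exp x <= exp y -> x <= y.
Proof. by move=> H; apply: Rnot_lt_le => /exp_increasing; lra. Qed.

Section DyadicSum.
Variables (c theta rho delta r xi : R) (N k : nat).
Let L := ln (INR N).
Let g := Rpower L (c - 1).
Let kr := INR k.
Let Lam := / (1 - r).
(** [Hgr] places the selected degree below [r * lam], [Hk] makes the Taylor error negligible, [HL]
    keeps the losses of the mean value below the saving, [HLam] and [HLam1] make the correction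
    series small at radius [r]. *)
Hypotheses (Hc : 1 < c < 8 / 7) (Hth : 0 < theta < c - 1)
  (Hdelta : 0 < delta <= 1 / 4) (Hrho : 8 * delta <= rho) (Hr : 1 / 2 <= r < 1)
  (Hgr : (1 + theta) * g + 2 <= r * (c * g)) (Hg : 8 <= g)
  (Hk : 6 * g <= delta * kr) (HL : 2000 * kr ^ 7 <= delta * L)
  (HLam : 64 * Lam ^ 2 * kr <= L) (HLam1 : 4 * Lam <= L)
  (Hxi : / h c (INR N) * Rpower (INR N) rho <= Rabs xi <= Rpower (h c (INR N)) theta).

Let kr192 : 192 <= kr := kr_large Hdelta Hg Hk.
Let krg : 24 * g <= kr := kr_g Hdelta Hg Hk.
Let L0 : 8000 * kr ^ 7 <= L := L_large Hdelta Hg Hk HL.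

Let L1 : 8000 * 192 <= L.
Proof.
have [_ [_ [_ [_ [_ H]]]]] := kr_pows Hdelta Hg Hk.
have : 1 <= kr ^ 6 by apply: pow_R1_Rle; lra.
lra.
Qed.

Let N1 : 1 < INR N.
Proof.
case: (Rlt_le_dec 1 (INR N)) => // H; have : L <= 0; last by move: L1; lra.
rewrite /L; case: (Rle_lt_dec (INR N) 0) => N0.
  rewrite /ln; case: Rlt_dec => H1; last exact: Rle_refl.
  by case: (Rlt_not_le _ _ H1 N0).
by rewrite -ln_1; exact: Rcomplements.ln_le.
Qed.

Let RpowL : Rpower L c = g * L.
Proof.
by rewrite /g -{3}(Rpower_1 L) -?Rpower_plus; [congr Rpower; ring | lra].
Qed.

Let hN : h c (INR N) = exp (g * L).
Proof. by rewrite h_exp // -RpowL. Qed.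

Let kappa := ln (Rabs xi) / L + g.

Let xiE : Rabs xi = exp ((kappa - g) * L).
Proof.
have -> : (kappa - g) * L = ln (Rabs xi) by rewrite /kappa; field; lra.
rewrite exp_ln //; case: Hxi => H _; apply: Rlt_le_trans H.
by apply: Rmult_lt_0_compat; [rewrite hN; apply/Rinv_0_lt_compat/exp_pos | apply: exp_pos].
Qed.

Let kappa_bounds : rho <= kappa <= (1 + theta) * g.
Proof.
case: Hxi; rewrite hN xiE -exp_Ropp /Rpower -exp_plus ln_exp -/L => H1 H2.
have {}H1 := exp_le_le_inv H1; have {}H2 := exp_le_le_inv H2.
split; apply: (Rmult_le_reg_r L); lra.
Qed.

Let kappa_le : kappa <= 2 * g.
Proof.
have [_ H] := kappa_bounds; apply: Rle_trans H _.
by apply: Rmult_le_compat_r; lra.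
Qed.

Section Point.
Variable n : nat.
Hypothesis Hn : (N < n <= 2 * N)%N.
Let Ln := ln (INR n).
Let lam := c * (Rpower Ln c / Ln).

Let nN : INR N <= INR n <= 2 * INR N.
Proof.
have /andP[h1 h2] := Hn; split; first by apply: INR_le; apply: ltnW.
by have := INR_le h2; rewrite INR_muln [INR 2]/=; lra.
Qed.

Let Ln_bounds : L <= Ln <= L + 1.
Proof.
split; first by apply: Rcomplements.ln_le; lra.
apply: (Rle_trans _ (ln (2 * INR N))); first by apply: Rcomplements.ln_le; lra.
rewrite ln_mult; [|lra|lra]; rewrite -/L.
have := exp_ineq1_le (ln 2); rewrite exp_ln; lra.
Qed.

Let nE : INR n = exp Ln.
Proof. by rewrite exp_ln; lra. Qed.

Let power_bounds : g * L <= Rpower Ln c <= g * L + 12 * g.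
Proof.
have := @Rpower_increment c L (Ln - L) ltac:(lra) ltac:(lra) ltac:(lra).
have -> : L + (Ln - L) = Ln by ring.
rewrite RpowL -/g; lra.
Qed.

Let hn : h c (INR n) = exp (Rpower Ln c).
Proof. by rewrite h_exp //; lra. Qed.

Let ratio_bounds : g <= Rpower Ln c / Ln <= 2 * g.
Proof.
have E : Rpower Ln c = Rpower Ln (c - 1) * Ln.
  by rewrite -{3}(Rpower_1 Ln) -?Rpower_plus; [congr Rpower; ring | lra].
have -> : Rpower Ln c / Ln = Rpower Ln (c - 1) by rewrite E; field; lra.
split; first by apply: Rle_Rpower_l; lra.
apply: (Rmult_le_reg_r Ln); first lra.
rewrite -E; nra.
Qed.

Let lam_bounds : c * g <= lam <= 3 * g.
Proof. rewrite /lam; nra. Qed.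

Let lam_ge0 : 0 <= lam.
Proof. by case: lam_bounds => H _; apply: Rle_trans H; apply: Rmult_le_pos; lra. Qed.

Let small1 : Lam / Ln <= 1 / 4.
Proof.
have Lam0 : 0 < Lam by apply: Rinv_0_lt_compat; lra.
apply: (Rmult_le_reg_r Ln); first lra.
have -> : Lam / Ln * Ln = Lam by field; lra.
lra.
Qed.

Let small2 : 2 * (Rpower Ln c * (Lam / Ln) ^ 2) <= 1 / 4.
Proof.
have Lam0 : 0 < Lam by apply: Rinv_0_lt_compat; lra.
have -> : Rpower Ln c * (Lam / Ln) ^ 2 = (Rpower Ln c / Ln) * Lam ^ 2 / Ln by field; lra.
apply: (Rmult_le_reg_r Ln); first lra.
have -> : 2 * (Rpower Ln c / Ln * Lam ^ 2 / Ln) * Ln = 2 * (Rpower Ln c / Ln) * Lam ^ 2.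
  by field; lra.
have l2 : 0 <= Lam ^ 2 by apply: pow2_ge_0.
have : 2 * (Rpower Ln c / Ln) * Lam ^ 2 <= (kr / 6) * Lam ^ 2.
  by apply: Rmult_le_compat_r => //; lra.
lra.
Qed.

Definition local_coef (j : nat) : R :=
  xi * h c (INR n) * (expansion_coef c Ln k j / INR n ^ j).

Lemma local_coef_approx (z : nat) : INR z <= exp ((1 - delta) * L) ->
  Rabs (xi * h c (INR (n + z)) - (\sum_(j < k.+1) local_coef j *+ (z ^ j)%N)%R) <= exp (- L).
Proof.
move=> Hz; pose t := INR z / INR n.
have n0 : 0 < INR n by lra.
have t0 : 0 <= t by apply: Rmult_le_pos; [apply: pos_INR | left; apply: Rinv_0_lt_compat].
have tE : INR (n + z) = INR n * (1 + t).
  by rewrite plus_INR /t; field; lra.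
have td : t <= exp (- (delta * L)).
  have -> : - (delta * L) = (1 - delta) * L + - L by ring.
  rewrite exp_plus; apply: Rmult_le_compat => //; first exact: pos_INR.
    by left; apply: Rinv_0_lt_compat.
  by rewrite exp_Ropp; apply: Rinv_le_contravar; [apply: exp_pos | rewrite nE; apply: exp_le; lra].
have k7 : 2000 * kr <= delta * L.
  have := kr_pows Hdelta Hg Hk; lra.
have td2 : t <= / (delta * L).
  by apply: Rle_trans td _; apply: exp_neg_le; lra.
have tk : INR (k + 3)%N * t <= 1 / 16.
  rewrite plus_INR -/kr [INR 3]/=.
  have i0 : t <= / (2000 * kr) by apply: Rle_trans td2 _; apply: Rinv_le_contravar; lra.
  have : (kr + (1 + 1 + 1)) * t <= (2 * kr) * / (2000 * kr).
    by apply: Rmult_le_compat => //; lra.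
  have -> : (2 * kr) * / (2000 * kr) = 1 / 1000 by field; lra.
  lra.
have k0 : (0 < k)%N.
  by rewrite lt0n; apply/eqP => k0; move: kr192; rewrite /kr k0 /=; lra.
have := @expansion_approx_R c Ln r t k ltac:(lra) ltac:(lra) Hr k0 ltac:(rewrite -/Lam; lra) small2 t0 tk.
rewrite -/lam => H.
have -> : xi * h c (INR (n + z)) - (\sum_(j < k.+1) local_coef j *+ (z ^ j)%N)%R =
  xi * h c (INR n) * (exp (Rpower (Ln + ln (1 + t)) c - Rpower Ln c) -
     (\sum_(j < k.+1) expansion_coef c Ln k j * t ^+ j)%R).
  rewrite Rmult_minus_distr_l; congr Rminus.
    rewrite tE h_exp; last by have := Rmult_le_pos _ _ (Rlt_le _ _ n0) t0; lra.
    rewrite hn Rmult_assoc -exp_plus ln_mult; [|lra|lra].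
    by rewrite -/Ln; congr (_ * exp _); ring.
  rewrite RmultE mulr_sumr; apply: eq_bigr => j _.
  rewrite natr_mulE /local_coef INR_expn -RpowE -!RmultE /t Rpow_mult_distr pow_inv.
  by rewrite /Rdiv; ring.
rewrite !Rabs_mult xiE hn [Rabs (exp _)]Rabs_right; last by left; apply: exp_pos.
set W := 60 * _ * _ in H.
apply: (Rle_trans _ (exp ((kappa - g) * L) * exp (Rpower Ln c) * W)).
  by apply: Rmult_le_compat_l => //; apply: Rmult_le_pos; left; apply: exp_pos.
(* Factor by factor: [60 <= 2 ^ 6 <= exp 6], [2 ^ lam <= exp kr], and [4 * (lam + 2 * k + 4) <= 16 *
   kr <= exp (16 * kr)]. *)
have HW : W <= exp (6 + kr + (kr + 1) * (16 * kr - delta * L)).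
  rewrite !exp_plus /W; apply: Rmult_le_compat.
  - by apply: Rmult_le_pos; [lra | left; apply: exp_pos].
  - apply: pow_le; rewrite plus_INR; apply: Rmult_le_pos => //.
    by have := pos_INR (2 * k)%N; have := pos_INR 4; lra.
  - apply: Rmult_le_compat; [lra | left; apply: exp_pos | |].
      have -> : 6 = INR 6 * 1 by rewrite /=; ring.
      rewrite -exp_natmul; have := pow_incr 2 (exp 1) 6; have := exp_ge_id 1.
      have := exp_ineq1_le 1; rewrite [2 ^ 6]/=; lra.
    rewrite /Rpower; apply: exp_le.
    have := exp_ineq1_le (ln 2); rewrite exp_ln; last lra.
    move=> l2; have : lam * ln 2 <= lam * 1 by apply: Rmult_le_compat_l; lra.
    lra.
  rewrite [(kr + 1) * _](_ : _ = INR k.+1 * (16 * kr - delta * L)); last by rewrite S_INR.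
  rewrite -exp_natmul; apply: pow_incr; split.
    apply: Rmult_le_pos => //; rewrite plus_INR.
    by have := pos_INR (2 * k)%N; have := pos_INR 4; lra.
  rewrite /Rminus exp_plus; apply: Rmult_le_compat => //.
    rewrite plus_INR; have := pos_INR (2 * k)%N; have := pos_INR 4; lra.
  apply: Rle_trans (exp_ge_id _); rewrite plus_INR mult_INR -/kr [INR 2]/= [INR 4]/=; lra.
apply: (Rle_trans _ (exp ((kappa - g) * L) * exp (g * L + 12 * g) *
   exp (6 + kr + (kr + 1) * (16 * kr - delta * L)))).
  apply: Rmult_le_compat => //.
  - by apply: Rmult_le_pos; left; apply: exp_pos.
  - by apply: Rle_trans H; apply: Rabs_pos.
  - by apply: Rmult_le_compat_l; [left; apply: exp_pos | apply: exp_le; lra].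
rewrite -!exp_plus; apply: exp_le.
have := err_numeric Hdelta Hg Hk HL kappa_le; lra.
Qed.

(** The coefficient is [exp ((kappa - g) L + Ln^c - j Ln)] times [expansion_coef], and
    [j <= r * lam] keeps the latter between [1 / 2] and [exp (1 + 2 * kr ^ 2)]. As
    [kappa - j <= -1], the result is about [1 / N] at most before losses. *)
Lemma local_coef_bounds (j : nat) : (j <= k)%N -> kappa + 1 <= INR j <= kappa + 2 ->
  exp (kappa * L - 1 - INR j * (L + 1)) <= Rabs (local_coef j) <= exp (- (L / 2)).
Proof.
move=> jk Hj.
have jkr : INR j <= kr by apply: INR_le.
have jl : INR j <= r * lam.
  have [_ H] := kappa_bounds; have : r * (c * g) <= r * lam by apply: Rmult_le_compat_l; lra.
  lra.
have [K1 K2] := @expansion_coef_near_R c Ln r k j ltac:(lra) ltac:(lra) ltac:(lra) jk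
  ltac:(rewrite -/Lam; lra) small2 jl.
rewrite -/lam in K2.
have -> : Rabs (local_coef j) =
    exp ((kappa - g) * L + Rpower Ln c - INR j * Ln) * expansion_coef c Ln k j.
  rewrite /local_coef !Rabs_mult xiE hn !(Rabs_right (exp _)); [|left; exact: exp_pos..].
  rewrite /Rdiv (Rabs_right (expansion_coef _ _ _ _)); last lra.
  rewrite nE exp_natmul -exp_Ropp Rabs_right; last by left; apply: exp_pos.
  by rewrite /Rminus !exp_plus; ring.
set E := expansion_coef _ _ _ _ in K1 K2 *.
have j0 := pos_INR j.
split.
  have -> : kappa * L - 1 - INR j * (L + 1) = kappa * L - INR j * (L + 1) + - (1) by ring.
  rewrite exp_plus; apply: Rmult_le_compat; [by left; apply: exp_pos.. | |].
    have jl2 : INR j * Ln <= INR j * (L + 1) by apply: Rmult_le_compat_l; lra.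
    apply: exp_le; lra.
  rewrite exp_Ropp; apply: Rle_trans K1.
  have e1 := exp_ineq1_le 1; have := Rinv_le_contravar 2 (exp 1) ltac:(lra) ltac:(lra); lra.
apply: (Rle_trans _ (exp (kappa * L + 12 * g - INR j * L) * exp (1 + 2 * kr ^ 2))).
  apply: Rmult_le_compat; [by left; apply: exp_pos | lra | |].
    have jl2 : INR j * L <= INR j * Ln by apply: Rmult_le_compat_l; lra.
    apply: exp_le; lra.
  apply: Rle_trans K2 _; rewrite exp_plus; apply: Rmult_le_compat; [lra | | |].
  - by apply: pow_le; lra.
  - by have := exp_ineq1_le 1; lra.
  apply: (Rle_trans _ (exp (INR j * (2 * kr)))).
    rewrite -exp_natmul; apply: pow_incr; split; first lra.
    by apply: Rle_trans (exp_ge_id _); lra.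
  apply: exp_le; have : INR j * (2 * kr) <= kr * (2 * kr) by apply: Rmult_le_compat_r; lra.
  rewrite /=; lra.
rewrite -exp_plus; apply: exp_le.
have := @upper_numeric delta g kr L Hdelta Hg Hk HL (kappa - INR j) ltac:(lra); lra.
Qed.

Lemma local_weyl (P m : nat) (mu := INR m * ln (INR P)) :
    prime P -> (4 * k ^ 2 <= P)%N -> ln (INR P) <= 17 * kr ^ 3 ->
    (1 - delta) * L - 2 * ln (INR P) <= 2 * mu <= (1 - delta) * L ->
  nm (poly_phase_sum k (P ^ m) local_coef) <= exp (2 * mu - delta * L / (36 * kr ^ 6)).
Proof.
move=> pP kP lP Hmu.
have [ka1 ka2] := kappa_bounds.
(* The integer part of [kappa + 2], so [kappa + 1 < j0 <= kappa + 2]. *)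
have [j0 [Hj1 Hj2]] : {j | INR j <= kappa + 2 < INR j + 1} by apply: nfloor_ex; lra.
have jkr : INR j0 <= kr by lra.
have jk : (j0 <= k)%N by apply/ssrnat.leP/RIneq.INR_le.
have k0 : (0 < k)%N.
  by rewrite lt0n; apply/eqP => k0; move: kr192; rewrite /kr k0 /=; lra.
have [B1 B2] := local_coef_bounds jk ltac:(lra).
set al := Rabs (local_coef j0) in B1 B2 *.
have al0 : 0 < al by apply: Rlt_le_trans B1; apply: exp_pos.
pose eta := sqrt al.
have eta0 : 0 < eta by apply: sqrt_lt_R0.
have eta2 : eta ^ 2 = al by rewrite /eta /= Rmult_1_r sqrt_sqrt; lra.
have lP0 : 0 <= ln (INR P).
  rewrite -ln_1; apply: Rcomplements.ln_le; first lra.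
  by rewrite -[1]/(INR 1); apply: INR_le; apply: prime_gt0.
have al_half : al <= 1 / 2.
  have := @exp_neg_le (L / 2) ltac:(lra); have := Rinv_le_contravar 2 (L / 2) ltac:(lra) ltac:(lra); lra.
have ev : eta <= exp (- (delta * L)).
  apply: (@le_exp_of_pow _ _ 2) => //; first lra.
  rewrite eta2; apply: Rle_trans B2 _; apply: exp_le; rewrite [INR 2]/=.
  have := Rmult_le_compat_r L _ _ ltac:(lra) (proj2 Hdelta); lra.
have s0 : (0 < k ^ 3 + k ^ 2 + k)%N by rewrite addn_gt0 k0 orbT.
have P0 : (0 < P)%N := prime_gt0 pP.
(* As [eta] is a square root, the claim reduces to [exp (2 * delta * L) <= M ^ (2 * j0) * al], which
   is [lower_numeric]. *)
have Hv : exp (delta * L) <= INR ((k ^ 3 + k ^ 2 + k) * (P ^ m) ^ j0).+1 * eta.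
  have ME : INR ((P ^ m) ^ j0)%N = exp (INR j0 * mu).
    by rewrite -expnM INR_expn_exp // INR_muln /mu; congr exp; ring.
  apply: (Rle_trans _ (exp (INR j0 * mu) * eta)); last first.
    apply: Rmult_le_compat_r; first lra.
    by rewrite -ME; apply: INR_le; apply: leqW; rewrite leq_pmull.
  have -> : exp (delta * L) = sqrt (exp (2 * (delta * L))).
    have -> : 2 * (delta * L) = delta * L + delta * L by ring.
    by rewrite exp_plus sqrt_square //; left; apply: exp_pos.
  have -> : exp (INR j0 * mu) = sqrt (exp (INR j0 * (2 * mu))).
    have -> : INR j0 * (2 * mu) = INR j0 * mu + INR j0 * mu by ring.
    by rewrite exp_plus sqrt_square //; left; apply: exp_pos.
  rewrite -sqrt_mult; [|by left; apply: exp_pos|lra].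
  apply: sqrt_le_1_alt.
  apply: (Rle_trans _ (exp (INR j0 * (2 * mu)) * exp (kappa * L - 1 - INR j0 * (L + 1)))).
    rewrite -exp_plus; apply: exp_le.
    have := @lower_numeric delta g kr L Hdelta Hg Hk HL kappa (INR j0) (ln (INR P))
      ltac:(lra) (conj (pos_INR j0) jkr) Hj1 (conj lP0 lP).
    have : INR j0 * ((1 - delta) * L - 2 * ln (INR P)) <= INR j0 * (2 * mu).
      by apply: Rmult_le_compat_l; [apply: pos_INR | lra].
    lra.
  by apply: Rmult_le_compat_l => //; left; apply: exp_pos.
have := weyl_exp_bound k0 pP kP jk eta0 eta2 al_half ev Hv.
rewrite -/kr -/mu; set s := (k ^ 3 + k ^ 2 + k)%N.
have sE : INR s = kr ^ 3 + kr ^ 2 + kr by rewrite /s !plus_INR !INR_expn.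
have [q1 [q2 _]] := kr_pows Hdelta Hg Hk.
have s1 : 1 <= INR s by rewrite sE; lra.
have s3 : INR s <= 3 * kr ^ 3 by rewrite sE; lra.
have mu0 : 0 <= mu by apply: Rmult_le_pos => //; apply: pos_INR.
have dL0 : 0 <= delta * L by apply: Rmult_le_pos; lra.
have mu2 : mu <= L / 2 by lra.
have := @mean_numeric delta g kr L Hdelta Hg Hk HL mu (ln (INR P)) (INR s)
  (conj mu0 mu2) (conj lP0 lP) (conj s1 s3).
set X := _ + 4 - _ => HX H; apply: Rle_trans H _; apply: exp_le.
have sp : 0 < 2 * INR s ^ 2 by have := pow_lt (INR s) 2 ltac:(lra); lra.
have : X / (2 * INR s ^ 2) <= - (delta * L / (36 * kr ^ 6)); last lra.
apply: (Rle_trans _ (- (delta * L / 2) * / (2 * INR s ^ 2))).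
  by apply: Rmult_le_compat_r => //; left; apply: Rinv_0_lt_compat.
have s9 : INR s ^ 2 <= 9 * kr ^ 6.
  have -> : 9 * kr ^ 6 = (3 * kr ^ 3) ^ 2 by ring.
  by apply: pow_incr; lra.
have -> : - (delta * L / 2) * / (2 * INR s ^ 2) = - (delta * L * / (4 * INR s ^ 2)).
  by field; lra.
apply: Ropp_le_contravar; apply: Rmult_le_compat_l => //.
by apply: Rinv_le_contravar; lra.
Qed.

End Point.

(** The three terms are the bilinear bound, the approximation error times the Lipschitz constant 8,
    and the boundary terms of shifts up to [M ^ 2 <= N ^ (1 - delta)]. *)
Lemma dyadic_sum_bound :
  Cmod (sum_n_m (fun n => Defs.e (h c (INR n) * xi)) (N + 1) (2 * N)) <=
  INR N * (exp (- (delta * L / (36 * kr ^ 6))) + 8 * exp (- L) + 2 * exp (- (delta * L))).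
Proof.
have k0 : (0 < k)%N.
  by rewrite lt0n; apply/eqP => k0; move: kr192; rewrite /kr k0 /=; lra.
have [P [pP kP lP]] := prime_large k0; rewrite -/kr in lP.
have P0 : (0 < P)%N := prime_gt0 pP.
have lP0 : 0 < ln (INR P).
  rewrite -ln_1; apply: ln_increasing; first lra.
  by rewrite -[1]/(INR 1); apply/lt_INR/ssrnat.ltP/prime_gt1.
have dL : delta * L <= 1 / 4 * L by apply: Rmult_le_compat_r; lra.
(* The largest [m] with [P ^ (2 * m) <= N ^ (1 - delta)]; rounding loses at most a factor
   [P ^ 2]. *)
have [m [Hm1 Hm2]] : {m | INR m <= (1 - delta) * L / (2 * ln (INR P)) < INR m + 1}.
  by apply: nfloor_ex; apply: Rmult_le_pos; [lra | left; apply: Rinv_0_lt_compat; lra].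
pose mu := INR m * ln (INR P).
have Hmu : (1 - delta) * L - 2 * ln (INR P) <= 2 * mu <= (1 - delta) * L.
  have E : (1 - delta) * L / (2 * ln (INR P)) * (2 * ln (INR P)) = (1 - delta) * L.
    by field; lra.
  have := Rmult_le_compat_r (2 * ln (INR P)) _ _ ltac:(lra) Hm1.
  have := Rmult_le_compat_r (2 * ln (INR P)) _ _ ltac:(lra) (Rlt_le _ _ Hm2).
  by rewrite E /mu; lra.
pose M := (P ^ m)%N.
have M0 : (0 < M)%N by rewrite expn_gt0 P0.
have MM : INR (M * M) = exp (2 * mu).
  rewrite INR_muln /M INR_expn_exp // -exp_plus /mu; congr exp; ring.
rewrite addn1 mul2n -addnn.
rewrite (Cmod_sum_cis (fun n => h c (INR n) * xi)).
set B := exp (2 * mu - delta * L / (36 * kr ^ 6)).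
have Hn i : (i < N)%N -> (N < N.+1 + i <= 2 * N)%N.
  by move=> iN; rewrite addSn ltnS leq_addr mul2n -addnn ltn_add2l.
have := @averaging_poly (fun n => h c (INR n) * xi)
  (fun i => local_coef (N.+1 + i)%N) N.+1 N M k (exp (- L)) B.
have -> : (8%:R)%R = IZR 8 :> R by rewrite natr_IZR.
move=> /(_ _ _ M0) key; apply: (Rle_trans _ (INR N * (B / INR (M * M) + 8 * exp (- L)) + INR (2 * (M * M)))).
  rewrite !INRE; apply/RleP; apply: key => [i iN|i z iN zM].
    by apply/RleP; apply: local_weyl => //; apply: Hn.
  apply/RleP; rewrite -RabsE [_ * xi]Rmult_comm; apply: local_coef_approx; first exact: Hn.
  have := INR_le zM; rewrite MM => zM'; apply: Rle_trans zM' _; apply: exp_le; lra.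
rewrite [INR (2 * _)]INR_muln MM [INR 2]/=.
have -> : B / exp (2 * mu) = exp (- (delta * L / (36 * kr ^ 6))).
  by rewrite /B /Rminus exp_plus; field; apply/Rgt_not_eq/exp_pos.
have : exp (2 * mu) <= INR N * exp (- (delta * L)).
  have -> : INR N = exp L by rewrite exp_ln //; lra.
  by rewrite -exp_plus; apply: exp_le; lra.
lra.
Qed.
End DyadicSum.

Lemma Cmod_sum_e_le (f : nat -> R) (N : nat) :
  Cmod (sum_n_m (fun n => Defs.e (f n)) (N + 1) (2 * N)) <= INR N.
Proof.
rewrite addn1 mul2n -addnn Cmod_sum_cis INRE; apply/RleP.
have := nm_sum (fun _ : 'I_N => true) (fun i : 'I_N => cis (f (N.+1 + i)%N)).
by under [X in (_ <= X)%R]eq_bigr do rewrite nm_cis; rewrite sumr_const card_ord.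
Qed.

End Dyadic.

(** * Choice of the parameters and conclusion *)

Lemma Rpower_ge_eventually (a B : R) : 0 < a ->
  exists L0, 1 <= L0 /\ forall L, L0 <= L -> B <= Rpower L a.
Proof.
  intros Ha. exists (Rmax 1 (Rpower (Rmax 1 B) (/ a))). split; [apply Rmax_l|].
  intros L HL.
  assert (H1 := Rmax_l 1 B). assert (H2 := Rmax_r 1 B).
  assert (H3 := Rmax_r 1 (Rpower (Rmax 1 B) (/ a))).
  apply Rle_trans with (Rpower (Rpower (Rmax 1 B) (/ a)) a).
  - rewrite Rpower_mult, Rinv_l, Rpower_1 by lra. exact H2.
  - apply Rle_Rpower_l; [lra|]. split; [apply exp_pos|lra].
Qed.

(** Includes [x = 0], which is [log N] at [N = 1]. *)
Lemma rpow_le_base (x y a : R) : 0 <= x <= y -> 1 <= y -> 0 < a <= 1 -> rpow x a <= y.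
Proof.
  intros Hx Hy Ha. unfold rpow. destruct Req_EM_T; [lra|].
  apply Rle_trans with (Rpower y a); [apply Rle_Rpower_l; lra|].
  rewrite <- (Rpower_1 y) at 2 by lra. apply Rle_Rpower; lra.
Qed.

Lemma ln_INR_nonneg (N : nat) : (1 <= N)%nat -> 0 <= ln (INR N).
Proof.
  intros HN. rewrite <- ln_1. apply Rcomplements.ln_le; [lra|].
  change 1 with (INR 1). apply le_INR, HN.
Qed.

Lemma large_bound (c theta rho : R) : 1 < c < 8 / 7 -> 0 < theta < c - 1 -> 0 < rho ->
  exists L0, 1 <= L0 /\ forall (N : nat) (xi : R), L0 <= ln (INR N) ->
    / h c (INR N) * Rpower (INR N) rho <= Rabs xi <= Rpower (h c (INR N)) theta ->
    Cmod (sum_n_m (fun n : nat => e (h c (INR n) * xi)) (N + 1) (2 * N))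
      <= 11 * INR N * exp (- Rpower (ln (INR N)) (8 - 7 * c)).
Proof.
  intros Hc Hth Hrho.
  set (delta := Rmin (1 / 4) (rho / 8)).
  assert (Hd1 : delta <= 1 / 4) by apply Rmin_l.
  assert (Hd2 : delta <= rho / 8) by apply Rmin_r.
  assert (Hd0 : 0 < delta) by (apply Rmin_glb_lt; lra).
  (* The midpoint of [(1 + theta) / c] and [1], which differ because [theta < c - 1]. *)
  set (r := ((1 + theta) / c + 1) / 2).
  assert (Er : r * c = (1 + theta + c) / 2) by (unfold r; field; lra).
  assert (Hr : 1 / 2 <= r < 1) by nra.
  set (Lam := / (1 - r)).
  assert (HLam0 : 0 < Lam) by (apply Rinv_0_lt_compat; lra).
  (* Thresholds: [G1] for the gap between [(1 + theta) * g] and [r * c * g], [G2] for the final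
     saving, [Q1] for [k ^ 7] against [L], [Q2] for the correction series. *)
  set (G1 := 4 / (c - 1 - theta)). set (G2 := 36 * 7 ^ 6 / delta ^ 7).
  set (Q1 := 2000 * 7 ^ 7 / delta ^ 8). set (Q2 := 448 * Lam ^ 2 / delta).
  destruct (Rpower_ge_eventually (c - 1) (Rmax (Rmax 8 (/ delta)) (Rmax G1 G2)) ltac:(lra))
    as [L1 [HL1 HG]].
  destruct (Rpower_ge_eventually (8 - 7 * c) (Rmax (Rmax Q1 Q2) (4 * Lam)) ltac:(lra))
    as [L2 [HL2 HQ]].
  exists (Rmax L1 L2). split; [assert (H := Rmax_l L1 L2); lra|].
  intros N xi HL Hxi. set (L := ln (INR N)) in *.
  specialize (HG L (Rle_trans _ _ _ (Rmax_l _ _) HL)).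
  specialize (HQ L (Rle_trans _ _ _ (Rmax_r _ _) HL)).
  assert (HL1' := Rle_trans _ _ _ (Rmax_l _ _) HL).
  set (g := Rpower L (c - 1)) in *. set (Q := Rpower L (8 - 7 * c)) in *.
  assert (g8 : 8 <= g) by (eapply Rle_trans; [|exact HG];
    eapply Rle_trans; [|apply Rmax_l]; apply Rmax_l).
  assert (gd : / delta <= g) by (eapply Rle_trans; [|exact HG];
    eapply Rle_trans; [|apply Rmax_l]; apply Rmax_r).
  assert (g1 : G1 <= g) by (eapply Rle_trans; [|exact HG];
    eapply Rle_trans; [|apply Rmax_r]; apply Rmax_l).
  assert (g2 : G2 <= g) by (eapply Rle_trans; [|exact HG];
    eapply Rle_trans; [|apply Rmax_r]; apply Rmax_r).
  assert (q1 : Q1 <= Q) by (eapply Rle_trans; [|exact HQ];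
    eapply Rle_trans; [|apply Rmax_l]; apply Rmax_l).
  assert (q2 : Q2 <= Q) by (eapply Rle_trans; [|exact HQ];
    eapply Rle_trans; [|apply Rmax_l]; apply Rmax_r).
  assert (q3 : 4 * Lam <= Q) by (eapply Rle_trans; [|exact HQ]; apply Rmax_r).
  clear HG HQ.
  (* Since [(8 - 7 * c) + 7 * (c - 1) = 1]. Of the seven factors [g], six pay for [k ^ 6] in the
     saving and the last one for the constant [G2]. *)
  assert (EL : L = Q * g ^ 7).
  { unfold Q, g. rewrite <- Rpower_pow, Rpower_mult, <- Rpower_plus by apply exp_pos.
    replace (8 - 7 * c + (c - 1) * INR 7) with 1 by (simpl; ring).
    rewrite Rpower_1; lra. }
  assert (Q0 : 0 < Q) by apply exp_pos.
  assert (g6 : 1 <= g ^ 6) by (apply pow_R1_Rle; lra).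
  assert (g7 : g <= g ^ 7) by (change (g ^ 7) with (g * g ^ 6); nra).
  assert (QL : Q <= L) by (rewrite EL; nra).
  assert (dpos : forall n, 0 < delta ^ n) by (intro; apply pow_lt, Hd0).
  (* With [7] in place of the required [6], taking the integer part loses at most [delta <= g]. *)
  destruct (nfloor_ex (7 * g / delta)) as [k [Hk1 Hk2]].
  { apply Rmult_le_pos; [lra | left; apply Rinv_0_lt_compat, Hd0]. }
  set (kr := INR k) in *.
  assert (E7 : 7 * g / delta * delta = 7 * g) by (field; lra).
  assert (kd : 6 * g <= delta * kr) by nra.
  assert (kr0 : 0 <= kr) by apply pos_INR.
  assert (kpow : forall n, kr ^ n <= 7 ^ n * g ^ n / delta ^ n).
  { intro n. apply Rle_trans with ((7 * g / delta) ^ n); [apply pow_incr; lra|].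
    right. unfold Rdiv. rewrite !Rpow_mult_distr, pow_inv. reflexivity. }
  assert (A1 : 2000 * kr ^ 7 <= delta * L).
  { apply Rle_trans with (2000 * (7 ^ 7 * g ^ 7 / delta ^ 7)).
    - apply Rmult_le_compat_l; [lra | apply kpow].
    - rewrite EL. apply Rle_trans with (delta * (Q1 * g ^ 7)).
      + right; unfold Q1; field; lra.
      + apply Rmult_le_compat_l; [lra|]. apply Rmult_le_compat_r; lra. }
  assert (A2 : 64 * Lam ^ 2 * kr <= L).
  { apply Rle_trans with (64 * Lam ^ 2 * (7 * g / delta)).
    - apply Rmult_le_compat_l; [|lra]. assert (H := pow2_ge_0 Lam); lra.
    - apply Rle_trans with (Q2 * g); [right; unfold Q2; field; lra|].
      rewrite EL. apply Rmult_le_compat; try lra.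
      unfold Q2. apply Rmult_le_pos; [assert (H := pow2_ge_0 Lam); lra|].
      left; apply Rinv_0_lt_compat, Hd0. }
  assert (A3 : Q <= delta * L / (36 * kr ^ 6)).
  { assert (kr1 : 0 < kr) by nra. assert (kp : 0 < kr ^ 6) by (apply pow_lt, kr1).
    apply Rmult_le_reg_r with (36 * kr ^ 6); [lra|].
    replace (delta * L / (36 * kr ^ 6) * (36 * kr ^ 6)) with (delta * L) by (field; lra).
    apply Rle_trans with (Q * (36 * (7 ^ 6 * g ^ 6 / delta ^ 6))).
    - apply Rmult_le_compat_l; [lra|]. apply Rmult_le_compat_l; [lra | apply kpow].
    - apply Rle_trans with (delta * (Q * (g ^ 6 * G2))).
      + right; unfold G2; field; lra.
      + rewrite EL. apply Rmult_le_compat_l; [lra|]. apply Rmult_le_compat_l; [lra|].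
        replace (g ^ 7) with (g ^ 6 * g) by ring.
        apply Rmult_le_compat_l; lra. }
  assert (A4 : Q <= delta * L).
  { apply Rle_trans with (Q * (delta * g)).
    2: { rewrite EL. replace (Q * (delta * g)) with (delta * (Q * g)) by ring.
      apply Rmult_le_compat_l; [lra|]. apply Rmult_le_compat_l; lra. }
    rewrite <- (Rmult_1_r Q) at 1. apply Rmult_le_compat_l; [lra|].
    apply Rmult_le_compat_l with (r := delta) in gd; [|lra].
    rewrite Rinv_r in gd; lra. }
  assert (A5 : (1 + theta) * g + 2 <= r * (c * g)).
  { replace (r * (c * g)) with ((1 + theta + c) / 2 * g) by (rewrite <- Er; ring).
    assert (2 <= (c - 1 - theta) / 2 * g); [|lra].
    apply Rmult_le_compat_l with (r := (c - 1 - theta) / 2) in g1; [|lra].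
    unfold G1 in g1.
    replace ((c - 1 - theta) / 2 * (4 / (c - 1 - theta))) with 2 in g1 by (field; lra).
    exact g1. }
  assert (A6 : 4 * / (1 - r) <= ln (INR N)) by (fold Lam L; lra).
  assert (A7 : 8 * delta <= rho) by lra.
  assert (B := Dyadic.dyadic_sum_bound Hc Hth (conj Hd0 Hd1)
    A7 Hr A5 g8 kd A1 A2 A6 Hxi).
  eapply Rle_trans; [exact B|]. fold L kr.
  (* Each exponential is at most [exp (- Q)], with weights [1 + 8 + 2 = 11]. *)
  rewrite (Rmult_comm 11), Rmult_assoc. apply Rmult_le_compat_l; [apply pos_INR|].
  assert (X : forall y, Q <= y -> exp (- y) <= exp (- Q)).
  { intros y Hy. apply MeanValue.exp_le. lra. }
  assert (X1 := X _ A3). assert (X2 := X _ A4). assert (X3 := X _ QL). lra.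
Qed.

Theorem proposition1p16 :
  forall c : R, 1 < c < 8 / 7 ->
  exists chi : R, 0 < chi /\
  forall rho theta : R, 0 < rho -> 0 < theta < c - 1 ->
  exists K : R, 0 < K /\
  forall (N : nat) (xi : R), (1 <= N)%nat ->
    / h c (INR N) * Rpower (INR N) rho <= Rabs xi <= Rpower (h c (INR N)) theta ->
    Cmod (sum_n_m (fun n : nat => e (h c (INR n) * xi)) (N + 1) (2 * N))
      <= K * INR N * exp (- rpow (ln (INR N)) chi).
Proof.
  intros c Hc. exists (8 - 7 * c). split; [lra|]. intros rho theta Hrho Hth.
  destruct (large_bound c theta rho Hc Hth Hrho) as [L0 [HL0 Hlarge]].
  (* For [log N < L0] the trivial bound [N] suffices: there [(log N)^chi <= L0], and [exp L0]
     compensates. *)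
  exists (11 + exp L0). assert (E0 := exp_pos L0). split; [lra|].
  intros N xi HN Hxi. assert (l0 := ln_INR_nonneg N HN). assert (N0 := pos_INR N).
  set (E := exp (- rpow (ln (INR N)) (8 - 7 * c))).
  assert (E1 : 0 < E) by apply exp_pos.
  assert (NE : 0 <= INR N * E) by (apply Rmult_le_pos; lra).
  destruct (Rle_lt_dec L0 (ln (INR N))) as [H|H].
  - apply Rle_trans with (11 * INR N * E).
    + unfold E, rpow. destruct Req_EM_T; [lra|]. apply Hlarge; assumption.
    + nra.
  - eapply Rle_trans; [apply Dyadic.Cmod_sum_e_le|].
    assert (1 <= exp L0 * E); [|nra].
    unfold E. rewrite <- exp_plus, <- exp_0. apply MeanValue.exp_le.
    assert (R0 := rpow_le_base (ln (INR N)) L0 (8 - 7 * c) ltac:(lra) HL0 ltac:(lra)). lra.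
Qed.
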